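(* Let $(X_t)_{t\ge 0}$ be the gamma process with parameters $a=b=1$, so that for each $t>0$ the random variable $X_t$ has law \[ d\mathcal{P}_{X_t}(x) = 1_{(0,\infty)}(x)\,\frac{1}{\Gamma(t)}\,x^{t-1}e^{-x}\,dx. \] Then there is a constant $C>0$ such that for all sufficiently large $t$, \[ \Bigl|\,\mathbb{E}\,|\zeta(1/2+iX_t)|^2 - \log t\,\Bigr| \le C\sqrt{\log t}\,\log\log t, \] i.e. $\mathbb{E}\,|\zeta(1/2+iX_t)|^2 = \log t + O(\sqrt{\log t}\,\log\log t)$.
   Context: $\zeta$ denotes the Riemann zeta function. The gamma process with parameters $a=b=1$ is the pure-jump increasing Lévy process with independent gamma-distributed increments whose time-$t$ marginal has density $x^{t-1}e^{-x}/\Gamma(t)$ on $(0,\infty)$; in particular $\mathbb{E}X_t=t$, $\mathrm{Var}X_t=t$ and $\mathbb{E}e^{iuX_t}=(1-iu)^{-t}$. Only the marginal laws of $X_t$ enter the statement. *)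

(* Defs.v *)
From HB Require Import structures.
From mathcomp Require Import all_boot all_order all_algebra.
From mathcomp Require Import all_classical all_reals all_analysis.
From mathcomp Require Import complex.
Set Implicit Arguments. Unset Strict Implicit. Unset Printing Implicit Defensive.
Import Order.TTheory GRing.Theory Num.Theory.
Import numFieldNormedType.Exports.
Local Open Scope classical_set_scope.
Local Open Scope ring_scope.
Local Open Scope complex_scope.

Section Zeta.
Variable R : realType.

(* n^{-(1/2 + i x)} = n^{-1/2} (cos (x ln n) - i sin (x ln n)), for n >= 1 *)
Definition npow_crit (x : R) (n : nat) : R[i] :=
  let a := (n%:R : R) `^ (- 2^-1) in
  (a * cos (x * ln n%:R)) -i* (a * sin (x * ln n%:R)).

Definition eta_partial (x : R) (N : nat) : R[i] :=
  \sum_(1 <= n < N.+1) ((-1) ^+ n.+1 * npow_crit x n).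

Definition eta_crit (x : R) : R[i] :=
  limn (fun N => complex.Re (eta_partial x N)) +i* limn (fun N => complex.Im (eta_partial x N)).

Definition two_pow_one_minus_s (x : R) : R[i] :=
  (Num.sqrt 2 * cos (x * ln 2)) -i* (Num.sqrt 2 * sin (x * ln 2)).

(* Riemann zeta on the critical line:
   zeta(s) = eta(s) / (1 - 2^{1-s}), valid for Re s > 0 (here Re s = 1/2) *)
Definition zeta_crit (x : R) : R[i] :=
  eta_crit x / (1 - two_pow_one_minus_s x).

Definition zeta_crit_sq (x : R) : R :=
  complex.Re (zeta_crit x) ^+ 2 + complex.Im (zeta_crit x) ^+ 2.

Definition Gamma (t : R) : R :=
  fine (\int[lebesgue_measure]_(x in `]0%R, +oo[) (x `^ (t - 1) * expR (- x))%:E)%E.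

Definition gamma_density (t x : R) : R :=
  if 0 < x then x `^ (t - 1) * expR (- x) / Gamma t else 0.

End Zeta.

(* Main.v *)
(* Let S_N(x) be the sum of n^(-1/2 - ix) over n <= N, with N close to 4t. For t/2 <= x <= 2t the
   Kusmin-Landau inequality gives zeta(1/2 + ix) = S_N(x) + O(1). Outside this window the squared
   error is O(x + t), and the gamma law gives E [(X_t + t + 1) (X_t - t)^2] = O(t^2). Hence
   E |zeta - S_N|^2 = O(1), and passing from E |S_N|^2 to E |zeta|^2 costs O(sqrt (log t)).

   Now E |S_N|^2 is the harmonic sum log t + O(1) plus twice the sum over m < n <= N of
   E [cos (X_t log (n/m))] / sqrt (m n). Since E exp (i u X_t) = (1 - iu)^(-t) decays only for
   u >> 1 / sqrt t, the absolute values of these terms add up to about sqrt t, so cancellation is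
   needed. With k = n - m and y = m + k/2, the term is close to E [cos (k X_t / y)] / y, which has an
   approximate antiderivative in y; the sum over y telescopes by the midpoint rule. The upper endpoint
   y = N contributes the sum over k of E [sin (k X_(t-1) / N)] / k, up to a bounded factor, and the
   partial sums of the sawtooth series are bounded. Hence the off-diagonal sum is O(1). *)
Require Import Defs.
From HB Require Import structures.
From mathcomp Require Import all_boot all_order all_algebra.
From mathcomp Require Import all_classical all_reals all_analysis.
From mathcomp Require Import complex measurable_realfun ring lra zify.
Import Order.TTheory GRing.Theory Num.Theory.
Import numFieldNormedType.Exports.
Set Implicit Arguments. Unset Strict Implicit. Unset Printing Implicit Defensive.
Local Open Scope classical_set_scope.
Local Open Scope ring_scope.

(** * Expectations under the gamma law *)

(** The gamma law is handled through two moves. Size biasing ([x] times the density at [t] is [t]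
    times the density at [t + 1]) turns derivatives in [u] into shifts of the parameter; integration
    by parts gives [phi_t = (1 - iu) phi_(t+1)] for [phi_t(u) = E exp (i u X_t)]. The second yields
    decay in [u] without complex powers. The first yields the antiderivative:
    [y E sin (k X_(t-1) / y) / (k (t - 1))] has derivative [- E cos (k X_t / y) / y] up to
    [E sin (k X_(t-1) / y) / (k (t - 1))], and one more step of the same kind, with parameter
    [t - 2], makes the remainder summable over both variables, with total size [N^2 / t^2]. The
    choice [N ~ 4t] serves two ends: for [x] near [t] the phase increments [x log (1 + 1/n)] with
    [N < n <= 2N] stay away from the multiples of [2 pi], and the argument [x / N] of the sawtooth
    sum lies in [(0, 1]], bounded away from 0. The error [sqrt (log t)] comes only from the cross
    term between [S_N] and [zeta - S_N], whose mean squares are about [log t] and [O(1)]. *)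

Section FTC.
Context {R : realType}.
Notation mu := (@lebesgue_measure R).

(** The fundamental theorem of calculus on compact intervals exhausting the half-line, then
    dominated convergence with majorant [|f|]. *)
Lemma Rintegral_positive_half_line_derivative_eq0 (F f : R -> R) :
  (forall x : R, 0 < x -> is_derive x 1 F (f x)) ->
  (forall x : R, 0 < x -> {for x, continuous f}) ->
  mu.-integrable `]0, +oo[ (EFin \o f) ->
  F x @[x --> 0^'+] --> (0 : R) -> F x @[x --> +oo] --> (0 : R) ->
  \int[mu]_(x in `]0, +oo[) f x = 0.
Proof.
move=> dF cf intf F0 Foo.
(* The shift by two keeps [a n < 1 < b n] for every [n]. *)
pose a n : R := n.+2%:R^-1; pose b n : R := n.+2%:R.
have a0 n : 0 < a n by rewrite invr_gt0.
have ab n : a n < b n.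
  by rewrite (@lt_trans _ _ 1) ?ltr1n// invf_lt1 ?ltr1n.
pose g n := (f \_ `[a n, b n]).
have mf : measurable_fun (`]0%R, +oo[%classic : set R) f.
  by have /measurable_int/measurable_EFinP := intf.
have sub n : (`[a n, b n] `<=` (`]0%R, +oo[ : set R))%classic.
  by move=> x /=; rewrite !in_itv/= andbT => /andP[+ _]; exact: lt_le_trans.
have boo : b n @[n --> \oo] --> +oo.
  apply/cvgryPge => r; have := @nbhs_infty_ger R r.
  by apply: filterS => n /le_trans; apply; rewrite ler_nat -addn2 leq_addr.
have cvgF : F (b n) - F (a n) @[n --> \oo] --> (0:R).
  rewrite -[X in _ --> X](subr0 0); apply: cvgB.
    exact: (cvg_comp b F boo Foo).
  move/cvg_at_rightP : F0; apply; split => //.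
  rewrite -[a](_ : (fun n => (b n)^-1) = a)//; apply/gtr0_cvgV0 => //.
  by apply: nearW => n; rewrite /b.
have FTC n : (\int[mu]_(x in `[a n, b n]) (f x)%:E = (F (b n))%:E - (F (a n))%:E)%E.
  have dF' x : a n <= x -> is_derive x 1 F (f x).
    by move=> ax; apply: dF; exact: lt_le_trans ax.
  have cF x : a n <= x -> {for x, continuous F}.
    by move=> ax; apply/differentiable_continuous/derivable1_diffP; have [] := dF' x ax.
  apply: continuous_FTC2 => //.
  - apply: continuous_in_subspaceT => x /[!inE] /=; rewrite in_itv/= => /andP[ax _].
    by apply: cf; exact: lt_le_trans ax.
  - split.
    + by move=> x; rewrite in_itv/= => /andP[/ltW ax _]; have [] := dF' x ax.
    + by apply: cvg_at_right_filter; apply: cF.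
    + by apply: cvg_at_left_filter; apply: cF; exact: ltW.
  - move=> x; rewrite in_itv/= => /andP[/ltW ax _].
    by rewrite derive1E; have [? ->] := dF' x ax.
have [] := @dominated_convergence _ _ _ mu `]0, +oo[ (measurable_itv _)
   (fun n => EFin \o g n) (EFin \o f) (fun x => `|(f x)%:E|)%E.
- move=> n; apply/measurable_EFinP; apply/measurable_restrict => //.
  by apply: measurable_funS mf => // x [].
- exact/measurable_EFinP.
- apply: aeW => /= x; rewrite in_itv/= andbT => x0.
  apply: cvg_EFin; first exact: nearW.
  apply: cvg_near_cst; near=> n; rewrite /= /g patchE ifT// inE/= in_itv/=; apply/andP; split.
    by rewrite /a invf_ple ?posrE//; near: n; move/cvgryPge : boo; exact.
  by near: n; move/cvgryPge : boo; exact.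
- exact: integrable_abse.
- apply: aeW => /= x n _; rewrite /g patchE; case: ifP => // _.
  by rewrite /= normr0 lee_fin.
move=> _ _.
under eq_fun => n.
  rewrite (_ : integral _ _ _ = (F (b n))%:E - (F (a n))%:E)%E; last first.
    rewrite -FTC [RHS]integral_mkcond [LHS]integral_mkcond; apply: eq_integral => x _.
    rewrite /= !patchE /g; case: ifPn => [x0|].
      by rewrite /comp patchE; case: ifPn.
    by case: ifPn => // /set_mem/(sub n)/mem_set ->.
  over.
move=> cvgI.
have cvgE : ((F (b n))%:E - (F (a n))%:E)%E @[n --> \oo] --> (0:R)%:E.
  by apply: cvg_EFin => //; exact: nearW.
by have := cvg_unique _ cvgI cvgE; rewrite /Rintegral /comp => ->.
Unshelve. all: by end_near. Qed.
End FTC.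

Section GammaLaw.
Context {R : realType}.
Notation mu := (@lebesgue_measure R).
Notation D := (`]0%R, +oo[%classic : set R).
Implicit Types (t u x : R) (f g : R -> R).

(** [gamma_density] without its sign test. The two agree on the half-line, where all integrals below
    are taken. *)
Definition gamma_weight t x : R := x `^ (t - 1) * expR (- x) / Gamma t.

(** The expectation of [f(X_t)] as a real number. [Rintegral] has a value even for a non-integrable
    integrand, so integrability is tracked separately by [gint]. *)
Definition gexp t f : R := \int[mu]_(x in D) (f x * gamma_weight t x).

Definition gint t f := mu.-integrable D (EFin \o (fun x => f x * gamma_weight t x)).

Lemma Gamma_ge0 t : 0 <= Gamma t.
Proof.
apply: fine_ge0; apply: integral_ge0 => x _.
by rewrite lee_fin mulr_ge0 ?powR_ge0 ?expR_ge0.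
Qed.

Lemma gamma_weight_ge0 t x : 0 <= gamma_weight t x.
Proof. by rewrite !mulr_ge0 ?invr_ge0 ?Gamma_ge0 ?powR_ge0 ?expR_ge0. Qed.

Lemma gamma_densityE t x : D x -> gamma_density t x = gamma_weight t x.
Proof. by rewrite /= in_itv/= andbT /gamma_density => ->. Qed.

Lemma measurable_gamma_weight t : measurable_fun setT (gamma_weight t).
Proof.
apply: measurable_funM => //; apply: measurable_funM.
  exact: measurable_powR.
by apply: measurableT_comp => //; apply: measurable_funN.
Qed.

Lemma measurable_gamma_density t : measurable_fun setT (gamma_density t).
Proof.
rewrite /gamma_density; apply: measurable_fun_ifT => //.
  by apply: measurable_fun_ltr => //.
exact: measurable_gamma_weight.
Qed.

Lemma continuous_gamma_weight t x : 0 < x -> {for x, continuous (gamma_weight t)}.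
Proof.
move=> x0; have cp : {for x, continuous (fun y => y `^ (t - 1))}.
  apply: differentiable_continuous; apply/derivable1_diffP.
  by have [] := is_derive1_powR (t - 1) x0.
apply: cvgM; last exact: cvg_cst; apply: cvgM; first exact: cp.
apply: continuous_comp; first exact: opp_continuous.
exact: continuous_expR.
Qed.

Lemma gintD t f g : gint t f -> gint t g -> gint t (fun x => f x + g x).
Proof.
move=> intf intg; apply: eq_integrable (integrableD _ intf intg) => // x _.
by rewrite /= mulrDl.
Qed.

Lemma gintZ t c f : gint t f -> gint t (fun x => c * f x).
Proof.
move=> intf; apply: eq_integrable (integrableZl _ c intf) => // x _.
by rewrite /= -mulrA EFinM.
Qed.

Lemma gexpD t f g : gint t f -> gint t g ->
  gexp t (fun x => f x + g x) = gexp t f + gexp t g.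
Proof.
move=> intf intg; rewrite /gexp -RintegralD//.
by apply: eq_Rintegral => x _; rewrite mulrDl.
Qed.

Lemma gexpZ t c f : gint t f -> gexp t (fun x => c * f x) = c * gexp t f.
Proof.
move=> intf; rewrite /gexp -RintegralZl//.
by apply: eq_Rintegral => x _; rewrite mulrA.
Qed.

Lemma eq_gexp t f g : (forall x, 0 < x -> f x = g x) -> gexp t f = gexp t g.
Proof.
by move=> fg; apply: eq_Rintegral => x /[!inE] /=; rewrite in_itv/= andbT => /fg ->.
Qed.

Lemma eq_gint t f g : (forall x, 0 < x -> f x = g x) -> gint t f -> gint t g.
Proof.
move=> fg; apply: eq_integrable => // x /[!inE] /=.
by rewrite in_itv/= andbT => /fg ->.
Qed.

Lemma le_gexp t f g : gint t f -> gint t g ->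
  (forall x, 0 < x -> f x <= g x) -> gexp t f <= gexp t g.
Proof.
move=> intf intg fg; apply: le_Rintegral => // x /=.
by rewrite in_itv/= andbT => x0; rewrite ler_wpM2r ?gamma_weight_ge0 ?fg.
Qed.

Lemma gint_sum t (I : Type) (s : seq I) (P : pred I) (F : I -> R -> R) :
  (forall i, P i -> gint t (F i)) -> gint t (fun x => \sum_(i <- s | P i) F i x).
Proof.
move=> intF; elim: s => [|i s IH].
  apply: (@eq_gint t (fun=> 0 * 0)); first by move=> x; rewrite big_nil mul0r.
  apply: eq_integrable (integrable0 mu D) => // x _.
  by rewrite /= !mul0r.
have [Pi|Pi] := boolP (P i); last first.
  by apply: eq_gint IH => x _; rewrite big_cons (negbTE Pi).
by apply: eq_gint (gintD (intF i Pi) IH) => x _; rewrite big_cons Pi.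
Qed.

Lemma gexp_sum t (I : Type) (s : seq I) (P : pred I) (F : I -> R -> R) :
  (forall i, P i -> gint t (F i)) ->
  gexp t (fun x => \sum_(i <- s | P i) F i x) = \sum_(i <- s | P i) gexp t (F i).
Proof.
move=> intF; elim: s => [|i s IH].
  rewrite big_nil /gexp (@eq_Rintegral _ _ _ _ _ (fun=> 0)).
    by rewrite /Rintegral integral0.
  by move=> x _; rewrite big_nil mul0r.
have [Pi|Pi] := boolP (P i); last first.
  rewrite big_cons (negbTE Pi) -IH; apply: eq_gexp => x _.
  by rewrite big_cons (negbTE Pi).
rewrite big_cons Pi -IH -gexpD//; last by apply: gint_sum.
  by apply: eq_gexp => x _; rewrite big_cons Pi.
exact: intF.
Qed.

(* In the theorem this holds because [gamma_density t] is the density of a probability law; deriving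
   the facts on [Gamma] from it avoids proving that the Gamma integral converges. *)
Hypothesis mass : forall t, 0 < t ->
  (\int[mu]_(x in setT) (gamma_density t x)%:E = 1)%E.

Lemma integral_gamma_weight t : 0 < t ->
  (\int[mu]_(x in D) (gamma_weight t x)%:E = 1)%E.
Proof.
move=> t0; rewrite -(mass t0) integral_mkcond; apply: eq_integral => x _.
rewrite patchE; case: ifPn => [/set_mem/gamma_densityE -> //|].
rewrite /gamma_density => /negP Dx; case: ifPn => // x0; exfalso; apply: Dx.
by rewrite inE/= in_itv/= x0.
Qed.

(** If [Gamma t] were 0, division by it would make the weight vanish, against total mass one. A
    divergent Gamma integral is excluded at the same time, since [fine] sends [+oo] to 0. *)
Lemma Gamma_gt0 t : 0 < t -> 0 < Gamma t.
Proof.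
move=> t0; rewrite lt_neqAle Gamma_ge0 andbT; apply/eqP => G0.
have := integral_gamma_weight t0; rewrite integral0_eq => [/eqP|x _].
  by rewrite eqe eq_sym oner_eq0.
by rewrite /gamma_weight -G0 invr0 mulr0.
Qed.

Lemma gint1 t : 0 < t -> gint t (fun=> 1).
Proof.
move=> t0; apply/integrableP; split.
  apply/measurable_EFinP; apply: measurable_funM => //.
  by apply: measurable_funTS; exact: measurable_gamma_weight.
under eq_integral do rewrite /= mul1r ger0_norm ?gamma_weight_ge0//.
by rewrite integral_gamma_weight// ltry.
Qed.

Lemma gexp1 t : 0 < t -> gexp t (fun=> 1) = 1.
Proof.
move=> t0; rewrite /gexp /Rintegral.
under eq_integral do rewrite mul1r.
by rewrite integral_gamma_weight.
Qed.

Lemma gint_cst t c : 0 < t -> gint t (fun=> c).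
Proof. by move=> t0; apply: eq_gint (gintZ c (gint1 t0)) => x _; rewrite mulr1. Qed.

Lemma gexp_cst t c : 0 < t -> gexp t (fun=> c) = c.
Proof.
move=> t0; rewrite -[RHS]mulr1 -(gexp1 t0) -gexpZ//; last exact: gint1.
by apply: eq_gexp => x _; rewrite mulr1.
Qed.

Lemma le_gint t f g : measurable_fun D f -> gint t g ->
  (forall x, 0 < x -> `|f x| <= g x) -> gint t f.
Proof.
move=> mf intg fg; apply: le_integrable intg => //.
  apply/measurable_EFinP; apply: measurable_funM => //.
  by apply: measurable_funTS; exact: measurable_gamma_weight.
move=> x /=; rewrite in_itv/= andbT => x0.
rewrite lee_fin !normrM ler_wpM2r//.
by rewrite (le_trans (fg x x0))// ler_norm.
Qed.

Lemma gint_bounded t c f : 0 < t -> measurable_fun setT f ->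
  (forall x, `|f x| <= c) -> gint t f.
Proof.
by move=> t0 mf fc; apply: (le_gint _ (gint_cst c t0)) => // ; exact: measurable_funTS.
Qed.

Lemma ler_norm_gexp t c f : 0 < t -> measurable_fun setT f ->
  (forall x, `|f x| <= c) -> `|gexp t f| <= c.
Proof.
move=> t0 mf fc; have intf := gint_bounded t0 mf fc.
rewrite ler_norml; apply/andP; split.
  rewrite -(gexp_cst (- c) t0); apply: le_gexp => //; first exact: gint_cst.
  by move=> x _; have := fc x; rewrite ler_norml => /andP[].
rewrite -(gexp_cst c t0); apply: le_gexp => //; first exact: gint_cst.
by move=> x _; rewrite (le_trans (ler_norm _)).
Qed.

(** Size biasing of the gamma law. The constant is [t], but this becomes available only with
    [GammaS]. *)
Lemma gamma_weightS t x : 0 < t -> 0 < x ->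
  x * gamma_weight t x = Gamma (t + 1) / Gamma t * gamma_weight (t + 1) x.
Proof.
move=> t0 x0; rewrite /gamma_weight addrK.
have -> : x `^ t = x * x `^ (t - 1).
  rewrite -[X in X * _](powRr1 (ltW x0)) -powRD ?(gt_eqF x0) ?implybT//.
  by rewrite addrC subrK.
have := Gamma_gt0 t0; have := Gamma_gt0 (addr_gt0 t0 ltr01).
move: (Gamma t) (Gamma (t + 1)) (x `^ _) (expR _) => g g' p e g'0 g0.
by field; rewrite !gt_eqF.
Qed.

Lemma gintM t f : 0 < t -> gint (t + 1) f -> gint t (fun x => x * f x).
Proof.
move=> t0 intf; apply: eq_integrable (integrableZl _ (Gamma (t + 1) / Gamma t) intf) => //.
move=> x /[!inE] /=; rewrite in_itv/= andbT => x0.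
by rewrite mulrAC gamma_weightS// -!EFinM; congr EFin; ring.
Qed.

Let gexpM_Gamma t f : 0 < t -> gint (t + 1) f ->
  gexp t (fun x => x * f x) = Gamma (t + 1) / Gamma t * gexp (t + 1) f.
Proof.
move=> t0 intf; rewrite /gexp -RintegralZl//.
apply: eq_Rintegral => x /[!inE] /=; rewrite in_itv/= andbT => x0.
by rewrite mulrAC gamma_weightS//; ring.
Qed.

(** From [ln z < z] at [z = x / (2t)]: this gives [t ln x <= x / 2 + t ln (2t)], so half of the
    exponential survives. *)
Let powR_expRN_le t x : 0 < t -> 0 < x ->
  x `^ t * expR (- x) <= expR (t * ln (t *+ 2)) * expR (- (x / 2)).
Proof.
move=> t0 x0; rewrite /powR gt_eqF// -!expRD ler_expR.
have t2 : 0 < t *+ 2 by rewrite pmulrn_lgt0.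
have := ln_sublinear (divr_gt0 x0 t2).
rewrite ln_div ?posrE// => /ltW; rewrite lerBlDr => /(ler_wpM2l (ltW t0)).
have -> : t * (x / (t *+ 2) + ln (t *+ 2)) = x / 2 + t * ln (t *+ 2).
  by field; rewrite gt_eqF.
lra.
Qed.

(* The case [f = 1] yields [Gamma (t + 1) = t * Gamma t], after which the factor below becomes [t]. *)
Let gamma_by_parts_Gamma t (c : R) f f' : 0 < t ->
  (forall x, is_derive x 1 f (f' x)) -> continuous f' ->
  (forall x, `|f x| <= c) -> (forall x, `|f' x| <= c) ->
  t * gexp t f =
  Gamma (t + 1) / Gamma t * (gexp (t + 1) f - gexp (t + 1) f').
Proof.
move=> t0 df cf' fc f'c; set k := Gamma (t + 1) / Gamma t.
have cf : continuous f.
  by move=> x; apply/differentiable_continuous/derivable1_diffP; have [] := df x.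
have mf : measurable_fun setT f by exact: continuous_measurable_fun.
have mf' : measurable_fun setT f' by exact: continuous_measurable_fun.
have t1 : 0 < t + 1 by rewrite addr_gt0.
have if0 := gint_bounded t0 mf fc.
have if1 := gint_bounded t1 mf fc.
have if'1 := gint_bounded t1 mf' f'c.
have Gt := Gamma_gt0 t0.
(* [h] is the derivative of [F]. Since [F] vanishes at 0 like [x^t] and decays exponentially at
   infinity, the integral of [h] is 0, which is the claimed identity. *)
pose F x := x `^ t * expR (- x) / Gamma t * f x.
pose h x := t * (f x * gamma_weight t x) +
  (- k) * (f x * gamma_weight (t + 1) x) + k * (f' x * gamma_weight (t + 1) x).
have iZ a g : mu.-integrable D (EFin \o g) -> mu.-integrable D (EFin \o (fun x => a * g x)).
  by move=> ig; apply: eq_integrable (integrableZl _ a ig) => // x _; rewrite /= EFinM.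
have iD g1 g2 : mu.-integrable D (EFin \o g1) -> mu.-integrable D (EFin \o g2) ->
    mu.-integrable D (EFin \o (fun x => g1 x + g2 x)).
  by move=> ig1 ig2; apply: eq_integrable (integrableD _ ig1 ig2) => // x _; rewrite /= EFinD.
have i1 := iD _ _ (iZ t _ if0) (iZ (- k) _ if1).
have i2 := iZ k _ if'1.
have inth := iD _ _ i1 i2.
have : \int[mu]_(x in D) h x = 0.
  apply: (@Rintegral_positive_half_line_derivative_eq0 _ F) => //.
  - move=> x x0; rewrite /F.
    have H1 := is_derive1_powR t x0; have H2 := df x.
    apply: is_derive_eq; rewrite /h /k /gamma_weight addrK /GRing.scale /=.
    have := Gamma_gt0 t1; move: (Gamma t) (Gamma (t + 1)) Gt => g g' g0 g'0.
    move: (x `^ _) (x `^ _) (expR _) (f x) (f' x) => p p' e y y'.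
    by field; rewrite !gt_eqF.
  - move=> x x0; rewrite /h.
    have c1 := @continuous_gamma_weight t _ x0.
    have c2 := @continuous_gamma_weight (t + 1) _ x0.
    apply: cvgD; [apply: cvgD|]; apply: cvgM; (try exact: cvg_cst); apply: cvgM;
      [exact: cf|exact: c1|exact: cf|exact: c2|exact: cf'|exact: c2].
  - apply/norm_cvg0P; apply: (@squeeze_cvgr _ _ _ _ (fun=> 0) (fun x => x `^ t * (c / Gamma t))).
    + near=> x; rewrite normr_ge0/= /F !normrM (ger0_norm (powR_ge0 _ _)) (ger0_norm (expR_ge0 _)).
      rewrite normfV (ger0_norm (Gamma_ge0 _)) -!mulrA ler_wpM2l ?powR_ge0//.
      rewrite mulrA mulrC; apply: ler_pM => //.
      * by rewrite mulr_ge0 ?expR_ge0 ?invr_ge0 ?Gamma_ge0.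
      * rewrite ger_pMl ?invr_gt0// -expR0 ler_expR oppr_le0.
        by near: x; exact: nbhs_right_ge.
    + exact: cvg_cst.
    + rewrite -[X in _ --> X](mul0r (c / Gamma t)); apply: cvgM; last exact: cvg_cst.
      exact: powR_cvg0.
  - apply/norm_cvg0P; apply: (@squeeze_cvgr _ _ _ _ (fun=> 0)
       (fun x => expR (- (x / 2)) * (expR (t * ln (t *+ 2)) * (c / Gamma t)))).
    + near=> x; have x0 : 0 < x by near: x; exact: nbhs_pinfty_gt.
      rewrite normr_ge0/= /F !normrM (ger0_norm (powR_ge0 _ _)) (ger0_norm (expR_ge0 _)).
      rewrite normfV (ger0_norm (Gamma_ge0 _)).
      rewrite mulrA [X in _ <= X * _]mulrC -[X in X <= _]mulrA [X in _ * X <= _]mulrC.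
      apply: ler_pM => //.
      * by rewrite mulr_ge0 ?powR_ge0 ?expR_ge0.
      * by rewrite mulr_ge0 ?invr_ge0 ?Gamma_ge0.
      * exact: powR_expRN_le.
      * by rewrite ler_wpM2r ?invr_ge0 ?Gamma_ge0.
    + exact: cvg_cst.
    + rewrite -[X in _ --> X](mul0r (expR (t * ln (t *+ 2)) * (c / Gamma t))).
      apply: cvgM; last exact: cvg_cst.
      apply: (cvg_comp (fun x => x / 2) _ _ (@cvgr_expR R)).
      apply/cvgryPge => r; have : \forall x \near +oo, (r * 2 <= x :> R).
        by apply: nbhs_pinfty_ge; exact: num_real.
      by apply: filterS => x; rewrite ler_pdivlMr.
have E1 : \int[mu]_(x in D) (t * (f x * gamma_weight t x)) = t * gexp t f.
  exact: (@RintegralZl _ _ _ mu D (fun x => f x * gamma_weight t x) t (measurable_itv _) if0).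
have E2 : \int[mu]_(x in D) (- k * (f x * gamma_weight (t + 1) x)) = - k * gexp (t + 1) f.
  exact: (@RintegralZl _ _ _ mu D (fun x => f x * gamma_weight (t + 1) x) (- k) (measurable_itv _) if1).
have E3 : \int[mu]_(x in D) (k * (f' x * gamma_weight (t + 1) x)) = k * gexp (t + 1) f'.
  exact: (@RintegralZl _ _ _ mu D (fun x => f' x * gamma_weight (t + 1) x) k (measurable_itv _) if'1).
have E12 : \int[mu]_(x in D) (t * (f x * gamma_weight t x) +
    - k * (f x * gamma_weight (t + 1) x)) = t * gexp t f + - k * gexp (t + 1) f.
  rewrite -E1 -E2.
  exact: (@RintegralD _ _ _ mu D _ _ (measurable_itv _) (iZ _ _ if0) (iZ _ _ if1)).
have -> : \int[mu]_(x in D) h x = t * gexp t f + - k * gexp (t + 1) f + k * gexp (t + 1) f'.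
  by rewrite -E12 -E3; exact: (@RintegralD _ _ _ mu D _ _ (measurable_itv _) i1 i2).
move=> h0; apply/eqP; rewrite -subr_eq0 -h0; apply/eqP.
move: (gexp t f) (gexp (t + 1) f) (gexp (t + 1) f') => a b e; clearbody k; ring.
Unshelve. all: by end_near. Qed.

Lemma GammaS t : 0 < t -> Gamma (t + 1) = t * Gamma t.
Proof.
move=> t0.
have := @gamma_by_parts_Gamma t 1 (fun=> 1) (fun=> 0) t0.
rewrite !gexp1 ?addr_gt0// (gexp_cst 0) ?addr_gt0// subr0 !mulr1 => E.
rewrite [X in X * _]E//.
- by rewrite divfK// gt_eqF ?Gamma_gt0.
- by move=> x; exact: cst_continuous.
- by move=> x; rewrite normr1.
- by move=> x; rewrite normr0.
Qed.

Let GammaSV t : 0 < t -> Gamma (t + 1) / Gamma t = t.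
Proof. by move=> t0; rewrite GammaS// mulfK// gt_eqF ?Gamma_gt0. Qed.

(** A Stein-type identity for the gamma law, the source of the recurrences [gcosS] and [gsinS],
    which stand in for the closed form of the characteristic function. *)
Lemma gamma_by_parts t (c : R) f f' : 0 < t ->
  (forall x, is_derive x 1 f (f' x)) -> continuous f' ->
  (forall x, `|f x| <= c) -> (forall x, `|f' x| <= c) ->
  gexp t f = gexp (t + 1) f - gexp (t + 1) f'.
Proof.
move=> t0 df cf' fc f'c; have := gamma_by_parts_Gamma t0 df cf' fc f'c.
by rewrite GammaSV// => /mulfI; apply; rewrite gt_eqF.
Qed.

Lemma gexpM t f : 0 < t -> gint (t + 1) f ->
  gexp t (fun x => x * f x) = t * gexp (t + 1) f.
Proof. by move=> t0 intf; rewrite gexpM_Gamma// GammaSV. Qed.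

Lemma continuous_comp_mul g u : continuous g -> continuous (fun x => g (u * x)).
Proof.
move=> cg x; apply: (@continuous_comp R R R (fun y => u * y) g x); last exact: cg.
exact: mulrl_continuous.
Qed.

(** Differentiation under the integral brings out a factor [x], which size biasing absorbs into the
    parameter [t + 1]. *)
Lemma gexp_scale_is_derive t u (h h' : R -> R) : 0 < t ->
  (forall x, is_derive x 1 h (h' x)) -> continuous h' ->
  (forall x, `|h x| <= 1) -> (forall x, `|h' x| <= 1) ->
  is_derive u 1 (fun v => gexp t (fun x => h (v * x)))
    (t * gexp (t + 1) (fun x => h' (u * x))).
Proof.
move=> t0 dh ch' h1 h'1.
have t1 : 0 < t + 1 by rewrite addr_gt0.
have ch : continuous h.
  by move=> x; apply/differentiable_continuous/derivable1_diffP; have [] := dh x.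
have mscale (g : R -> R) v : continuous g -> measurable_fun setT (fun x => g (v * x)).
  by move=> cg; apply: continuous_measurable_fun; exact: continuous_comp_mul.
pose f v x := h (v * x) * gamma_weight t x.
have df (v x : R) : is_derive v 1 (f ^~ x) (x * h' (v * x) * gamma_weight t x).
  have H := dh (v * x); have Hx : is_derive v 1 (fun w : R => w * x) x.
    by apply: is_derive_eq; rewrite /GRing.scale /=; ring.
  have H1 : is_derive v 1 (fun w => h (w * x)) (x * h' (v * x)).
    apply: (is_derive_eq (@is_derive1_comp _ h (fun w => w * x) v _ _ H Hx)).
    by rewrite mulrC.
  rewrite /f; apply: is_derive_eq; rewrite /GRing.scale /=; ring.
have d1f v x : partial1of2 f v x = x * h' (v * x) * gamma_weight t x.
  by rewrite partial1of2E; have [_ ->] := df v x.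
have uI : u \in `](u - 1), (u + 1)[%R by rewrite in_itv/=; apply/andP; split; lra.
(* The dominating function for the derivative in [v], uniform in [v] because [|h'| <= 1]; its
   integrability is the finiteness of the mean. *)
pose G x := `|x| * gamma_weight t x.
have intf v : `](u - 1), (u + 1)[%classic v -> mu.-integrable D (EFin \o f v).
  by move=> _; apply: (gint_bounded t0 (mscale h v ch) (c := 1)).
have intx := gintM t0 (gint1 t1).
have G0 x : 0 <= G x by rewrite mulr_ge0 ?gamma_weight_ge0.
have intG : mu.-integrable D (EFin \o G).
  apply: eq_integrable intx => // x /[!inE] /=; rewrite in_itv/= andbT => x0.
  by rewrite /G gtr0_norm// mulr1.
have GU v x : `](u - 1), (u + 1)[%classic v -> D x -> `|partial1of2 f v x| <= G x.
  move=> _ _; rewrite d1f 2!normrM (ger0_norm (gamma_weight_ge0 _ _)).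
  by rewrite ler_wpM2r ?gamma_weight_ge0// ler_piMr.
have derf v x : `](u - 1), (u + 1)[%classic v -> D x -> derivable (f ^~ x) v 1.
  by move=> _ _; have [] := df v x.
have D1 := @derivable_under_integral R _ _ mu f D (measurable_itv _) u _ _ uI intf derf G G0 intG GU.
have := @differentiation_under_integral R _ _ mu f D (measurable_itv _) u _ _ uI intf derf G G0 intG GU.
rewrite derive1E => D2; apply: DeriveDef => //; rewrite D2.
rewrite -gexpM; [|exact: t0|exact: (gint_bounded t1 (mscale h' u ch') (c := 1))].
by apply: eq_Rintegral => x _; rewrite d1f.
Qed.

Definition gcos t u := gexp t (fun x => cos (u * x)).
Definition gsin t u := gexp t (fun x => sin (u * x)).

Lemma continuous_cosM u : continuous (fun x : R => cos (u * x)).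
Proof. by apply: continuous_comp_mul; exact: continuous_cos. Qed.

Lemma continuous_sinM u : continuous (fun x : R => sin (u * x)).
Proof. by apply: continuous_comp_mul; exact: continuous_sin. Qed.

Lemma gint_cos t u : 0 < t -> gint t (fun x => cos (u * x)).
Proof.
move=> t0; apply: (gint_bounded (c := 1) t0) => [|x]; last exact: cos_max.
by apply: continuous_measurable_fun; exact: continuous_cosM.
Qed.

Lemma gint_sin t u : 0 < t -> gint t (fun x => sin (u * x)).
Proof.
move=> t0; apply: (gint_bounded (c := 1) t0) => [|x]; last exact: sin_max.
by apply: continuous_measurable_fun; exact: continuous_sinM.
Qed.

Lemma ler_norm_gcos t u : 0 < t -> `|gcos t u| <= 1.
Proof.
move=> t0; apply: ler_norm_gexp => // [|x]; last exact: cos_max.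
by apply: continuous_measurable_fun; exact: continuous_cosM.
Qed.

Lemma ler_norm_gsin t u : 0 < t -> `|gsin t u| <= 1.
Proof.
move=> t0; apply: ler_norm_gexp => // [|x]; last exact: sin_max.
by apply: continuous_measurable_fun; exact: continuous_sinM.
Qed.

Lemma gcos_is_derive t u : 0 < t -> is_derive u 1 (gcos t) (- t * gsin (t + 1) u).
Proof.
move=> t0.
have -> : - t * gsin (t + 1) u = t * gexp (t + 1) (fun x => - sin (u * x)).
  rewrite mulNr -mulrN; congr (t * _).
  rewrite /gsin -[LHS]mulN1r -gexpZ; last by apply: gint_sin; rewrite addr_gt0.
  by apply: eq_gexp => x _; rewrite mulN1r.
apply: (@gexp_scale_is_derive t u cos (fun x => - sin x) t0).
- by move=> x; apply: cvgN; exact: continuous_sin.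
- exact: cos_max.
- by move=> x; rewrite normrN; exact: sin_max.
Qed.

Lemma gsin_is_derive t u : 0 < t -> is_derive u 1 (gsin t) (t * gcos (t + 1) u).
Proof.
move=> t0; apply: gexp_scale_is_derive => //.
- exact: continuous_cos.
- exact: sin_max.
- exact: cos_max.
Qed.

(** Together with [gsinS], the real and imaginary parts of [phi_t = (1 - iu) phi_(t+1)]. *)
Lemma gcosS t u : 0 < t -> gcos t u = gcos (t + 1) u + u * gsin (t + 1) u.
Proof.
move=> t0; have t1 : 0 < t + 1 by rewrite addr_gt0.
have d (x : R) : is_derive x 1 (fun x => cos (u * x)) (- u * sin (u * x)).
  have d1 : is_derive x 1 (fun x : R => u * x) u.
    by apply: is_derive_eq; rewrite /GRing.scale /=; ring.
  apply: (is_derive_eq (@is_derive1_comp _ cos (fun x => u * x) x _ _ (is_derive_cos _) d1)).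
  by rewrite mulrC mulrN mulNr.
rewrite /gcos (@gamma_by_parts t (1 + `|u|) (fun x => cos (u * x)) _ t0 d).
- by rewrite gexpZ ?mulNr ?opprK//; exact: gint_sin.
- by move=> x; apply: cvgM; [exact: cvg_cst|exact: continuous_sinM].
- by move=> x; rewrite (le_trans (cos_max _))// lerDl.
- move=> x; rewrite normrM normrN (le_trans (ler_piMr _ (sin_max _)))//.
  by rewrite lerDr.
Qed.

Lemma gsinS t u : 0 < t -> gsin t u = gsin (t + 1) u - u * gcos (t + 1) u.
Proof.
move=> t0; have t1 : 0 < t + 1 by rewrite addr_gt0.
have d (x : R) : is_derive x 1 (fun x => sin (u * x)) (u * cos (u * x)).
  have d1 : is_derive x 1 (fun x : R => u * x) u.
    by apply: is_derive_eq; rewrite /GRing.scale /=; ring.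
  apply: (is_derive_eq (@is_derive1_comp _ sin (fun x => u * x) x _ _ (is_derive_sin _) d1)).
  by rewrite mulrC.
rewrite /gsin (@gamma_by_parts t (1 + `|u|) (fun x => sin (u * x)) _ t0 d).
- by rewrite gexpZ//; exact: gint_cos.
- by move=> x; apply: cvgM; [exact: cvg_cst|exact: continuous_cosM].
- by move=> x; rewrite (le_trans (sin_max _))// lerDl.
- move=> x; rewrite normrM (le_trans (ler_piMr _ (cos_max _)))//.
  by rewrite lerDr.
Qed.

(** Each step of the recurrence divides the squared modulus by exactly [1 + u^2]. The start of the
    induction is the crude bound [1 + 1] at parameter [t]. *)
Lemma gcos2Dgsin2_le t u (n : nat) : 0 < t ->
  gcos (t + n%:R) u ^+ 2 + gsin (t + n%:R) u ^+ 2 <= 2 / (1 + u ^+ 2) ^+ n.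
Proof.
move=> t0; elim: n => [|n IH].
  rewrite addr0 divr1 -[2]/(1 + 1); apply: lerD.
  - by rewrite -real_normK ?num_real// expr_le1//; exact: ler_norm_gcos.
  - by rewrite -real_normK ?num_real// expr_le1//; exact: ler_norm_gsin.
have tn : 0 < t + n%:R by rewrite ltr_wpDr.
rewrite (gcosS u tn) (gsinS u tn) -addrA in IH.
rewrite -natr1; move: (gcos (t + (n%:R + 1)) u) (gsin (t + (n%:R + 1)) u) IH => a b IH.
have u2 : 0 < 1 + u ^+ 2 by rewrite ltr_wpDr ?sqr_ge0.
rewrite [(1 + u ^+ 2) ^+ n.+1]exprSr invfM mulrA ler_pdivlMr//.
apply: le_trans IH.
by rewrite le_eqVlt; apply/orP; left; apply/eqP; ring.
Qed.

Lemma gint_monomial t (n : nat) : 0 < t -> gint t (fun x => x ^+ n).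
Proof.
elim: n t => [|n IH] t t0.
  by apply: eq_gint (gint1 t0) => x _; rewrite expr0.
by apply: eq_gint (gintM t0 (IH _ (addr_gt0 t0 ltr01))) => x _; rewrite exprS.
Qed.

Lemma gexp_monomialS t (n : nat) : 0 < t ->
  gexp t (fun x => x ^+ n.+1) = t * gexp (t + 1) (fun x => x ^+ n).
Proof.
move=> t0; rewrite -gexpM//; last by apply: gint_monomial; rewrite addr_gt0.
by apply: eq_gexp => x _; rewrite exprS.
Qed.

Lemma gexp_id t : 0 < t -> gexp t (fun x => x) = t.
Proof.
move=> t0; have t1 : 0 < t + 1 by rewrite addr_gt0.
transitivity (gexp t (fun x => x * 1)); first by apply: eq_gexp => x _; rewrite mulr1.
by rewrite gexpM ?gexp1 ?mulr1//; exact: gint1.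
Qed.

Lemma gexp_sqr t : 0 < t -> gexp t (fun x => x ^+ 2) = t * (t + 1).
Proof.
move=> t0; rewrite gexp_monomialS//; congr (_ * _).
rewrite -[RHS]gexp_id ?addr_gt0//; apply: eq_gexp => x _; exact: expr1.
Qed.

Lemma gexp_cube t : 0 < t -> gexp t (fun x => x ^+ 3) = t * ((t + 1) * (t + 2)).
Proof.
by move=> t0; rewrite gexp_monomialS// gexp_sqr ?addr_gt0//; congr (_ * (_ * _)); ring.
Qed.

(** This polynomial majorizes the squared error of [S_N] outside the window around [t]: a factor
    linear in [x + t] for the growth of zeta and of [S_N], and a Chebyshev factor [(x - t)^2]. *)
Lemma gint_variance_cubic t : 0 < t ->
  gint t (fun x => (x + t + 1) * (x - t) ^+ 2).
Proof.
move=> t0.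
have H : gint t (fun x => x ^+ 3 + ((1 - t) * x ^+ 2 + (- t ^+ 2 - 2 * t) * x ^+ 1 + (t ^+ 3 + t ^+ 2))).
  by do ![apply: gintD|apply: gintZ|exact: gint_monomial|exact: gint_cst].
by apply: eq_gint H => x _; ring.
Qed.

Lemma gexp_variance_cubic t : 0 < t ->
  gexp t (fun x => (x + t + 1) * (x - t) ^+ 2) = 2 * t ^+ 2 + 3 * t.
Proof.
move=> t0.
rewrite (@eq_gexp _ _ (fun x => x ^+ 3 + ((1 - t) * x ^+ 2 + (- t ^+ 2 - 2 * t) * x + (t ^+ 3 + t ^+ 2)))); last first.
  by move=> x _; ring.
have i1 : gint t (fun x => x).
  by apply: eq_gint (gint_monomial 1 t0) => x _; exact: expr1.
have i2 := gint_monomial 2 t0.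
have ic := gint_cst (t ^+ 3 + t ^+ 2) t0.
have i3 := gint_monomial 3 t0.
have j2 := gintZ (1 - t) i2; have j1 := gintZ (- t ^+ 2 - 2 * t) i1.
rewrite (gexpD i3 (gintD (gintD j2 j1) ic)) (gexpD (gintD j2 j1) ic) (gexpD j2 j1).
rewrite (gexpZ _ i2) (gexpZ _ i1) gexp_cst// gexp_cube// gexp_sqr// gexp_id//; ring.
Qed.

Lemma gint_variance t : 0 < t -> gint t (fun x => (x - t) ^+ 2).
Proof.
move=> t0.
have H : gint t (fun x => x ^+ 2 + ((- 2 * t) * x ^+ 1 + t ^+ 2)).
  by do ![apply: gintD|apply: gintZ|exact: gint_monomial|exact: gint_cst].
by apply: eq_gint H => x _; ring.
Qed.

Lemma gexp_variance t : 0 < t -> gexp t (fun x => (x - t) ^+ 2) = t.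
Proof.
move=> t0.
rewrite (@eq_gexp _ _ (fun x => x ^+ 2 + ((- 2 * t) * x + t ^+ 2))); last first.
  by move=> x _; ring.
have i1 : gint t (fun x => x).
  by apply: eq_gint (gint_monomial 1 t0) => x _; exact: expr1.
have i2 := gint_monomial 2 t0.
have ic := gint_cst (t ^+ 2) t0.
have j1 := gintZ (- 2 * t) i1.
rewrite (gexpD i2 (gintD j1 ic)) (gexpD j1 ic) (gexpZ _ i1).
rewrite gexp_cst// gexp_sqr// gexp_id//; ring.
Qed.

End GammaLaw.

(** * From the probability space to integrals against the density *)

Section Density.
Context {R : realType} d (T : measurableType d) (P : probability T R).
Notation mu := (@lebesgue_measure R).

Notation RT := (measurableTypeR R).

(** The law of [Y] is absolutely continuous, and its Radon-Nikodym derivative equals [p] almost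
    everywhere because both have the same integral over every measurable set; change of variables
    then applies. *)
Lemma ge0_integral_comp_density (Y : T -> RT) (p f : RT -> R) :
  measurable_fun setT Y -> measurable_fun setT p -> (forall x, 0 <= p x) ->
  (forall A : set RT, measurable A ->
    P (Y @^-1` A) = (\int[mu]_(x in A) (p x)%:E)%E) ->
  measurable_fun setT f -> (forall x, 0 <= f x) ->
  (\int[P]_w (f (Y w))%:E = \int[mu]_x (f x * p x)%:E)%E.
Proof.
move=> mY mp p0 law mf f0.
pose Ym := isMeasurableFun.Build _ _ _ _ _ mY.
pose Y' : {mfun T >-> RT} := HB.pack Y Ym.
pose nu := distribution P Y'.
have mfE : measurable_fun setT (EFin \o f) by exact/measurable_EFinP.
have mpE : measurable_fun setT (EFin \o p) by exact/measurable_EFinP.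
have -> : (\int[P]_w (f (Y w))%:E = \int[nu]_x (f x)%:E)%E.
  by rewrite (@ge0_integral_pushforward _ _ _ _ _ Y mY P setT (EFin \o f))// => y _; rewrite lee_fin.
have nuE (A : set RT) : measurable A -> nu A = (\int[mu]_(x in A) (p x)%:E)%E.
  by move=> mA; rewrite -law.
have numu : nu `<< mu.
  apply/null_content_dominatesP => A mA A0.
  rewrite nuE//; apply: null_set_integral => //.
  exact: measurable_funTS.
rewrite -(@Radon_Nikodym_SigmaFinite.change_of_variables _ _ _ nu mu numu (EFin \o f) setT)//.
apply: ae_eq_integral => //.
- apply: emeasurable_funM => //.
  apply: (measurable_int mu); exact: Radon_Nikodym_SigmaFinite.f_integrable.
- by under eq_fun do rewrite EFinM; exact: emeasurable_funM.
have H : ae_eq mu setT (Radon_Nikodym_SigmaFinite.f nu mu) (EFin \o p).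
  apply: integral_ae_eq => //.
    exact: Radon_Nikodym_SigmaFinite.f_integrable.
  by move=> A _ mA; rewrite -Radon_Nikodym_SigmaFinite.f_integral//; exact: nuE.
by apply: filterS H => x H _; rewrite /= EFinM H.
Qed.

End Density.

Lemma integral_gamma_comp (R : realType) d (T : measurableType d) (P : probability T R)
    (t : R) (Y : T -> R) (f : R -> R) :
  measurable_fun setT Y ->
  (forall A : set R, measurable A ->
    P (Y @^-1` A) = (\int[lebesgue_measure]_(x in A) (gamma_density t x)%:E)%E) ->
  measurable_fun setT f -> (forall x, 0 <= f x) ->
  (\int[P]_w (f (Y w))%:E =
   \int[lebesgue_measure]_(x in `]0%R, +oo[) (f x * gamma_weight t x)%:E)%E.
Proof.
move=> mY law mf f0.
have g0 x : 0 <= gamma_density t x.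
  by rewrite /gamma_density; case: ifP => // _; exact: gamma_weight_ge0.
rewrite (ge0_integral_comp_density mY (measurable_gamma_density t) g0 law mf f0).
rewrite [RHS]integral_mkcond; apply: eq_integral => x _; rewrite patchE.
case: ifPn => [/set_mem/gamma_densityE -> //|].
rewrite notin_setE /= in_itv/= andbT => /negP; rewrite /gamma_density => /negbTE ->.
by rewrite mulr0.
Qed.

(** * Elementary estimates *)

Section MeanValue.
Context {R : realType}.
Implicit Types (f : R -> R) (a b x y h K : R).

Lemma le_mean_value f f' a b K : a <= b ->
  (forall x, a <= x <= b -> is_derive x 1 f (f' x)) ->
  (forall x, a <= x <= b -> `|f' x| <= K) -> `|f b - f a| <= K * (b - a).
Proof.
move=> ab df f'K.
have [||x] := @MVT_segment R f f' a b ab.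
- by move=> x; rewrite in_itv/= => /andP[ax xb]; apply: df; rewrite !ltW.
- apply: continuous_in_subspaceT => x /[!inE] /=; rewrite in_itv/= => axb.
  by apply/differentiable_continuous/derivable1_diffP; have [] := df x axb.
rewrite in_itv/= => axb ->; rewrite normrM (ger0_norm (_ : 0 <= b - a)) ?subr_ge0//.
by rewrite ler_wpM2r ?subr_ge0// f'K.
Qed.

Lemma midpoint_rule f0 f1 f2 f3 y h K : 0 <= h ->
  (forall x, y - h <= x <= y + h -> is_derive x 1 f0 (f1 x)) ->
  (forall x, y - h <= x <= y + h -> is_derive x 1 f1 (f2 x)) ->
  (forall x, y - h <= x <= y + h -> is_derive x 1 f2 (f3 x)) ->
  (forall x, y - h <= x <= y + h -> `|f3 x| <= K) ->
  `|f0 (y + h) - f0 (y - h) - 2 * h * f1 y| <= 2 * h ^+ 3 * K.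
Proof.
move=> h0 d0 d1 d2 f3K.
have K0 : 0 <= K by rewrite (le_trans _ (f3K y _))// lerBlDr !lerDl h0.
have dshift (g : R -> R) (g' z : R) : is_derive (y + z) 1 g g' ->
    is_derive z 1 (fun w => g (y + w)) g'.
  move=> dg; have H : is_derive z 1 (fun w : R => y + w) 1.
    by apply: is_derive_eq; ring.
  by apply: (is_derive_eq (@is_derive1_comp _ g (fun w => y + w) z _ _ dg H)); rewrite mulr1.
have dshiftN (g : R -> R) (g' z : R) : is_derive (y - z) 1 g g' ->
    is_derive z 1 (fun w => g (y - w)) (- g').
  move=> dg; have H : is_derive z 1 (fun w : R => y - w) (-1).
    by apply: is_derive_eq; ring.
  by apply: (is_derive_eq (@is_derive1_comp _ g (fun w => y - w) z _ _ dg H)); rewrite mulrN1.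
have inD z : 0 <= z <= h -> y - h <= y + z <= y + h.
  by move=> /andP[z0 zh]; apply/andP; split; lra.
have inN z : 0 <= z <= h -> y - h <= y - z <= y + h.
  by move=> /andP[z0 zh]; apply/andP; split; lra.
pose g0 z := f0 (y + z) - f0 (y - z) - 2 * z * f1 y.
pose g1 z := f1 (y + z) + f1 (y - z) - 2 * f1 y.
pose g2 z := f2 (y + z) - f2 (y - z).
have dg0 z : 0 <= z <= h -> is_derive z 1 g0 (g1 z).
  move=> zh; have H1 := dshift _ _ _ (d0 _ (inD _ zh)); have H2 := dshiftN _ _ _ (d0 _ (inN _ zh)).
  by apply: is_derive_eq; rewrite /g1 /GRing.scale /=; ring.
have dg1 z : 0 <= z <= h -> is_derive z 1 g1 (g2 z).
  move=> zh; have H1 := dshift _ _ _ (d1 _ (inD _ zh)); have H2 := dshiftN _ _ _ (d1 _ (inN _ zh)).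
  by apply: is_derive_eq; rewrite /g2 /GRing.scale /=; ring.
have g2K z : 0 <= z <= h -> `|g2 z| <= 2 * h * K.
  move=> zh; have /andP[z0 zh'] := zh.
  have sub x : y - z <= x <= y + z -> y - h <= x <= y + h.
    by move=> /andP[p q]; apply/andP; split; lra.
  have zz : y - z <= y + z by lra.
  have := le_mean_value zz (fun x xz => d2 x (sub x xz)) (fun x xz => f3K x (sub x xz)).
  by move=> H; apply: (le_trans H); nra.
have g1K z : 0 <= z <= h -> `|g1 z| <= 2 * h ^+ 2 * K.
  move=> /andP[z0 zh].
  have sub x : 0 <= x <= z -> 0 <= x <= h.
    by move=> /andP[p q]; rewrite p (le_trans q).
  have := le_mean_value z0 (fun x xz => dg1 x (sub x xz)) (fun x xz => g2K x (sub x xz)).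
  have -> : g1 0 = 0 by rewrite /g1 addr0 subr0; ring.
  rewrite !subr0 => H; apply: (le_trans H).
  have hK : 0 <= 2 * h * K by rewrite !mulr_ge0.
  by have := ler_wpM2l hK zh; lra.
have := le_mean_value h0 dg0 g1K.
have -> : g0 0 = 0 by rewrite /g0 addr0 subr0; ring.
rewrite !subr0 => H; apply: (le_trans H).
by rewrite le_eqVlt; apply/orP; left; apply/eqP; ring.
Qed.

End MeanValue.

(** * The decay majorant and elementary sums *)

Section Bump.
Context {R : realType}.
Implicit Types (t r u v x y : R).

(* A polynomial majorant for the decay of [E cos (u X_t)] and [E sin (u X_t)] on the scale
   [v ~ 1 / sqrt t]; see [c_decay]. *)
Definition bump t v : R := (1 + t * v ^+ 2 / 4)^-1.

Lemma bumpD_gt0 t v : 0 <= t -> 0 < 1 + t * v ^+ 2 / 4.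
Proof. by move=> t0; rewrite ltr_wpDr// divr_ge0// mulr_ge0// sqr_ge0. Qed.

Lemma bump_gt0 t v : 0 <= t -> 0 < bump t v.
Proof. by move=> t0; rewrite invr_gt0 bumpD_gt0. Qed.

Lemma bump_le1 t v : 0 <= t -> bump t v <= 1.
Proof.
by move=> t0; rewrite invf_le1 ?bumpD_gt0// lerDl divr_ge0// mulr_ge0// sqr_ge0.
Qed.

Lemma mul_bump_le r v : 0 < r -> v * bump (r ^+ 2) v <= r^-1.
Proof.
move=> r0; rewrite ler_pdivrMr ?bumpD_gt0 ?sqr_ge0//.
rewrite mulrC ler_pdivlMr// -subr_ge0.
have -> : 1 + r ^+ 2 * v ^+ 2 / 4 - v * r = (1 - r * v / 2) ^+ 2 by field.
exact: sqr_ge0.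
Qed.

Lemma sqr_bump_le r v : 0 < r -> v ^+ 2 * bump (r ^+ 2) v <= 4 / r ^+ 2.
Proof.
move=> r0; rewrite ler_pdivrMr ?bumpD_gt0 ?sqr_ge0//.
have -> : 4 / r ^+ 2 * (1 + r ^+ 2 * v ^+ 2 / 4) = 4 / r ^+ 2 + v ^+ 2.
  by field; rewrite gt_eqF.
by rewrite lerDr divr_ge0// sqr_ge0.
Qed.

(* [1/(a^2+k^2) <= 2/(a+k)^2 <= 2/((a+k-1)(a+k))] telescopes. *)
Lemma sum_bump_le r (x : R) (n : nat) : 0 < r -> 0 < x ->
  \sum_(1 <= k < n.+1) bump (r ^+ 2) (k%:R / x) <= 4 * x / r.
Proof.
(* With this [a], the summand is [a^2 / (a^2 + k^2)]. *)
move=> r0 x0; pose a := 2 * x / r.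
have a0 : 0 < a by rewrite divr_gt0// mulr_gt0.
suff H : \sum_(1 <= k < n.+1) bump (r ^+ 2) (k%:R / x) <=
    2 * a ^+ 2 * (a^-1 - (a + n%:R)^-1).
  apply: (le_trans H).
  have -> : 4 * x / r = 2 * a ^+ 2 * a^-1.
    by rewrite /a; field; rewrite !gt_eqF.
  apply: ler_wpM2l; first by rewrite mulr_ge0 ?sqr_ge0.
  by rewrite gerBl invr_ge0 addr_ge0// ltW.
elim: n => [|n IH]; first by rewrite big_geq// addr0 subrr mulr0.
rewrite big_nat_recr//=.
have an : 0 < a + n%:R by rewrite ltr_wpDr.
have an1 : 0 < a + n%:R + 1 by rewrite ltr_wpDr.
have n0 : 0 <= n%:R :> R by [].
rewrite -natr1; move: (n%:R) an an1 n0 IH => y an an1 y0 IH.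
have -> : 2 * a ^+ 2 * (a^-1 - (a + (y + 1))^-1) =
  2 * a ^+ 2 * (a^-1 - (a + y)^-1) + 2 * a ^+ 2 / ((a + y) * (a + y + 1)).
  by field; rewrite !gt_eqF// addrA.
apply: lerD => //; rewrite /bump.
have -> : (1 + r ^+ 2 * ((y + 1) / x) ^+ 2 / 4)^-1 = a ^+ 2 / (a ^+ 2 + (y + 1) ^+ 2).
  rewrite /a; field; rewrite !gt_eqF//.
  by apply: addr_gt0; apply: exprn_gt0; apply: mulr_gt0 => //; lra.
rewrite [2 * a ^+ 2]mulrC -[leRHS]mulrA; apply: ler_wpM2l; first exact: sqr_ge0.
have d0 : 0 < a ^+ 2 + (y + 1) ^+ 2.
  by apply: addr_gt0; apply: exprn_gt0 => //; lra.
rewrite ler_pdivlMr ?mulr_gt0// mulrC ler_pdivrMr//.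
have := sqr_ge0 (a - (y + 1)); nra.
Qed.

Lemma Bernoulli_expr (n : nat) x : 0 <= x -> 1 + n%:R * x <= (1 + x) ^+ n.
Proof.
move=> x0; elim: n => [|n IH]; first by rewrite mul0r addr0 expr0.
rewrite exprS; apply: le_trans (_ : (1 + x) * (1 + n%:R * x) <= _); last first.
  by rewrite ler_wpM2l// addr_ge0.
have := mulr_ge0 (ler0n R n) (sqr_ge0 x); rewrite -natr1; lra.
Qed.

Lemma sum_invr_sqrt_le (n : nat) :
  \sum_(1 <= k < n.+1) (Num.sqrt (k%:R : R))^-1 <= 2 * Num.sqrt n%:R.
Proof.
elim: n => [|n IH]; first by rewrite big_geq// sqrtr0 mulr0.
rewrite big_nat_recr//=; apply: (le_trans (lerD IH (lexx _))).
set x := Num.sqrt n%:R; set y := Num.sqrt n.+1%:R.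
have x0 : 0 <= x by exact: sqrtr_ge0.
have y0 : 0 < y by rewrite sqrtr_gt0.
have y2 : y ^+ 2 = x ^+ 2 + 1 by rewrite !sqr_sqrtr// natr1.
rewrite -lerBrDl -mulrBr -[y^-1]mul1r ler_pdivrMr//.
have := sqr_ge0 (y - x); lra.
Qed.

(** From [1/k <= 1/sqrt k]. The sum is later multiplied by a constant over [r], with [n <= 5 r^2],
    so a bound of order [sqrt n] is as good as a logarithm. *)
Lemma sum_invr_le (n : nat) :
  \sum_(1 <= k < n.+1) (k%:R : R)^-1 <= 2 * Num.sqrt n%:R.
Proof.
apply: le_trans (sum_invr_sqrt_le n); apply: ler_sum_nat => k /andP[k1 _].
rewrite lef_pV2 ?posrE ?sqrtr_gt0 ?ltr0n//.
rewrite -[leRHS](@sqr_sqrtr _ k%:R)// expr2 ler_peMr ?sqrtr_ge0//.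
by rewrite -[leLHS]sqrtr1 ler_wsqrtr// ler1n.
Qed.

Lemma sum_invr_sqr_from_le (a n : nat) : (1 < a)%N ->
  \sum_(a <= k < n) ((k%:R : R) ^+ 2)^-1 <= (a.-1%:R)^-1.
Proof.
case: a => [|a]//; rewrite ltnS => a0 /=.
have [na|an] := leqP n a.+1; first by rewrite big_geq// invr_ge0.
suff : forall j, \sum_(a.+1 <= k < (a.+1 + j)%N) ((k%:R : R) ^+ 2)^-1 <=
    a%:R^-1 - (a + j)%:R^-1.
  move=> /(_ (n - a.+1)%N); rewrite subnKC 1?ltnW// => H.
  by apply: (le_trans H); rewrite gerBl invr_ge0.
elim=> [|j IH]; first by rewrite big_geq ?addn0// subrr.
rewrite addnS big_nat_recr ?leq_addr//=; apply: (le_trans (lerD IH (lexx _))).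
rewrite addSn addnS -natr1.
have x0 : 0 < (a + j)%:R :> R by rewrite ltr0n ltn_addr.
move: (_ + _)%:R x0 => x x0.
rewrite -addrA lerD2l -lerBrDl opprK.
have -> : - (x + 1)^-1 + x^-1 = (x * (x + 1))^-1.
  by field; rewrite !gt_eqF//; lra.
have x1 : 0 < x + 1 by lra.
by rewrite lef_pV2 ?posrE ?mulr_gt0 ?exprn_gt0//; nra.
Qed.

Lemma sum_invr_sqr_le (n : nat) : \sum_(1 <= k < n) ((k%:R : R) ^+ 2)^-1 <= 2.
Proof.
have [n1|n1] := leqP n 1; first by rewrite big_geq.
rewrite big_ltn// expr1n invr1.
have := @sum_invr_sqr_from_le 2 n isT; rewrite /= invr1; lra.
Qed.

End Bump.

(** * Off-diagonal terms *)

Section Transform.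
Context {R : realType}.
(* [c p u] and [s p u] stand for [E cos (u X_p)] and [E sin (u X_p)]; only the relations below are used. *)
Variables (c s : R -> R -> R).
Implicit Types (p q t u v m k x y : R).
Hypothesis dc : forall p q u, 0 < p -> q = p + 1 -> is_derive u 1 (c p) (- p * s q u).
Hypothesis ds : forall p q u, 0 < p -> q = p + 1 -> is_derive u 1 (s p) (p * c q u).
Hypothesis decay : forall p u (n : nat), 0 < p ->
  c (p + n%:R) u ^+ 2 + s (p + n%:R) u ^+ 2 <= 2 / (1 + u ^+ 2) ^+ n.

(** Bernoulli turns the decay [(1 + u^2)^(-n)], with [n] of order [t], into a fixed power of [bump].
    The range [p >= t - 2] covers every shifted parameter that occurs, and the slack [3/2] leaves
    room for replacing [u] by nearby arguments. *)
Let sqr_decay t p u v : 100 <= t -> t - 2 <= p -> 0 <= v -> 3 / 2 * v <= u ->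
  c p u ^+ 2 + s p u ^+ 2 <= 2 * bump t v ^+ 6.
Proof.
move=> t100 tp v0 vu.
have t0 : 0 <= t by lra.
(* The decay is used with exponent [6 i]: [6 i <= 3t/4] keeps [p - 6 i] positive, and [i >= t/9]
   with [u^2 >= 9/4 v^2] gives [i u^2 >= t v^2 / 4]. *)
pose i := Num.trunc (t / 8).
have /andP[i1 i2] : i%:R <= t / 8 < i.+1%:R.
  by apply: truncn_itv; rewrite divr_ge0.
rewrite -[i.+1%:R]natr1 in i2.
have p0 : 0 < p - (i * 6)%:R by rewrite natrM; lra.
have := decay u (i * 6) p0; rewrite subrK => H; apply: (le_trans H).
rewrite ler_wpM2l// /bump exprVn lef_pV2 ?posrE ?exprn_gt0 ?bumpD_gt0//; last first.
  by have := sqr_ge0 u; lra.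
rewrite exprM lerXn2r ?nnegrE//; first by rewrite ltW ?bumpD_gt0.
  by rewrite exprn_ge0//; have := sqr_ge0 u; lra.
apply: (le_trans _ (Bernoulli_expr i (sqr_ge0 u))).
have u2 : 9 / 4 * v ^+ 2 <= u ^+ 2.
  have -> : 9 / 4 * v ^+ 2 = (3 / 2 * v) ^+ 2 by field.
  by rewrite lerXn2r ?nnegrE ?mulr_ge0//; apply: le_trans vu; rewrite mulr_ge0.
have i9 : t / 9 <= i%:R by lra.
have : t / 9 * (9 / 4 * v ^+ 2) <= i%:R * u ^+ 2.
  by apply: ler_pM => //; [lra|rewrite mulr_ge0 ?sqr_ge0].
lra.
Qed.

(** The third power is what the sums require: two factors absorb powers of [v] up to [v^4], and one
    is left to be summed over [k] by [sum_bump_le]. *)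
Lemma c_decay t p u v : 100 <= t -> t - 2 <= p -> 0 <= v -> 3 / 2 * v <= u ->
  `|c p u| <= 2 * bump t v ^+ 3.
Proof.
move=> t100 tp v0 vu; have H := sqr_decay t100 tp v0 vu.
have b0 : 0 < bump t v by apply: bump_gt0; lra.
have B0 : 0 <= 2 * bump t v ^+ 3 by rewrite mulr_ge0// exprn_ge0// ltW.
rewrite -(@ler_pXn2r _ 2)// ?nnegrE//.
rewrite real_normK ?num_real// exprMn -exprM.
have := sqr_ge0 (s p u); have := exprn_gt0 6 b0; lra.
Qed.

Lemma s_decay t p u v : 100 <= t -> t - 2 <= p -> 0 <= v -> 3 / 2 * v <= u ->
  `|s p u| <= 2 * bump t v ^+ 3.
Proof.
move=> t100 tp v0 vu; have H := sqr_decay t100 tp v0 vu.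
have b0 : 0 < bump t v by apply: bump_gt0; lra.
have B0 : 0 <= 2 * bump t v ^+ 3 by rewrite mulr_ge0// exprn_ge0// ltW.
rewrite -(@ler_pXn2r _ 2)// ?nnegrE//.
rewrite real_normK ?num_real// exprMn -exprM.
have := sqr_ge0 (c p u); have := exprn_gt0 6 b0; lra.
Qed.

Let dlog1 (v : R) : -1 < v < 1 ->
  is_derive v 1 (fun w => ln (1 + w) - ln (1 - w) - 2 * w) ((1 + v)^-1 + (1 - v)^-1 - 2).
Proof.
move=> /andP[v1 v2].
have p1 : 0 < 1 + v by lra. have p2 : 0 < 1 - v by lra.
have e1 : is_derive v 1 (fun w : R => 1 + w) 1 by apply: is_derive_eq; ring.
have e2 : is_derive v 1 (fun w : R => 1 - w) (-1) by apply: is_derive_eq; ring.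
have d1 := @is_derive1_comp _ _ (fun w : R => 1 + w) v _ _ (is_derive1_ln p1) e1.
have d2 := @is_derive1_comp _ _ (fun w : R => 1 - w) v _ _ (is_derive1_ln p2) e2.
have d1' : is_derive v 1 (fun w : R => ln (1 + w)) (1 + v)^-1.
  by apply: (is_derive_eq d1); rewrite mulr1.
have d2' : is_derive v 1 (fun w : R => ln (1 - w)) (- (1 - v)^-1).
  by apply: (is_derive_eq d2); rewrite mulrN1.
by apply: is_derive_eq; rewrite /GRing.scale /=; ring.
Qed.

(** For [v = (n - m) / (n + m)] one has [ln (n/m) = ln (1 + v) - ln (1 - v)], so the left side is
    the error in replacing [ln (n/m)] by [2v]. The two bounds below read off its sign and its cubic
    size. *)
Let ln_ratio v : 0 <= v < 1 -> exists2 x, 0 <= x <= v &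
  ln (1 + v) - ln (1 - v) - 2 * v = ((1 + x)^-1 + (1 - x)^-1 - 2) * v.
Proof.
move=> /andP[v0 v1].
have dl x : 0 <= x <= v -> -1 < x < 1.
  by move=> /andP[? ?]; apply/andP; split; lra.
pose h (w : R) : R := ln (1 + w) - ln (1 - w) - 2 * w.
have dh x : x \in `]0, v[%R -> is_derive x 1 h ((1 + x)^-1 + (1 - x)^-1 - 2).
  by rewrite in_itv/= => /andP[/ltW x0 /ltW xv]; apply: dlog1; apply: dl; rewrite x0 xv.
have ch : {within `[0, v], continuous h}.
  apply: continuous_in_subspaceT => x /[!inE] /=; rewrite in_itv/= => axb.
  by apply/differentiable_continuous/derivable1_diffP; have [] := dlog1 (dl _ axb).
have [x] := @MVT_segment R h _ 0 v v0 dh ch.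
rewrite in_itv/= => xv; rewrite /h !addr0 !subr0 ln1 mulr0 !subr0 => H.
by exists x.
Qed.

Let ln_ratio_ge v : 0 <= v < 1 -> 2 * v <= ln (1 + v) - ln (1 - v).
Proof.
move=> v01; have [x /andP[x0 xv] E] := ln_ratio v01; have /andP[v0 v1] := v01.
rewrite -subr_ge0 E mulr_ge0//.
have p1 : 0 < 1 + x by lra. have p2 : 0 < 1 - x by lra.
have -> : (1 + x)^-1 + (1 - x)^-1 - 2 = 2 * x ^+ 2 / ((1 + x) * (1 - x)).
  by field; rewrite !gt_eqF.
by rewrite divr_ge0 ?mulr_ge0 ?sqr_ge0// ltW.
Qed.

Let ln_ratio_le v : 0 <= v <= 1 / 2 -> ln (1 + v) - ln (1 - v) - 2 * v <= 8 / 3 * v ^+ 3.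
Proof.
move=> /andP[v0 v1].
have v01 : 0 <= v < 1 by apply/andP; split; lra.
have [x /andP[x0 xv] ->] := ln_ratio v01.
have p1 : 0 < 1 + x by lra. have p2 : 0 < 1 - x by lra.
have -> : (1 + x)^-1 + (1 - x)^-1 - 2 = 2 * x ^+ 2 / ((1 + x) * (1 - x)).
  by field; rewrite !gt_eqF.
rewrite [v ^+ 3]exprSr [leRHS]mulrA; apply: ler_wpM2r => //; rewrite ler_pdivrMr ?mulr_gt0//.
have x2 : x ^+ 2 <= v ^+ 2 by rewrite lerXn2r ?nnegrE.
have v2 : v ^+ 2 <= 1 / 4.
  have -> : 1 / 4 = (1 / 2) ^+ 2 :> R by field.
  by rewrite lerXn2r ?nnegrE//; lra.
have H := sqr_ge0 v.
have -> : (1 + x) * (1 - x) = 1 - x ^+ 2 by ring.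
have : v ^+ 2 * (3 / 4) <= v ^+ 2 * (1 - x ^+ 2) by rewrite ler_wpM2l//; lra.
lra.
Qed.

(* One off-diagonal term: [log(n/m)] is replaced by [2(n-m)/(n+m)] and [1/sqrt(mn)] by [2/(m+n)]. *)
Lemma replace_term t m k x v : 100 <= t -> 1 <= m -> 1 <= k ->
  x = 2 * m + k -> v = k / x ->
  `|c t (ln (m + k) - ln m) / Num.sqrt (m * (m + k)) - 2 / x * c t (2 * v)| <=
  64 * bump t v ^+ 3 * (v ^+ 2 / x + t * v ^+ 3 / x + v ^+ 4).
Proof.
move=> t100 m1 k1 xE vE.
have x0 : 0 < x by rewrite xE; lra.
have kE : k = v * x by rewrite vE divfK// gt_eqF.
have v0 : 0 < v by rewrite vE divr_gt0//; lra.
have v1 : v < 1 by rewrite vE ltr_pdivrMr// xE; lra.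
have mE : m = x / 2 * (1 - v).
  have -> : x / 2 * (1 - v) = (x - v * x) / 2 by field.
  by rewrite -kE xE; field.
have mkE : m + k = x / 2 * (1 + v) by rewrite mulrDr mulr1 mulrAC [x * v]mulrC -kE xE; field.
have p1 : 0 < 1 + v by lra. have p2 : 0 < 1 - v by lra.
have lnE : ln (m + k) - ln m = ln (1 + v) - ln (1 - v).
  rewrite mkE [in X in _ - X]mE !lnM ?posrE// ?divr_gt0//.
  by rewrite opprD addrACA subrr add0r.
have v01 : 0 <= v < 1 by apply/andP; split; lra.
have lge := ln_ratio_ge v01.
have b0 : 0 < bump t v by apply: bump_gt0; lra.
have b30 := exprn_gt0 3 b0.
have cl : `|c t (ln (1 + v) - ln (1 - v))| <= 2 * bump t v ^+ 3.
  by apply: c_decay => //; lra.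
have c2v : `|c t (2 * v)| <= 2 * bump t v ^+ 3 by apply: c_decay => //; lra.
have q0 : 0 < Num.sqrt (m * (m + k)).
  by rewrite sqrtr_gt0 mulr_gt0//; lra.
have x3 : 3 <= x by rewrite xE; lra.
have t0 : 0 <= t by lra.
have tp1 : t - 2 <= t + 1 by lra.
have v32 : 3 / 2 * v <= 2 * v by lra.
have h1 : 0 <= bump t v ^+ 3 * (v ^+ 2 / x).
  by rewrite mulr_ge0 ?divr_ge0 ?sqr_ge0// ltW.
have h2 : 0 <= bump t v ^+ 3 * (t * v ^+ 3 / x).
  by apply: mulr_ge0; [exact: ltW|rewrite divr_ge0 ?mulr_ge0 ?exprn_ge0// ltW].
rewrite lnE; set q := Num.sqrt _ in q0 *.
(* For [v <= 1/2] the expansions in [v] apply. For [v > 1/2] the error term [v^4 >= 1/16] already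
   dominates both quantities, each at most [2 bump^3]. *)
have [vle|vgt] := lerP v (1 / 2).
- have q2 : q ^+ 2 = x ^+ 2 / 4 * (1 - v ^+ 2).
    rewrite sqr_sqrtr; last by rewrite mulr_ge0//; lra.
    by rewrite {1}mE mkE; field.
  have qx : 2 / 5 * x <= q.
    rewrite -(ler_pXn2r (n := 2)) ?nnegrE ?mulr_ge0 ?ltW// q2.
    have v2 : v ^+ 2 <= 1 / 4 by nra.
    have := sqr_ge0 x; nra.
  have E1 : q^-1 - 2 / x = (x ^+ 2 * v ^+ 2) / ((x + 2 * q) * q * x).
    have -> : x ^+ 2 * v ^+ 2 = x ^+ 2 - 4 * q ^+ 2 by rewrite q2; field.
    by field; rewrite !gt_eqF//; lra.
  have qd : `|q^-1 - 2 / x| <= 5 / 2 * v ^+ 2 / x.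
    rewrite E1 ger0_norm; last first.
      have y0 : 0 < (x + 2 * q) * q * x by rewrite !mulr_gt0//; lra.
      by apply: divr_ge0; [rewrite mulr_ge0 ?sqr_ge0|exact: ltW].
    rewrite ler_pdivrMr ?mulr_gt0//; last by lra.
    have -> : 5 / 2 * v ^+ 2 / x * ((x + 2 * q) * q * x) =
      5 / 2 * v ^+ 2 * ((x + 2 * q) * q) by field; rewrite gt_eqF.
    have : x * (2 / 5 * x) <= (x + 2 * q) * q by apply: ler_pM; lra.
    move=> /(ler_wpM2l (sqr_ge0 v)); lra.
  have lle := @ln_ratio_le v _.
  (* Mean value bound: the arguments differ by at most [8/3 v^3], and on the whole segment the
     derivative [- t s (t + 1)] is controlled at the scale of [v]. *)
  have dl : `|c t (ln (1 + v) - ln (1 - v)) - c t (2 * v)| <=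
      t * (2 * bump t v ^+ 3) * (8 / 3 * v ^+ 3).
    have := @le_mean_value R (c t) (fun u => - t * s (t + 1) u) (2 * v)
      (ln (1 + v) - ln (1 - v)) (t * (2 * bump t v ^+ 3)) lge.
    move=> H; apply: (le_trans (H _ _)).
    + by move=> u _; apply: dc => //; lra.
    + move=> u /andP[u1 _]; rewrite normrM normrN (ger0_norm t0).
      by apply: ler_wpM2l => //; apply: s_decay; [exact: t100|exact: tp1|exact: ltW|exact: le_trans u1].
    + apply: ler_wpM2l; first by rewrite !mulr_ge0// ltW.
      by apply: lle; apply/andP; split; lra.
  have -> : c t (ln (1 + v) - ln (1 - v)) / q - 2 / x * c t (2 * v) =
    c t (ln (1 + v) - ln (1 - v)) * (q^-1 - 2 / x) +
    2 / x * (c t (ln (1 + v) - ln (1 - v)) - c t (2 * v)) by ring.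
  apply: (le_trans (ler_normD _ _)); rewrite !normrM.
  rewrite (ger0_norm (_ : 0 <= 2)) // normfV (gtr0_norm x0).
  have H1 : `|c t (ln (1 + v) - ln (1 - v))| * `|q^-1 - 2 / x| <=
    2 * bump t v ^+ 3 * (5 / 2 * v ^+ 2 / x) by apply: ler_pM.
  have H2 : 2 / x * `|c t (ln (1 + v) - ln (1 - v)) - c t (2 * v)| <=
    2 / x * (t * (2 * bump t v ^+ 3) * (8 / 3 * v ^+ 3)).
    by rewrite ler_wpM2l// divr_ge0// ltW.
  apply: (le_trans (lerD H1 H2)).
  have h3 : 0 <= bump t v ^+ 3 * v ^+ 4 by rewrite mulr_ge0 ?exprn_ge0// ltW.
  by move: (bump t v ^+ 3) (x^-1) h1 h2 h3 => B X; nra.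
- apply: (le_trans (ler_normB _ _)); rewrite !normrM.
  rewrite (ger0_norm (_ : 0 <= 2)) // !normfV (gtr0_norm x0) (gtr0_norm q0).
  have q1 : q^-1 <= 1.
    rewrite invf_le1// -[leLHS]sqrtr1 ler_wsqrtr//.
    by rewrite -[leLHS]mulr1; apply: ler_pM => //; lra.
  have H1 : `|c t (ln (1 + v) - ln (1 - v))| * q^-1 <= 2 * bump t v ^+ 3 * 1.
    by apply: ler_pM => //; rewrite invr_ge0 ltW.
  have x1 : 2 / x <= 1 by rewrite ler_pdivrMr//; lra.
  have H2 : 2 / x * `|c t (2 * v)| <= 1 * (2 * bump t v ^+ 3).
    by apply: ler_pM => //; rewrite divr_ge0// ltW.
  apply: (le_trans (lerD H1 H2)).
  have v4 : 1 / 16 <= v ^+ 4.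
    have -> : 1 / 16 = (1 / 2) ^+ 4 :> R by field.
    by rewrite lerXn2r ?nnegrE//; lra.
  have h3 : bump t v ^+ 3 * (1 / 16) <= bump t v ^+ 3 * v ^+ 4 by rewrite ler_wpM2l// ltW.
  by move: (bump t v ^+ 3) (x^-1) h1 h2 h3 => B X; lra.
Qed.

End Transform.

(** * The approximate antiderivative and its derivatives *)

Section Antiderivative.
Context {R : realType}.
Variables (c s : R -> R -> R).
Implicit Types (p q t u v m k x y : R).
Hypothesis dc : forall p q u, 0 < p -> q = p + 1 -> is_derive u 1 (c p) (- p * s q u).
Hypothesis ds : forall p q u, 0 < p -> q = p + 1 -> is_derive u 1 (s p) (p * c q u).

Let dV y : 0 < y -> is_derive y 1 (fun z : R => z^-1) (- y^-1 ^+ 2).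
Proof.
move=> y0; have yn0 : y != 0 by rewrite gt_eqF.
have H : is_derive y 1 (@id R) 1 by exact: is_derive_id.
by apply: (is_derive_eq (@is_deriveV _ _ _ _ _ yn0 H)); rewrite /GRing.scale /= mulr1 exprVn.
Qed.

Let dkV k y : 0 < y -> is_derive y 1 (fun z : R => k / z) (- k * y^-1 ^+ 2).
Proof.
move=> y0; have H := dV y0.
by apply: is_derive_eq; rewrite /GRing.scale /=; ring.
Qed.

Let dck k p q y : 0 < p -> q = p + 1 -> 0 < y ->
  is_derive y 1 (fun z => c p (k / z)) (p * k * s q (k / y) * y^-1 ^+ 2).
Proof.
move=> p0 qE y0; have H := @is_derive1_comp _ _ _ y _ _ (dc (k / y) p0 qE) (dkV k y0).
by apply: (is_derive_eq H); ring.
Qed.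

Let dsk k p q y : 0 < p -> q = p + 1 -> 0 < y ->
  is_derive y 1 (fun z => s p (k / z)) (- p * k * c q (k / y) * y^-1 ^+ 2).
Proof.
move=> p0 qE y0; have H := @is_derive1_comp _ _ _ y _ _ (ds (k / y) p0 qE) (dkV k y0).
by apply: (is_derive_eq H); ring.
Qed.

(* [anti0 t k] is an approximate antiderivative of [y |-> c t (k / y) / y], the error being the second
   summand of [anti1]; its first three derivatives are [anti1], [anti2] and [anti3]. *)
Definition anti0 t k y := - (k * (t - 1))^-1 * (y * s (t - 1) (k / y)) +
  (k ^+ 2 * (t - 1) * (t - 2))^-1 * (y ^+ 2 * c (t - 2) (k / y)).

Definition anti1 t k y := c t (k / y) * y^-1 +
  (k ^+ 2 * (t - 1) * (t - 2))^-1 * (2 * y * c (t - 2) (k / y)).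

Definition anti2 t k y := t * k * (s (t + 1) (k / y) * y^-1 ^+ 3) -
  c t (k / y) * y^-1 ^+ 2 +
  (k ^+ 2 * (t - 1) * (t - 2))^-1 *
    (2 * c (t - 2) (k / y) + 2 * (t - 2) * k * (s (t - 1) (k / y) * y^-1)).

Definition anti3 t k y := - (4 * t * k * s (t + 1) (k / y) * y^-1 ^+ 4) -
  t * (t + 1) * k ^+ 2 * c (t + 2) (k / y) * y^-1 ^+ 5.

Lemma anti0_is_derive t k y : 2 < t -> 0 < k -> 0 < y ->
  is_derive y 1 (anti0 t k) (anti1 t k y).
Proof.
move=> t2 k0 y0.
have H1 : is_derive y 1 (fun z => s (t - 1) (k / z)) (- (t - 1) * k * c t (k / y) * y^-1 ^+ 2).
  by apply: dsk => //; [lra|ring].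
have H2 : is_derive y 1 (fun z => c (t - 2) (k / z)) ((t - 2) * k * s (t - 1) (k / y) * y^-1 ^+ 2).
  by apply: dck => //; [lra|ring].
rewrite /anti0; apply: is_derive_eq; rewrite /anti1 /GRing.scale /=.
have t1' : t - 1 != 0 by rewrite gt_eqF//; lra.
have t2' : t - 2 != 0 by rewrite gt_eqF//; lra.
move: (c t _) (c (t - 2) _) (s (t - 1) _) => a b e.
by field; rewrite t1' t2' !gt_eqF.
Qed.

Lemma anti1_is_derive t k y : 2 < t -> 0 < k -> 0 < y ->
  is_derive y 1 (anti1 t k) (anti2 t k y).
Proof.
move=> t2 k0 y0.
have H1 : is_derive y 1 (fun z => c t (k / z)) (t * k * s (t + 1) (k / y) * y^-1 ^+ 2).
  by apply: dck => //; lra.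
have H2 : is_derive y 1 (fun z => c (t - 2) (k / z)) ((t - 2) * k * s (t - 1) (k / y) * y^-1 ^+ 2).
  by apply: dck => //; [lra|ring].
have H3 := dV y0.
rewrite /anti1; apply: is_derive_eq; rewrite /anti2 /GRing.scale /=.
have t1' : t - 1 != 0 by rewrite gt_eqF//; lra.
have t2' : t - 2 != 0 by rewrite gt_eqF//; lra.
move: (c t _) (c (t - 2) _) (s (t - 1) _) (s (t + 1) _) => a b e f.
by field; rewrite t1' t2' !gt_eqF.
Qed.

Lemma anti2_is_derive t k y : 2 < t -> 0 < k -> 0 < y ->
  is_derive y 1 (anti2 t k) (anti3 t k y).
Proof.
move=> t2 k0 y0.
have H0 : is_derive y 1 (fun z => s (t + 1) (k / z)) (- (t + 1) * k * c (t + 2) (k / y) * y^-1 ^+ 2).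
  by apply: dsk => //; [lra|ring].
have H1 : is_derive y 1 (fun z => c t (k / z)) (t * k * s (t + 1) (k / y) * y^-1 ^+ 2).
  by apply: dck => //; lra.
have H2 : is_derive y 1 (fun z => c (t - 2) (k / z)) ((t - 2) * k * s (t - 1) (k / y) * y^-1 ^+ 2).
  by apply: dck => //; [lra|ring].
have H4 : is_derive y 1 (fun z => s (t - 1) (k / z)) (- (t - 1) * k * c t (k / y) * y^-1 ^+ 2).
  by apply: dsk => //; [lra|ring].
have H3 := dV y0.
rewrite /anti2; apply: is_derive_eq; rewrite /anti3 /GRing.scale /=.
have t1' : t - 1 != 0 by rewrite gt_eqF//; lra.
have t2' : t - 2 != 0 by rewrite gt_eqF//; lra.
move: (c t _) (c (t + 2) _) (s (t - 1) _) (s (t + 1) _) => a g e f.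
by field; rewrite t1' t2' !gt_eqF.
Qed.

(** Used to move the upper endpoints of the telescoped sums to the common point [N]. *)
Lemma muls_is_derive t k y : 1 < t -> 0 < k -> 0 < y ->
  is_derive y 1 (fun z => z * s (t - 1) (k / z))
    (s (t - 1) (k / y) - (t - 1) * (k / y) * c t (k / y)).
Proof.
move=> t1 k0 y0.
have H1 : is_derive y 1 (fun z => s (t - 1) (k / z)) (- (t - 1) * k * c t (k / y) * y^-1 ^+ 2).
  by apply: dsk => //; [lra|ring].
apply: is_derive_eq; rewrite /GRing.scale /=.
move: (c t _) (s (t - 1) _) => a e.
by field; rewrite gt_eqF.
Qed.

End Antiderivative.

Section SumReindex.
Context {R : realType}.

(** For fixed [k] the map [m |-> 2m + k] is injective, and further nonnegative terms only increase
    the sum. *)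
Lemma sum_double_shift_le (g : nat -> R) (a b k : nat) : (forall n, 0 <= g n) ->
  \sum_(a <= m < b) g (2 * m + k)%N <= \sum_((2 * a)%N <= i < (2 * b + k)%N) g i.
Proof.
move=> g0.
have [ba|ab] := leqP b a; first by rewrite big_geq// sumr_ge0.
have : forall j, \sum_(a <= m < a + j) g (2 * m + k)%N <=
    \sum_((2 * a)%N <= i < (2 * (a + j) + k)%N) g i.
  elim=> [|j IH]; first by rewrite addn0 big_geq// sumr_ge0.
  rewrite addnS big_nat_recr ?leq_addr//=.
  rewrite (_ : (2 * (a + j).+1 + k = (2 * (a + j) + k).+2)%N); last first.
    by rewrite mulnS -addnA addnC addn2 addnC.
  rewrite 2?big_nat_recr/=; last 2 first.
  - by rewrite mulnDr -addnA leq_addr.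
  - by rewrite leqW// mulnDr -addnA leq_addr.
  by rewrite -addrA lerD// lerDl.
by move=> /(_ (b - a)%N); rewrite subnKC// ltnW.
Qed.

(** Error bounds depend on [m] and [k] through [i = 2m + k] and [k / i]. Exchanging the sums puts
    [k] inside at fixed [i], where [sum_bump_le] applies; forgetting the parity of [i] costs only a
    constant. *)
Lemma sum_triangle_le (g : nat -> nat -> R) (a N : nat) : (forall n k, 0 <= g n k) ->
  \sum_(1 <= k < N) \sum_(a <= m < (N - k).+1) g (2 * m + k)%N k <=
  \sum_((2 * a)%N <= i < (2 * N).+1) \sum_(1 <= k < N) g i k.
Proof.
move=> g0; rewrite [leRHS]exchange_big/=; apply: ler_sum_nat => k /andP[k1 kN].
apply: (le_trans (sum_double_shift_le _ _ _ (fun n => g0 n k))).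
have [aN|Na] := leqP (2 * a) (2 * (N - k).+1 + k).
  rewrite [leRHS](@big_cat_nat _ _ _ (2 * (N - k).+1 + k)%N)//=; last by lia.
  by rewrite lerDl sumr_ge0.
rewrite [leLHS]big_geq; last by lia.
by apply: sumr_ge0.
Qed.

End SumReindex.

Lemma sum_nat_le_cst (R : realType) (f : nat -> R) (K : R) (a b : nat) : 0 <= K ->
  (forall i, (a <= i < b)%N -> f i <= K) -> \sum_(a <= i < b) f i <= b%:R * K.
Proof.
move=> K0 fK; apply: (@le_trans _ _ (\sum_(a <= i < b) K)); first exact: ler_sum_nat.
by rewrite sumr_const_nat -[K *+ _]mulr_natl; apply: ler_wpM2r => //; rewrite ler_nat leq_subr.
Qed.

(** * Summation of the off-diagonal terms *)

Section OffDiagonal.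
Context {R : realType}.
Variables (c s : R -> R -> R).
Implicit Types (p q t u v x y : R) (m k i n : nat).
Hypothesis dc : forall p q u, 0 < p -> q = p + 1 -> is_derive u 1 (c p) (- p * s q u).
Hypothesis ds : forall p q u, 0 < p -> q = p + 1 -> is_derive u 1 (s p) (p * c q u).
Hypothesis decay : forall p u (n : nat), 0 < p ->
  c (p + n%:R) u ^+ 2 + s (p + n%:R) u ^+ 2 <= 2 / (1 + u ^+ 2) ^+ n.

(** [r] is [sqrt t], and [M] separates the [m] treated by trivial bounds from those treated by the
    midpoint rule. The first part costs about [M^2 / t + M / r] and the remainders of the second
    about [r / M], so [M] must be of order [sqrt t]. *)
Variables (r : R) (N M : nat).
Hypothesis r10 : 10 <= r.
Hypothesis Nge : 4 * r ^+ 2 <= N%:R.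
Hypothesis Nle : N%:R <= 5 * r ^+ 2.
Hypothesis Mge : r <= M%:R.
Hypothesis Mle : M%:R <= 2 * r.

Let r0 : 0 < r. Proof. by apply: lt_le_trans r10. Qed.
Let t := r ^+ 2.
Let t0 : 0 < t. Proof. exact: exprn_gt0. Qed.
Let t100 : 100 <= t.
Proof. by rewrite /t (_ : 100 = 10 ^+ 2 :> R) ?lerXn2r ?nnegrE ?(ltW r0)//; ring. Qed.
Let N0 : 0 < N%:R :> R. Proof. by apply: lt_le_trans Nge; rewrite mulr_gt0. Qed.
Let M10 : 10 <= M%:R :> R. Proof. exact: le_trans Mge. Qed.

Local Notation b k x := (bump (r ^+ 2) (k%:R / x)).

Let b_gt0 v : 0 < bump (r ^+ 2) v. Proof. by apply: bump_gt0; exact: ltW. Qed.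
Let b_le1 v : bump (r ^+ 2) v <= 1. Proof. by apply: bump_le1; exact: ltW. Qed.

Let b3_le v : bump (r ^+ 2) v ^+ 3 <= bump (r ^+ 2) v.
Proof. by rewrite exprS ger_pMr// expr_le1// ltW. Qed.

(** Here and in the next lemmas each factor [v] is traded for a constant over [r] at the expense of
    [bump], always keeping one factor [bump] for the sum over [k]. *)
Let b3v v : 0 <= v -> bump (r ^+ 2) v ^+ 3 * v <= bump (r ^+ 2) v / r.
Proof.
move=> v0; have H := mul_bump_le v r0; have b0 := b_gt0 v; have b1 := b_le1 v.
have -> : bump (r ^+ 2) v ^+ 3 * v = bump (r ^+ 2) v * (bump (r ^+ 2) v * (v * bump (r ^+ 2) v)) by ring.
rewrite ler_pM2l//; apply: le_trans H.
by rewrite ler_piMl// mulr_ge0// ltW.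
Qed.

Let b3v2 v : 0 <= v -> bump (r ^+ 2) v ^+ 3 * v ^+ 2 <= bump (r ^+ 2) v * (4 / r ^+ 2).
Proof.
move=> v0; have H := sqr_bump_le v r0; have b0 := b_gt0 v; have b1 := b_le1 v.
have -> : bump (r ^+ 2) v ^+ 3 * v ^+ 2 =
  bump (r ^+ 2) v * (bump (r ^+ 2) v * (v ^+ 2 * bump (r ^+ 2) v)) by ring.
rewrite ler_pM2l//; apply: le_trans H.
by rewrite ler_piMl// mulr_ge0 ?sqr_ge0// ltW.
Qed.

Let b3v3 v : 0 <= v -> bump (r ^+ 2) v ^+ 3 * v ^+ 3 <= bump (r ^+ 2) v * (4 / r ^+ 3).
Proof.
move=> v0; have H := sqr_bump_le v r0; have H1 := mul_bump_le v r0; have b0 := b_gt0 v.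
have -> : bump (r ^+ 2) v ^+ 3 * v ^+ 3 =
  bump (r ^+ 2) v * ((v ^+ 2 * bump (r ^+ 2) v) * (v * bump (r ^+ 2) v)) by ring.
have -> : 4 / r ^+ 3 = 4 / r ^+ 2 * r^-1 by field; rewrite gt_eqF.
rewrite ler_pM2l//; apply: ler_pM => //; rewrite mulr_ge0 ?sqr_ge0// ltW//.
Qed.

Let b3v4 v : 0 <= v -> bump (r ^+ 2) v ^+ 3 * v ^+ 4 <= bump (r ^+ 2) v * (16 / r ^+ 4).
Proof.
move=> v0; have H := sqr_bump_le v r0; have b0 := b_gt0 v.
have -> : bump (r ^+ 2) v ^+ 3 * v ^+ 4 =
  bump (r ^+ 2) v * ((v ^+ 2 * bump (r ^+ 2) v) * (v ^+ 2 * bump (r ^+ 2) v)) by ring.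
have -> : 16 / r ^+ 4 = 4 / r ^+ 2 * (4 / r ^+ 2) by field; rewrite gt_eqF.
rewrite ler_pM2l//; apply: ler_pM => //; rewrite mulr_ge0 ?sqr_ge0// ltW//.
Qed.

Let sum_b n x : 0 < x -> \sum_(1 <= k < n) b k x <= 4 * x / r.
Proof.
move=> x0; case: n => [|n]; last exact: sum_bump_le.
by rewrite big_geq// divr_ge0 ?mulr_ge0// ltW.
Qed.

Let termG m k : R := c t (ln (m%:R + k%:R) - ln m%:R) / Num.sqrt (m%:R * (m%:R + k%:R)).
(* [c t (k / y) / y] at [y = m + k / 2]. *)
Let termV m k : R := 2 / (2 * m + k)%:R * c t (2 * (k%:R / (2 * m + k)%:R)).

Let sqrtN : Num.sqrt N%:R <= 3 * r.
Proof.
have -> : 3 * r = Num.sqrt ((3 * r) ^+ 2) by rewrite sqrtr_sqr gtr0_norm// mulr_gt0.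
by rewrite ler_wsqrtr// exprMn; apply: (le_trans Nle); have := ltW t0; rewrite /t; lra.
Qed.

(** Summing [bump] over [k] at fixed [i = 2m + k] gives at most [4i / r], which turns the error of
    [replace_term] into [O(1/r^2)] for each of the [O(r^2)] values of [i]. *)
Let sum_replace :
  \sum_(1 <= k < N) \sum_(1 <= m < (N - k).+1) `|termG m k - termV m k| <= 64 * 1000.
Proof.
pose g i k : R := b k i%:R * (8 / (r * i%:R) + 16 / r ^+ 4).
have g0 i k : 0 <= g i k.
  apply: mulr_ge0; first exact: ltW.
  by rewrite addr_ge0// divr_ge0// ?mulr_ge0// ?exprn_ge0 ltW.
apply: (@le_trans _ _ (\sum_(1 <= k < N) \sum_(1 <= m < (N - k).+1) 64 * g (2 * m + k)%N k)).
  apply: ler_sum_nat => k /andP[k1 _]; apply: ler_sum_nat => m /andP[m1 _].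
  have k1' : 1 <= k%:R :> R by rewrite ler1n.
  have m1' : 1 <= m%:R :> R by rewrite ler1n.
  rewrite /g /termG /termV.
  set x : R := (2 * m + k)%:R; have xE : x = 2 * m%:R + k%:R by rewrite /x natrD natrM.
  clearbody x; apply: (le_trans (replace_term dc decay t100 m1' k1' xE erefl)).
  have x0 : 0 < x by rewrite xE; lra.
  set v := k%:R / x; have v0 : 0 <= v by rewrite divr_ge0// ltW.
  have h2 := b3v2 v0; have h3 := b3v3 v0; have h4 := b3v4 v0.
  have b0 := b_gt0 v.
  rewrite -/v.
  have -> : 64 * bump t v ^+ 3 * (v ^+ 2 / x + t * v ^+ 3 / x + v ^+ 4) =
    64 * ((bump t v ^+ 3 * v ^+ 2) / x + t * (bump t v ^+ 3 * v ^+ 3) / x + bump t v ^+ 3 * v ^+ 4).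
    by ring.
  rewrite ler_pM2l//.
  apply: (@le_trans _ _ (bump t v * (4 / r ^+ 2) / x + t * (bump t v * (4 / r ^+ 3)) / x +
    bump t v * (16 / r ^+ 4))).
    apply: lerD => //; apply: lerD; rewrite ler_pM2r ?invr_gt0//.
    by rewrite ler_pM2l.
  have -> : bump t v * (4 / r ^+ 2) / x + t * (bump t v * (4 / r ^+ 3)) / x +
    bump t v * (16 / r ^+ 4) = bump t v * (4 / r ^+ 2 / x + 4 / (r * x) + 16 / r ^+ 4).
    by rewrite /t; field; rewrite !gt_eqF.
  rewrite ler_pM2l// lerD2r.
  have -> : 8 / (r * x) = 4 / (r * x) + 4 / (r * x) by field; rewrite !gt_eqF.
  rewrite lerD2r -mulrA ler_pM2l// -invfM lef_pV2 ?posrE ?mulr_gt0 ?exprn_gt0//.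
  by rewrite expr2 -mulrA ler_peMl ?mulr_ge0 ?(ltW r0) ?(ltW x0)//; apply: le_trans r10; rewrite ler1n.
under eq_bigr do rewrite -mulr_sumr.
rewrite -mulr_sumr ler_pM2l//; apply: (le_trans (sum_triangle_le _ _ g0)).
apply: (@le_trans _ _ (\sum_((2 * 1)%N <= i < (2 * N).+1) (32 / r ^+ 2 + 64 * i%:R / r ^+ 5))).
  apply: ler_sum_nat => i /andP[i1 _].
  have i0 : 0 < i%:R :> R by rewrite ltr0n (leq_trans _ i1).
  rewrite /g -mulr_suml.
  apply: (@le_trans _ _ ((4 * i%:R / r) * (8 / (r * i%:R) + 16 / r ^+ 4))).
    apply: ler_wpM2r; first by rewrite addr_ge0// divr_ge0// ?mulr_ge0// ?exprn_ge0 ltW.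
    exact: sum_b.
  rewrite le_eqVlt; apply/orP; left; apply/eqP.
  by field; rewrite !gt_eqF.
have NR : (2 * N)%:R <= 10 * r ^+ 2 :> R.
  by rewrite natrM (_ : 10 * r ^+ 2 = 2 * (5 * r ^+ 2)) ?ler_pM2l//; ring.
(* Here [i <= 10 r^2 <= r^3], so each term is at most [96 / r^2]; there are at most [10 r^2 + 1] of
   them. *)
apply: (le_trans (@sum_nat_le_cst _ _ (96 / r ^+ 2) _ _ _ _)).
- by rewrite divr_ge0// exprn_ge0// ltW.
- move=> i /andP[_]; rewrite ltnS => iN.
  have iR : i%:R <= 10 * r ^+ 2 by apply: le_trans NR; rewrite ler_nat.
  have -> : 96 / r ^+ 2 = 32 / r ^+ 2 + 64 * r ^+ 3 / r ^+ 5 by field; rewrite gt_eqF.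
  rewrite lerD2l ler_pM2r ?invr_gt0 ?exprn_gt0// ler_pM2l//; apply: (le_trans iR).
  by rewrite [r ^+ 3]exprS ler_pM2r// exprn_gt0.
rewrite mulrA ler_pdivrMr// -natr1; have := t100; rewrite /t; lra.
Qed.

(** For small [m] only size is used: [bump <= 4 x^2 / (t k^2)] with [x = 2m + k] bounds the term by
    [16 x / (t k^2)]. *)
Let termV_le m k : (1 <= k)%N ->
  `|termV m k| <= 32 * m%:R / (t * k%:R ^+ 2) + 16 / (t * k%:R).
Proof.
move=> k1; rewrite /termV; have k0 : 0 < k%:R :> R by rewrite ltr0n.
set x : R := (2 * m + k)%:R; have xE : x = 2 * m%:R + k%:R by rewrite /x natrD natrM.
have x0 : 0 < x by rewrite xE ltr_wpDl// mulr_ge0.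
clearbody x; set v := k%:R / x; have v0 : 0 < v by rewrite divr_gt0.
have v32 : 3 / 2 * v <= 2 * v by lra.
have tt2 : t - 2 <= t by rewrite gerBl.
have H := c_decay decay t100 tt2 (ltW v0) v32.
have b0 := b_gt0 v.
have bx : bump (r ^+ 2) v <= 4 * x ^+ 2 / (t * k%:R ^+ 2).
  have -> : 4 * x ^+ 2 / (t * k%:R ^+ 2) = 4 / r ^+ 2 / v ^+ 2.
    by rewrite /v /t; field; rewrite !gt_eqF.
  by rewrite ler_pdivlMr ?exprn_gt0// mulrC sqr_bump_le.
rewrite normrM ger0_norm; last by rewrite divr_ge0// ltW.
apply: (@le_trans _ _ (2 / x * (2 * (4 * x ^+ 2 / (t * k%:R ^+ 2))))).
  rewrite ler_pM2l ?divr_gt0//; apply: (le_trans H); rewrite ler_pM2l//.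
  exact: le_trans (b3_le v) bx.
rewrite le_eqVlt; apply/orP; left; apply/eqP.
have -> : 2 / x * (2 * (4 * x ^+ 2 / (t * k%:R ^+ 2))) = 16 * x / (t * k%:R ^+ 2).
  by field; rewrite !gt_eqF.
by rewrite xE; field; rewrite !gt_eqF.
Qed.

Let M1 : (1 <= M)%N.
Proof. by rewrite -(@ler1n R) (le_trans _ M10)// ler1n. Qed.

Let sum_drop_le (f K : nat -> R) n : (forall m, `|f m| <= K m) ->
  `|\sum_(1 <= m < n) f m - \sum_(M <= m < n) f m| <= \sum_(1 <= m < M) K m.
Proof.
move=> fK; have K0 m : 0 <= K m by exact: le_trans (fK m).
have [nM|Mn] := leqP n M.
  rewrite [X in _ - X]big_geq// subr0; apply: (le_trans (ler_norm_sum _ _ _)).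
  have [n0|n1] := leqP n 1; first by rewrite big_geq// sumr_ge0.
  rewrite [leRHS](@big_cat_nat _ _ _ n)/= ?(ltnW n1)//.
  by rewrite ler_wpDr ?sumr_ge0//; apply: ler_sum.
rewrite (@big_cat_nat _ _ _ M)/= ?(ltnW Mn)// addrK.
by apply: (le_trans (ler_norm_sum _ _ _)); apply: ler_sum.
Qed.

Let sum_small : \sum_(1 <= k < N)
  `|\sum_(1 <= m < (N - k).+1) termV m k - \sum_(M <= m < (N - k).+1) termV m k| <= 448.
Proof.
apply: (@le_trans _ _ (\sum_(1 <= k < N)
    (32 * M%:R ^+ 2 / t * (k%:R ^+ 2)^-1 + 16 * M%:R / t * k%:R^-1))).
  apply: ler_sum_nat => k /andP[k1 _]; have k0 : 0 < k%:R :> R by rewrite ltr0n.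
  apply: (le_trans (sum_drop_le _ (fun m => termV_le m k1))).
  apply: (le_trans (@sum_nat_le_cst _ _ (32 * M%:R / (t * k%:R ^+ 2) + 16 / (t * k%:R)) _ _ _ _)).
  - by rewrite addr_ge0// divr_ge0// ?mulr_ge0// ?exprn_ge0 ltW.
  - move=> m /andP[_ mM]; rewrite lerD2r ler_pM2r ?invr_gt0 ?mulr_gt0 ?exprn_gt0//.
    by rewrite ler_pM2l// ler_nat ltnW.
  rewrite le_eqVlt; apply/orP; left; apply/eqP.
  by field; rewrite !gt_eqF.
rewrite big_split/= -!mulr_sumr.
have S1 : \sum_(1 <= k < N) (k%:R : R)^-1 <= 6 * r.
  have : \sum_(1 <= k < N) (k%:R : R)^-1 <= \sum_(1 <= k < N.+1) (k%:R : R)^-1.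
    rewrite [leRHS]big_nat_recr/= ?lerDl ?invr_ge0//.
    by rewrite -(ltr0n R).
  move=> H; apply: (le_trans H); apply: (le_trans (sum_invr_le N)).
  by rewrite (_ : 6 * r = 2 * (3 * r)) ?ler_pM2l//; ring.
have S2 := @sum_invr_sqr_le R N.
have M0 : 0 < M%:R :> R by exact: lt_le_trans Mge.
have C1 : 32 * M%:R ^+ 2 / t <= 128.
  rewrite ler_pdivrMr// /t; have : M%:R ^+ 2 <= (2 * r) ^+ 2.
    by rewrite lerXn2r ?nnegrE ?mulr_ge0// ltW.
  rewrite exprMn; lra.
have C2 : 16 * M%:R / t <= 32 / r.
  have -> : 32 / r = 16 * (2 * r) / t by rewrite /t; field; rewrite gt_eqF.
  by rewrite ler_pM2r ?invr_gt0// ler_pM2l.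
have P1 : 32 * M%:R ^+ 2 / t * \sum_(1 <= k < N) (k%:R ^+ 2)^-1 <= 128 * 2.
  apply: ler_pM => //; first by rewrite divr_ge0 ?mulr_ge0 ?sqr_ge0// ltW.
  by rewrite sumr_ge0// => i _; rewrite invr_ge0 sqr_ge0.
have P2 : 16 * M%:R / t * \sum_(1 <= k < N) (k%:R)^-1 <= 32 / r * (6 * r).
  apply: ler_pM => //; first by rewrite divr_ge0 ?mulr_ge0// ltW.
  by rewrite sumr_ge0// => i _; rewrite invr_ge0.
apply: (le_trans (lerD P1 P2)).
have -> : 32 / r * (6 * r) = 192 by field; rewrite gt_eqF.
lra.
Qed.

(** [x] stands for twice a reference point [y], so [3 z <= 2 x] says that [z] is at most [4/3 y];
    this is the slack [3/2] of the decay bounds. *)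
Let cs_decay1 p q z x k : t - 2 <= p -> t - 2 <= q -> 0 < z -> 0 < x -> 3 * z <= 2 * x ->
  `|c p (k%:R / z)| <= 2 * b k x ^+ 3 /\ `|s q (k%:R / z)| <= 2 * b k x ^+ 3.
Proof.
move=> tp tq z0 x0 zx.
have v0 : 0 <= k%:R / x by rewrite divr_ge0// ltW.
have uv : 3 / 2 * (k%:R / x) <= k%:R / z.
  rewrite mulrCA ler_wpM2l// -[z^-1]mul1r ler_pdivlMr// mulrAC ler_pdivrMr//; lra.
by split; [exact: (c_decay decay t100 tp v0 uv)|exact: (s_decay decay t100 tq v0 uv)].
Qed.

Let cs_le2 p q z k : t - 2 <= p -> t - 2 <= q -> 0 < z ->
  `|c p (k%:R / z)| <= 2 /\ `|s q (k%:R / z)| <= 2.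
Proof.
move=> tp tq z0; have z20 : 0 < 2 * z by rewrite mulr_gt0.
have zz : 3 * z <= 2 * (2 * z) by lra.
have [h1 h2] := cs_decay1 k tp tq z0 z20 zz.
have B1 : 2 * b k (2 * z) ^+ 3 <= 2.
  by rewrite -[leRHS]mulr1 ler_pM2l// expr_le1 ?b_le1// ltW.
by split; [exact: le_trans B1|exact: le_trans B1].
Qed.

(** With [k = v x] and [1/z <= 4/x], the two terms of [anti3] are of order [t v / x^3] and
    [t^2 v^2 / x^3] times [bump^3]; since each [v] is worth [1/r], both are [O(r^2 bump / x^3)]. *)
Let anti3_le k z x : 20 <= x -> x <= 4 * z -> 3 * z <= 2 * x ->
  `|anti3 c s t k%:R z| <= b k x * (20 * 1000) * r ^+ 2 / x ^+ 3.
Proof.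
move=> x20 xz zx.
have x0 : 0 < x by lra. have z0 : 0 < z by lra.
have w0 : 0 < z^-1 by rewrite invr_gt0.
have wx : z^-1 <= 4 / x.
  by rewrite -[z^-1]mul1r ler_pdivrMr// mulrAC ler_pdivlMr// mul1r.
set v := k%:R / x; have v0 : 0 <= v by rewrite divr_ge0// ltW.
have kE : k%:R = v * x by rewrite /v divfK// gt_eqF.
have [tp1 tp2] : t - 2 <= t + 1 /\ t - 2 <= t + 2 by split; lra.
have [Hc Hs] := cs_decay1 k tp2 tp1 z0 x0 zx.
have B0 := b_gt0 v; have B30 : 0 < bump (r ^+ 2) v ^+ 3 by rewrite exprn_gt0.
have h1 := b3v v0; have h2 := b3v2 v0.
have w4 : z^-1 ^+ 4 <= (4 / x) ^+ 4.
  by rewrite lerXn2r ?nnegrE ?divr_ge0 ?(ltW w0) ?(ltW x0).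
have w5 : z^-1 ^+ 5 <= (4 / x) ^+ 5.
  by rewrite lerXn2r ?nnegrE ?divr_ge0 ?(ltW w0) ?(ltW x0).
have tk0 : 0 <= 4 * t * k%:R by rewrite !mulr_ge0// ltW.
have ttk0 : 0 <= t * (t + 1) * k%:R ^+ 2.
  by rewrite !mulr_ge0 ?exprn_ge0// ?addr_ge0// ltW.
have x30 : 0 < x ^+ 3 by rewrite exprn_gt0.
have T1 : `|4 * t * k%:R * s (t + 1) (k%:R / z) * z^-1 ^+ 4| <=
    bump (r ^+ 2) v * (8 * 4 ^+ 4 * r ^+ 2) / x ^+ 3.
  apply: (@le_trans _ _ (4 * t * k%:R * (2 * bump (r ^+ 2) v ^+ 3) * (4 / x) ^+ 4)).
    rewrite normrM [X in X * _]normrM (ger0_norm tk0) (ger0_norm (exprn_ge0 4 (ltW w0))).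
    apply: ler_pM => //; [by rewrite mulr_ge0|by rewrite exprn_ge0// ltW|].
    by apply: ler_wpM2l.
  have -> : 4 * t * k%:R * (2 * bump (r ^+ 2) v ^+ 3) * (4 / x) ^+ 4 =
      (bump (r ^+ 2) v ^+ 3 * v) * (8 * 4 ^+ 4 * r ^+ 2) / x ^+ 3.
    by rewrite kE /t; field; rewrite gt_eqF.
  rewrite ler_pM2r ?invr_gt0//; apply: ler_wpM2r.
    by rewrite mulr_ge0 ?sqr_ge0// mulr_ge0 ?exprn_ge0.
  by apply: (le_trans h1); rewrite ler_piMr ?(ltW B0)// invf_le1// (le_trans _ r10)// ler1n.
have T2 : `|t * (t + 1) * k%:R ^+ 2 * c (t + 2) (k%:R / z) * z^-1 ^+ 5| <=
    bump (r ^+ 2) v * (16 * 4 ^+ 5 * r ^+ 2) / x ^+ 3.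
  apply: (@le_trans _ _ (t * (t + 1) * k%:R ^+ 2 * (2 * bump (r ^+ 2) v ^+ 3) * (4 / x) ^+ 5)).
    rewrite normrM [X in X * _]normrM (ger0_norm ttk0) (ger0_norm (exprn_ge0 5 (ltW w0))).
    apply: ler_pM => //; [by rewrite mulr_ge0|by rewrite exprn_ge0// ltW|].
    by apply: ler_wpM2l.
  have -> : t * (t + 1) * k%:R ^+ 2 * (2 * bump (r ^+ 2) v ^+ 3) * (4 / x) ^+ 5 =
      (bump (r ^+ 2) v ^+ 3 * v ^+ 2) * (2 * 4 ^+ 5 * (t * (t + 1))) / x ^+ 3.
    by rewrite kE; field; rewrite gt_eqF.
  rewrite ler_pM2r ?invr_gt0//.
  have C0 : 0 <= 2 * 4 ^+ 5 * (t * (t + 1)).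
    by rewrite mulr_ge0 ?mulr_ge0 ?exprn_ge0 ?addr_ge0// ltW.
  apply: (le_trans (ler_wpM2r C0 h2)).
  have -> : bump (r ^+ 2) v * (4 / r ^+ 2) * (2 * 4 ^+ 5 * (t * (t + 1))) =
    bump (r ^+ 2) v * (8 * 4 ^+ 5 * (t + 1)) by rewrite /t; field; rewrite gt_eqF.
  rewrite ler_pM2l//.
  have -> : 16 * 4 ^+ 5 * r ^+ 2 = 8 * 4 ^+ 5 * (t + t) by rewrite /t; ring.
  by rewrite ler_wpM2l ?mulr_ge0 ?exprn_ge0// lerD2l (le_trans _ t100)// ler1n.
apply: (le_trans (ler_normB _ _)); rewrite normrN; apply: (le_trans (lerD T1 T2)).
rewrite -mulrDl ler_pM2r ?invr_gt0// -mulrDr -[leRHS]mulrA ler_pM2l//.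
rewrite -mulrDl; apply: ler_wpM2r; first exact: sqr_ge0.
lra.
Qed.

Let t12 k : (1 <= k)%N -> 0 <= (k%:R ^+ 2 * (t - 1) * (t - 2))^-1 <= 4 / (k%:R ^+ 2 * t ^+ 2).
Proof.
move=> k1; have k0 : 0 < k%:R ^+ 2 :> R by rewrite exprn_gt0// ltr0n.
have T1 := t100; have h1 : t / 2 <= t - 1 by lra.
have h2 : t / 2 <= t - 2 by lra.
have p1 : 0 < t - 1 by lra.
have p2 : 0 < t - 2 by lra.
rewrite invr_ge0 !mulr_ge0 ?(ltW k0) ?(ltW p1) ?(ltW p2)//=.
have -> : 4 / (k%:R ^+ 2 * t ^+ 2) = (k%:R ^+ 2 * (t / 2 * (t / 2)))^-1.
  by field; rewrite !gt_eqF// ltr0n.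
have h3 : 0 < t / 2 by rewrite divr_gt0.
have q1 := mulr_gt0 k0 (mulr_gt0 h3 h3).
have q2 := mulr_gt0 (mulr_gt0 k0 p1) p2.
rewrite lef_pV2//.
by rewrite -[leRHS]mulrA ler_pM2l//; apply: ler_pM => //; rewrite divr_ge0// ltW.
Qed.

(** The first error is the second summand of [anti1], with [c (t - 2)] bounded trivially; the second
    is the midpoint remainder for half-width [1/2]. *)
Let midpoint_term m k : (1 <= k)%N -> (M <= m)%N -> (m + k <= N)%N ->
  `|termV m k - (anti0 c s t k%:R (m%:R + k%:R / 2 + 1 / 2) -
                 anti0 c s t k%:R (m%:R + k%:R / 2 - 1 / 2))| <=
  16 * N%:R / t ^+ 2 / k%:R ^+ 2 +
  b k (2 * m + k)%:R * (5 * 1000) * r ^+ 2 / (2 * m + k)%:R ^+ 3.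
Proof.
move=> k1 Mm mkN; have k0 : 0 < k%:R :> R by rewrite ltr0n.
have m10 : 10 <= m%:R :> R by rewrite (le_trans M10)// ler_nat.
have mkR : m%:R + k%:R <= N%:R :> R by rewrite -natrD ler_nat.
rewrite /termV; set x : R := (2 * m + k)%:R.
have xE : x = 2 * m%:R + k%:R by rewrite /x natrD natrM.
clearbody x; set y := m%:R + k%:R / 2.
have yE : y = x / 2 by rewrite /y xE; field.
have x20 : 20 <= x by rewrite xE; lra.
have y0 : 0 < y by rewrite yE; lra.
have yN : y <= N%:R by rewrite /y; lra.
have yz z : y - 1 / 2 <= z <= y + 1 / 2 -> [/\ 0 < z, x <= 4 * z & 3 * z <= 2 * x].
  by rewrite yE => /andP[z1 z2]; split; lra.
have t2 : 2 < t by have := t100; lra.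
have h0 : 0 <= 1 / 2 :> R by rewrite divr_ge0.
have := @midpoint_rule R (anti0 c s t k%:R) (anti1 c t k%:R) (anti2 c s t k%:R)
  (anti3 c s t k%:R) y (1 / 2) (b k x * (20 * 1000) * r ^+ 2 / x ^+ 3) h0.
move=> /(_ (fun z zy => let: And3 a _ _ := yz z zy in anti0_is_derive dc ds t2 k0 a)).
move=> /(_ (fun z zy => let: And3 a _ _ := yz z zy in anti1_is_derive dc t2 k0 a)).
move=> /(_ (fun z zy => let: And3 a _ _ := yz z zy in anti2_is_derive dc ds t2 k0 a)).
move=> /(_ (fun z zy => let: And3 _ p q := yz z zy in anti3_le k x20 p q)).
set Fp := anti0 c s t k%:R (y + 1 / 2); set Fm := anti0 c s t k%:R (y - 1 / 2).
have -> : 2 * (1 / 2) * anti1 c t k%:R y = 2 / x * c t (2 * (k%:R / x)) +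
    (k%:R ^+ 2 * (t - 1) * (t - 2))^-1 * (2 * y * c (t - 2) (k%:R / y)).
  rewrite /anti1 (_ : 2 * (k%:R / x) = k%:R / y); last first.
    by rewrite yE; field; rewrite gt_eqF//; lra.
  rewrite (_ : 2 * (1 / 2) = 1 :> R) ?mul1r; last by field.
  by rewrite [c t _ * _]mulrC [in X in X * c t _](_ : y^-1 = 2 / x)// yE invf_div.
have -> : 2 * (1 / 2) ^+ 3 * (b k x * (20 * 1000) * r ^+ 2 / x ^+ 3) =
  b k x * (5 * 1000) * r ^+ 2 / x ^+ 3 by field; rewrite gt_eqF//; lra.
set e := (_ * _)^-1 * _; set V := 2 / x * _ => H.
have eN : `|e| <= 16 * N%:R / t ^+ 2 / k%:R ^+ 2.
  have tt : t - 2 <= t - 2 by [].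
  have [h1 _] := cs_le2 k tt tt y0; have /andP[i0 i1] := t12 k1.
  rewrite /e !normrM (ger0_norm i0) (ger0_norm (ler0n _ 2)) (gtr0_norm y0).
  have -> : 16 * N%:R / t ^+ 2 / k%:R ^+ 2 = 4 / (k%:R ^+ 2 * t ^+ 2) * (2 * N%:R * 2).
    by field; rewrite !gt_eqF.
  apply: ler_pM => //; first by rewrite !mulr_ge0// ltW.
  by apply: ler_pM => //; [rewrite mulr_ge0// ltW|rewrite ler_pM2l].
have -> : V - (Fp - Fm) = - (Fp - Fm - (V + e)) - e by ring.
by apply: (le_trans (ler_normB _ _)); rewrite normrN addrC lerD.
Qed.

Let sum_mid : \sum_(1 <= k < N) `|\sum_(M <= m < (N - k).+1) termV m k -
    \sum_(M <= m < (N - k).+1) (anti0 c s t k%:R (m%:R + k%:R / 2 + 1 / 2) -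
                 anti0 c s t k%:R (m%:R + k%:R / 2 - 1 / 2))| <= 21 * 1000.
Proof.
pose g i k : R := b k i%:R * (5 * 1000) * r ^+ 2 / i%:R ^+ 3.
have g0 i k : 0 <= g i k.
  apply: divr_ge0; last by rewrite exprn_ge0.
  apply: mulr_ge0; last exact: sqr_ge0.
  by apply: mulr_ge0; [exact: ltW|lra].
apply: (@le_trans _ _ (\sum_(1 <= k < N)
   \sum_(M <= m < (N - k).+1) (16 * N%:R / t ^+ 2 / k%:R ^+ 2 + g (2 * m + k)%N k))).
  apply: ler_sum_nat => k /andP[k1 kN]; rewrite -sumrB.
  apply: (le_trans (ler_norm_sum _ _ _)); apply: ler_sum_nat => m /andP[Mm mN].
  apply: (midpoint_term k1 Mm); rewrite ltnS in mN.
  by rewrite -(subnK (ltnW kN)) leq_add2r.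
under eq_bigr do rewrite big_split/=.
rewrite big_split/=.
have P1 : \sum_(1 <= k < N) \sum_(M <= m < (N - k).+1) (16 * N%:R / t ^+ 2 / k%:R ^+ 2) <= 800.
  apply: (@le_trans _ _ (\sum_(1 <= k < N) (16 * N%:R / t ^+ 2 * N%:R * (k%:R ^+ 2)^-1))).
    apply: ler_sum_nat => k /andP[k1 kN].
    have P0 : 0 <= 16 * N%:R / t ^+ 2 / k%:R ^+ 2.
      exact: divr_ge0 (divr_ge0 (mulr_ge0 (ler0n _ 16) (ltW N0)) (sqr_ge0 _)) (sqr_ge0 _).
    rewrite sumr_const_nat -[_ *+ _]mulr_natl mulrC mulrAC; apply: ler_wpM2r.
      by rewrite invr_ge0 sqr_ge0.
    apply: ler_wpM2l.
      exact: divr_ge0 (mulr_ge0 (ler0n _ 16) (ltW N0)) (sqr_ge0 _).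
    rewrite ler_nat (leq_trans (leq_subr _ _))// ltn_subrL k1.
    exact: leq_ltn_trans kN.
  rewrite -mulr_sumr; have S2 := @sum_invr_sqr_le R N.
  have C1 : 16 * N%:R / t ^+ 2 * N%:R <= 400.
    rewrite mulrAC ler_pdivrMr ?exprn_gt0//.
    have : N%:R * N%:R <= 5 * t * (5 * t) by apply: ler_pM.
    lra.
  apply: (@le_trans _ _ (400 * 2)); last by lra.
  apply: ler_pM => //.
    exact: mulr_ge0 (divr_ge0 (mulr_ge0 (ler0n _ 16) (ltW N0)) (sqr_ge0 _)) (ltW N0).
  by rewrite sumr_ge0// => i _; rewrite invr_ge0 sqr_ge0.
have P2 : \sum_(1 <= k < N) \sum_(M <= m < (N - k).+1) g (2 * m + k)%N k <= 20 * 1000.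
  apply: (le_trans (sum_triangle_le _ _ g0)).
  (* The sum over [k] leaves [r / i^2], and its tail from [2M] is at most a constant times
     [r / (2M - 1)]; this is where [M >= r] enters. *)
  apply: (@le_trans _ _ (\sum_((2 * M)%N <= i < (2 * N).+1) (20 * 1000 * r * (i%:R ^+ 2)^-1))).
    apply: ler_sum_nat => i /andP[Mi _].
    have i0 : 0 < i%:R :> R by rewrite ltr0n (leq_trans _ Mi)// muln_gt0.
    rewrite /g; do 3 rewrite -mulr_suml.
    have c5 : 0 < 5 * 1000 :> R by lra.
    have h1 : 0 < (i%:R : R) ^+ 3 by exact: exprn_gt0.
    apply: (@le_trans _ _ (4 * i%:R / r * (5 * 1000) * r ^+ 2 / i%:R ^+ 3)).
      by rewrite ler_pM2r ?invr_gt0// ler_pM2r// ler_pM2r//; exact: sum_b.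
    by rewrite le_eqVlt; apply/orP; left; apply/eqP; field; rewrite !gt_eqF.
  rewrite -mulr_sumr.
  have M2 : (1 < 2 * M)%N by rewrite mul2n -addnn; exact: leq_add M1 M1.
  have := @sum_invr_sqr_from_le R (2 * M) (2 * N).+1 M2.
  have rM : r <= (2 * M).-1%:R.
    apply: (le_trans Mge); rewrite ler_nat -(leq_add2r 1) !addn1.
    rewrite prednK ?muln_gt0 ?M1// mul2n -addnn.
    by rewrite -[X in (X < _)%N]addn0 ltn_add2l M1.
  have rM1 : ((2 * M).-1%:R)^-1 <= r^-1 by rewrite lef_pV2 ?posrE// (lt_le_trans r0).
  move=> /le_trans /(_ rM1) S.
  have C0 : 0 <= 20 * 1000 * r by have := r0; lra.
  apply: (le_trans (ler_wpM2l C0 S)).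
  by rewrite mulfK// gt_eqF.
apply: (le_trans (lerD P1 P2)); lra.
Qed.
Let MN : (M < N)%N.
Proof.
rewrite -(ltr_nat R); apply: (le_lt_trans Mle); apply: lt_le_trans Nge.
by rewrite expr2 mulrA ltr_pM2r//; have := r10; lra.
Qed.

(** The right end of the step at [m] is the left end of the step at [m + 1]. The last index
    [m = N - k] gives [N - k/2 + 1/2]; for [k > N - M] the range of [m] is empty, hence the
    conditional. *)
Let telescope k : (1 <= k < N)%N ->
  \sum_(M <= m < (N - k).+1) (anti0 c s t k%:R (m%:R + k%:R / 2 + 1 / 2) -
      anti0 c s t k%:R (m%:R + k%:R / 2 - 1 / 2)) =
  if (k < (N - M).+1)%N then anti0 c s t k%:R (N%:R - k%:R / 2 + 1 / 2) -
     anti0 c s t k%:R (M%:R + k%:R / 2 - 1 / 2) else 0.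
Proof.
move=> /andP[k1 kN]; case: ifPn => [kNM|]; last first.
  by rewrite -leqNgt => NMk; rewrite big_geq// -subSn ?(ltnW kN)// leq_subLR addnC -leq_subLR subSn ?(ltnW MN).
have MNk : (M <= (N - k).+1)%N.
  by rewrite leqW// leq_subRL ?(ltnW kN)// addnC -leq_subRL ?(ltnW MN).
rewrite (telescope_sumr_eq (fun m => anti0 c s t k%:R (m%:R + k%:R / 2 - 1 / 2)) _ MNk).
  congr (anti0 _ _ _ _ _ - _).
  by rewrite -natr1 natrB ?(ltnW kN)//; field.
by move=> m _; congr (anti0 _ _ _ _ _ - _); rewrite -natr1; field.
Qed.

Let NM1 : ((N - M).+1 <= N)%N.
Proof. by rewrite ltn_subrL M1 (leq_ltn_trans _ MN). Qed.

Let sum_if (f : nat -> R) : \sum_(1 <= k < N) (if (k < (N - M).+1)%N then f k else 0) =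
  \sum_(1 <= k < (N - M).+1) f k.
Proof.
rewrite (@big_cat_nat _ _ _ (N - M).+1)//= [X in _ + X]big1_seq ?addr0.
  by apply: eq_big_nat => k /andP[_ ->].
by move=> k /andP[_]; rewrite mem_index_iota => /andP[NMk _]; rewrite ltnNge NMk.
Qed.

Let anti0_le k z : (1 <= k)%N -> 0 < z ->
  `|anti0 c s t k%:R z| <= 4 * z / (k%:R * t) + 8 * z ^+ 2 / (k%:R ^+ 2 * t ^+ 2).
Proof.
move=> k1 z0; have k0 : 0 < k%:R :> R by rewrite ltr0n.
have [tp tq] : t - 2 <= t - 1 /\ t - 2 <= t - 2 by split; lra.
have [Hc Hs] := cs_le2 k tq tp z0; have /andP[i0 i1] := t12 k1.
have T1 := t100; have t1 : 0 < t - 1 by lra.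
apply: (le_trans (ler_normD _ _)); apply: lerD.
  have j0 : 0 < (k%:R * (t - 1))^-1 by rewrite invr_gt0 mulr_gt0.
  rewrite mulNr normrN !normrM (gtr0_norm j0) (gtr0_norm z0).
  have -> : 4 * z / (k%:R * t) = (k%:R * (t / 2))^-1 * (z * 2) by field; rewrite !gt_eqF.
  apply: ler_pM => //; [exact: ltW|by rewrite mulr_ge0// ltW| |by rewrite ler_pM2l].
  rewrite lef_pV2 ?posrE ?mulr_gt0 ?divr_gt0// ler_pM2l//; lra.
rewrite normrM (ger0_norm i0) normrM (ger0_norm (sqr_ge0 z)).
have -> : 8 * z ^+ 2 / (k%:R ^+ 2 * t ^+ 2) = 4 / (k%:R ^+ 2 * t ^+ 2) * (z ^+ 2 * 2).
  by field; rewrite !gt_eqF.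
apply: ler_pM => //; first by rewrite mulr_ge0 ?sqr_ge0.
by rewrite ler_wpM2l ?sqr_ge0.
Qed.

Let sumV : \sum_(1 <= k < N) (k%:R : R)^-1 <= 6 * r.
Proof.
have : \sum_(1 <= k < N) (k%:R : R)^-1 <= \sum_(1 <= k < N.+1) (k%:R : R)^-1.
  by rewrite [leRHS]big_nat_recr/= ?lerDl ?invr_ge0//; rewrite -(ltr0n R).
move=> H; apply: (le_trans H); apply: (le_trans (sum_invr_le N)).
by rewrite (_ : 6 * r = 2 * (3 * r)) ?ler_pM2l//; ring.
Qed.

(** At the lower endpoints [z <= 2r + k/2], and the trivial bounds on [c] and [s] leave terms of
    order [1/(r k)], [1/(t k^2)] and [1/t], each with bounded sum over [k < N]. *)
Let sum_bottom :
  \sum_(1 <= k < N) `|anti0 c s t k%:R (M%:R + k%:R / 2 - 1 / 2)| <= 300.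
Proof.
apply: (@le_trans _ _ (\sum_(1 <= k < N) (8 / r * k%:R^-1 + 64 / t * (k%:R ^+ 2)^-1 + 6 / t))).
  apply: ler_sum_nat => k /andP[k1 _]; have k0 : 1 <= k%:R :> R by rewrite ler1n.
  have kp : 0 < k%:R :> R by rewrite ltr0n.
  set z := M%:R + k%:R / 2 - 1 / 2; have zl : z <= 2 * r + k%:R / 2 by rewrite /z; have := Mle; lra.
  have z0 : 0 < z by rewrite /z; have := M10; lra.
  apply: (le_trans (anti0_le k1 z0)).
  have h1 : 4 * z / (k%:R * t) <= 8 / r * k%:R^-1 + 2 / t.
    have -> : 8 / r * k%:R^-1 + 2 / t = 4 * (2 * r + k%:R / 2) / (k%:R * t).
      by rewrite /t; field; rewrite !gt_eqF.
    by rewrite ler_pM2r ?invr_gt0 ?mulr_gt0// ler_pM2l.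
  have h2 : 8 * z ^+ 2 / (k%:R ^+ 2 * t ^+ 2) <= 64 / t * (k%:R ^+ 2)^-1 + 4 / t ^+ 2.
    have -> : 64 / t * (k%:R ^+ 2)^-1 + 4 / t ^+ 2 =
       8 * (8 * r ^+ 2 + k%:R ^+ 2 / 2) / (k%:R ^+ 2 * t ^+ 2).
      by rewrite /t; field; rewrite !gt_eqF.
    rewrite ler_pM2r ?invr_gt0 ?mulr_gt0 ?exprn_gt0// ler_pM2l//.
    have : z ^+ 2 <= (2 * r + k%:R / 2) ^+ 2.
      by rewrite lerXn2r ?nnegrE ?(ltW z0)// addr_ge0 ?divr_ge0 ?mulr_ge0// ltW.
    have := sqr_ge0 (2 * r - k%:R / 2); lra.
  have h3 : 4 / t ^+ 2 <= 4 / t.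
    rewrite ler_pM2l// lef_pV2 ?posrE ?exprn_gt0// expr2 ler_peMr ?(ltW t0)//.
    by have := t100; lra.
  lra.
rewrite !big_split/= -[X in X + _ + _]mulr_sumr -[X in _ + X + _]mulr_sumr.
have S2 := @sum_invr_sqr_le R N.
have P1 : 8 / r * \sum_(1 <= k < N) (k%:R : R)^-1 <= 48.
  have -> : 48 = 8 / r * (6 * r) :> R by field; rewrite gt_eqF.
  by rewrite ler_pM2l ?divr_gt0.
have P2 : 64 / t * \sum_(1 <= k < N) ((k%:R : R) ^+ 2)^-1 <= 128.
  apply: (@le_trans _ _ (64 / t * 2)); first by rewrite ler_pM2l ?divr_gt0.
  by rewrite mulrAC ler_pdivrMr//; have := t100; lra.
have P3 : \sum_(1 <= k < N) (6 / t) <= 30.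
  have q0 : 0 <= 6 / t by rewrite divr_ge0// ltW.
  apply: (le_trans (sum_nat_le_cst q0 (fun i _ => lexx _))).
  by rewrite mulrA ler_pdivrMr// /t; have := Nle; lra.
apply: (le_trans (lerD (lerD P1 P2) P3)); lra.
Qed.

Variable K0 : R.
Hypothesis sum_sin : forall n, (n <= N)%N ->
  `|\sum_(1 <= k < n) s (t - 1) (k%:R / N%:R) / k%:R| <= K0.

(* The upper endpoints [N - k / 2 + 1 / 2] depend on [k]; moving them to [N] isolates the sine sum. *)
Let top_diff k : (1 <= k < (N - M).+1)%N ->
  `|anti0 c s t k%:R (N%:R - k%:R / 2 + 1 / 2) +
    N%:R / (t - 1) * (s (t - 1) (k%:R / N%:R) / k%:R)| <=
  9 / r * b k (2 * N%:R) + 200 * (k%:R ^+ 2)^-1.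
Proof.
move=> /andP[k1]; rewrite ltnS => kNM; have kp : 0 < k%:R :> R by rewrite ltr0n.
have k1' : 1 <= k%:R :> R by rewrite ler1n.
have kN : (k <= N)%N by rewrite (leq_trans kNM)// leq_subr.
have kNR : k%:R <= N%:R :> R by rewrite ler_nat.
have T1 := t100; have t1 : 0 < t - 1 by lra. have t1' : 1 < t by lra.
set Y := N%:R - k%:R / 2 + 1 / 2.
have YN : Y <= N%:R by rewrite /Y; lra.
have Y2 : N%:R <= 2 * Y by rewrite /Y; lra.
have Y0 : 0 < Y by have := N0; lra.
set v := k%:R / (2 * N%:R); have v0 : 0 <= v by rewrite divr_ge0 ?mulr_ge0// ltW.
have b0 := b_gt0 v.
(* The derivative of [z s (t - 1) (k / z)] is [O(r bump)] and the endpoint moves by at most [k/2];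
   after division by [k (t - 1)] this becomes [9/r bump]. *)
have D : `|N%:R * s (t - 1) (k%:R / N%:R) - Y * s (t - 1) (k%:R / Y)| <=
    9 * r * bump (r ^+ 2) v * (k%:R / 2).
  have dm z : Y <= z <= N%:R -> is_derive z 1 (fun z => z * s (t - 1) (k%:R / z))
     (s (t - 1) (k%:R / z) - (t - 1) * (k%:R / z) * c t (k%:R / z)).
    by move=> /andP[Yz _]; apply: muls_is_derive ds _ _ _ t1' kp (lt_le_trans Y0 Yz).
  have dK z : Y <= z <= N%:R ->
     `|s (t - 1) (k%:R / z) - (t - 1) * (k%:R / z) * c t (k%:R / z)| <= 9 * r * bump (r ^+ 2) v.
    move=> /andP[Yz zN]; have z0 := lt_le_trans Y0 Yz.
    have [tp tq] : t - 2 <= t - 1 /\ t - 2 <= t by split; lra.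
    have NN0 : 0 < 2 * N%:R :> R by rewrite mulr_gt0.
    have zx : 3 * z <= 2 * (2 * N%:R) by lra.
    have [Hc Hs] := cs_decay1 k tq tp z0 NN0 zx.
    have kz0 : 0 <= k%:R / z by rewrite divr_ge0// ltW.
    have kz : k%:R / z <= 4 * v.
      have -> : 4 * v = k%:R / (N%:R / 2) by rewrite /v; field; rewrite gt_eqF.
      by rewrite ler_pM2l// lef_pV2 ?posrE ?divr_gt0//; lra.
    apply: (le_trans (ler_normB _ _)).
    have h : `|(t - 1) * (k%:R / z) * c t (k%:R / z)| <= t * (4 * v) * (2 * bump (r ^+ 2) v ^+ 3).
      rewrite normrM normrM (gtr0_norm t1) (ger0_norm kz0).
      apply: ler_pM => //; first by rewrite mulr_ge0// ltW.
      by apply: ler_pM => //; [exact: ltW|lra].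
    apply: (le_trans (lerD Hs h)).
    have h3 := b3v v0; have h4 := b3_le v.
    have h5 : t * (4 * v) * (2 * bump (r ^+ 2) v ^+ 3) <= 8 * r * bump (r ^+ 2) v.
      have -> : t * (4 * v) * (2 * bump (r ^+ 2) v ^+ 3) = 8 * t * (bump (r ^+ 2) v ^+ 3 * v) by ring.
      have -> : 8 * r * bump (r ^+ 2) v = 8 * t * (bump (r ^+ 2) v / r).
        by rewrite /t; field; rewrite gt_eqF.
      by rewrite ler_pM2l// mulr_gt0.
    have h6 : 2 * bump (r ^+ 2) v <= r * bump (r ^+ 2) v by rewrite ler_pM2r//; have := r10; lra.
    rewrite -/v; lra.
  have := le_mean_value YN dm dK => H; apply: (le_trans H); rewrite ler_pM2l ?mulr_gt0//.
  by rewrite /Y; lra.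
have [_ tq] : t - 2 <= t - 1 /\ t - 2 <= t - 2 by split; lra.
have [Hc _] := cs_le2 k tq tq Y0; have /andP[i0 i1] := t12 k1.
have E : `|(k%:R ^+ 2 * (t - 1) * (t - 2))^-1 * (Y ^+ 2 * c (t - 2) (k%:R / Y))| <= 200 * (k%:R ^+ 2)^-1.
  rewrite normrM (ger0_norm i0) normrM (ger0_norm (sqr_ge0 Y)).
  have -> : 200 * (k%:R ^+ 2)^-1 = 4 / (k%:R ^+ 2 * t ^+ 2) * ((5 * t) ^+ 2 * 2) :> R.
    by field; rewrite !gt_eqF.
  apply: ler_pM => //; first by rewrite mulr_ge0 ?sqr_ge0.
  apply: ler_pM => //; first exact: sqr_ge0.
  have Y5 : Y <= 5 * t by exact: le_trans YN Nle.
  have Y50 : 0 <= 5 * t by exact: le_trans (ltW Y0) Y5.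
  by rewrite lerXn2r ?nnegrE// ltW.
have j0 : 0 < (k%:R * (t - 1))^-1 by rewrite invr_gt0 mulr_gt0.
have -> : anti0 c s t k%:R Y + N%:R / (t - 1) * (s (t - 1) (k%:R / N%:R) / k%:R) =
  (k%:R * (t - 1))^-1 * (N%:R * s (t - 1) (k%:R / N%:R) - Y * s (t - 1) (k%:R / Y)) +
  (k%:R ^+ 2 * (t - 1) * (t - 2))^-1 * (Y ^+ 2 * c (t - 2) (k%:R / Y)).
  rewrite /anti0; move: ((_ ^+ 2 * _ * _)^-1 * _) => e.
  by field; rewrite !gt_eqF.
apply: (le_trans (ler_normD _ _)); apply: lerD => //.
rewrite normrM (gtr0_norm j0) -/v.
apply: (@le_trans _ _ ((k%:R * (t / 2))^-1 * (9 * r * bump (r ^+ 2) v * (k%:R / 2)))).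
  apply: ler_pM => //; first exact: ltW.
  rewrite lef_pV2 ?posrE ?mulr_gt0 ?divr_gt0// ler_pM2l//; lra.
rewrite le_eqVlt; apply/orP; left; apply/eqP.
by rewrite /t; field; rewrite !gt_eqF.
Qed.

Let sum_top :
  `|\sum_(1 <= k < (N - M).+1) anti0 c s t k%:R (N%:R - k%:R / 2 + 1 / 2)| <= 760 + 10 * K0.
Proof.
have T1 := t100; have t1 : 0 < t - 1 by lra.
pose S := \sum_(1 <= k < (N - M).+1) s (t - 1) (k%:R / N%:R) / k%:R.
have HS : `|N%:R / (t - 1) * S| <= 10 * K0.
  rewrite normrM ger0_norm; last by rewrite divr_ge0// ltW.
  apply: ler_pM => //; [by rewrite divr_ge0// ltW| |exact: sum_sin NM1].
  by rewrite ler_pdivrMr//; have := Nle; move: T1; rewrite /t; lra.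
have D : `|\sum_(1 <= k < (N - M).+1) (anti0 c s t k%:R (N%:R - k%:R / 2 + 1 / 2) +
    N%:R / (t - 1) * (s (t - 1) (k%:R / N%:R) / k%:R))| <= 760.
  apply: (le_trans (ler_norm_sum _ _ _)).
  apply: (@le_trans _ _ (\sum_(1 <= k < (N - M).+1)
      (9 / r * b k (2 * N%:R) + 200 * (k%:R ^+ 2)^-1))).
    exact: ler_sum_nat top_diff.
  rewrite big_split/= -!mulr_sumr.
  have NN0 : 0 < 2 * N%:R :> R by rewrite mulr_gt0.
  have P1 : 9 / r * \sum_(1 <= k < (N - M).+1) b k (2 * N%:R) <= 360.
    apply: (@le_trans _ _ (9 / r * (4 * (2 * N%:R) / r))).
      by rewrite ler_pM2l ?divr_gt0//; exact: sum_b.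
    have -> : 9 / r * (4 * (2 * N%:R) / r) = 72 * N%:R / t by rewrite /t; field; rewrite gt_eqF.
    by rewrite ler_pdivrMr// /t; have := Nle; lra.
  have P2 := @sum_invr_sqr_le R (N - M).+1.
  apply: (@le_trans _ _ (360 + 200 * 2)); last by lra.
  by apply: lerD => //; rewrite ler_pM2l.
rewrite big_split/= -mulr_sumr -/S in D.
set A := \sum_(_ <= _ < _) _ in D *.
have -> : A = (A + N%:R / (t - 1) * S) - N%:R / (t - 1) * S by rewrite addrK.
by apply: (le_trans (ler_normB _ _)); apply: lerD.
Qed.

Lemma off_diagonal_bound :
  `|\sum_(1 <= k < N) \sum_(1 <= m < (N - k).+1)
     c t (ln (m%:R + k%:R) - ln m%:R) / Num.sqrt (m%:R * (m%:R + k%:R))| <=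
  100 * 1000 + 10 * K0.
Proof.
(* [A] holds the true terms, [B] the replaced ones, [C] those with [m >= M], and [E] the telescoping
   differences. The bounds collected below add up to [86508 + 10 K0]. *)
pose A k := \sum_(1 <= m < (N - k).+1) termG m k.
pose B k := \sum_(1 <= m < (N - k).+1) termV m k.
pose C k := \sum_(M <= m < (N - k).+1) termV m k.
pose F k y := anti0 c s t k%:R y.
pose E k := \sum_(M <= m < (N - k).+1) (F k (m%:R + k%:R / 2 + 1 / 2) -
      F k (m%:R + k%:R / 2 - 1 / 2)).
have h1 : `|\sum_(1 <= k < N) (A k - B k)| <= 64 * 1000.
  apply: (le_trans (ler_norm_sum _ _ _)); apply: le_trans sum_replace.
  apply: ler_sum => k _; rewrite -sumrB; exact: ler_norm_sum.
have h2 : `|\sum_(1 <= k < N) (B k - C k)| <= 448.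
  by apply: (le_trans (ler_norm_sum _ _ _)); exact: sum_small.
have h3 : `|\sum_(1 <= k < N) (C k - E k)| <= 21 * 1000.
  by apply: (le_trans (ler_norm_sum _ _ _)); exact: sum_mid.
have h4 : \sum_(1 <= k < N) E k =
    \sum_(1 <= k < (N - M).+1) F k (N%:R - k%:R / 2 + 1 / 2) -
    \sum_(1 <= k < (N - M).+1) F k (M%:R + k%:R / 2 - 1 / 2).
  by rewrite -sumrB -sum_if; apply: eq_big_nat => k; exact: telescope.
have h5 : `|\sum_(1 <= k < (N - M).+1) F k (M%:R + k%:R / 2 - 1 / 2)| <= 300.
  apply: (le_trans (ler_norm_sum _ _ _)); apply: le_trans sum_bottom.
  rewrite [leRHS](@big_cat_nat _ _ _ (N - M).+1)//= lerDl.
  by rewrite sumr_ge0.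
have h6 := sum_top.
rewrite -/(F _ _) in h6.
have -> : \sum_(1 <= k < N) \sum_(1 <= m < (N - k).+1)
     c t (ln (m%:R + k%:R) - ln m%:R) / Num.sqrt (m%:R * (m%:R + k%:R)) =
  \sum_(1 <= k < N) (A k - B k) + \sum_(1 <= k < N) (B k - C k) +
  \sum_(1 <= k < N) (C k - E k) + \sum_(1 <= k < N) E k.
  by rewrite -!big_split/=; apply: eq_bigr => k _; rewrite /A /termG; ring.
rewrite h4; move: h1 h2 h3 h5 h6; rewrite /F.
set a := \sum_(1 <= k < N) (A k - B k); set b := \sum_(1 <= k < N) (B k - C k).
set d := \sum_(1 <= k < N) (C k - E k).
set e := \sum_(1 <= k < _) _; set f := \sum_(1 <= k < _) _.
move=> h1 h2 h3 h5 h6.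
apply: (le_trans (ler_normD _ _)).
apply: (le_trans (lerD (le_trans (ler_normD _ _) (lerD (ler_normD _ _) (lexx _))) (ler_normB _ _))).
lra.
Qed.

End OffDiagonal.

(** * The boundary sine sum *)

Section Trig.
Context {R : realType}.
Implicit Types (x y : R).

Lemma sin_norm_le x : `|sin x| <= `|x|.
Proof.
wlog x0 : x / 0 <= x.
  move=> H; have [/H//|x0] := leP 0 x.
  by rewrite -normrN -sinN -[`|x|]normrN H// oppr_ge0 ltW.
have := @le_mean_value R sin cos 0 x 1 x0 (fun z _ => is_derive_sin z) (fun z _ => cos_max z).
by rewrite sin0 !subr0 mul1r (ger0_norm x0).
Qed.

Lemma cos_ge x : 1 - x ^+ 2 / 2 <= cos x.
Proof.
have -> : cos x = 1 - 2 * sin (x / 2) ^+ 2.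
  have {1}-> : x = (x / 2) *+ 2 by rewrite -mulr_natr divfK.
  by rewrite cos_mulr2n cos2sin2 -[_ *+ 2]mulr_natr; ring.
have : sin (x / 2) ^+ 2 <= (x / 2) ^+ 2.
  rewrite -[leLHS]real_normK ?num_real// -[leRHS]real_normK ?num_real//.
  by rewrite lerXn2r ?nnegrE// sin_norm_le.
lra.
Qed.

Lemma sin_ge_half x : 0 <= x <= 1 -> x / 2 <= sin x.
Proof.
move=> /andP[x0 x1].
have [z] := @MVT_segment R sin cos 0 x x0 (fun z _ => is_derive_sin z)
   (continuous_subspaceT (@continuous_sin R)).
rewrite in_itv/= sin0 !subr0 => /andP[z0 zx] ->.
rewrite mulrC ler_wpM2r//; apply: le_trans (cos_ge z).
have : z ^+ 2 <= 1 by rewrite expr_le1// (le_trans zx).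
lra.
Qed.

(** Summation by parts: [2 sin (x/2) sin (k x)] is a difference of consecutive cosines and [1/k]
    decreases. The bound is uniform in [n]; its growth as [x] tends to 0 is harmless, since the
    argument used is [x / N], of constant order near the mean. *)
Lemma sum_sin_div_le x (n : nat) : 0 < x <= 1 ->
  `|\sum_(1 <= k < n) sin (k%:R * x) / k%:R| <= 4 / x.
Proof.
move=> /andP[x0 x1].
have s0 : x / 4 <= sin (x / 2).
  by apply: le_trans (sin_ge_half _); [lra|apply/andP; split; lra].
have C0 : 0 <= 4 / x by rewrite divr_ge0// ltW.
case: n => [|[|n]]; [by rewrite big_geq// normr0..|].
pose C k := cos ((k%:R - 1 / 2) * x).
have E k : 2 * sin (x / 2) * sin (k%:R * x) = C k - C k.+1.
  rewrite /C (_ : (k%:R - 1 / 2) * x = k%:R * x - x / 2); last by field.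
  rewrite (_ : (k.+1%:R - 1 / 2) * x = k%:R * x + x / 2); last by rewrite -natr1; field.
  by rewrite cosB cosD; ring.
have H : `|\sum_(1 <= k < n.+2) (C k - C k.+1) / k%:R + C n.+2 / n.+1%:R| <=
    2 - n.+1%:R^-1.
  elim: n => [|n IH].
    rewrite big_nat1 !divr1 subrK invr1 (_ : 2 - 1 = 1); last by lra.
    exact: cos_max.
  rewrite big_nat_recr//=.
  set S := \sum_(_ <= _ < _) _ in IH *.
  have -> : S + (C n.+2 - C n.+3) / n.+2%:R + C n.+3 / n.+2%:R =
    (S + C n.+2 / n.+1%:R) - C n.+2 * (n.+1%:R^-1 - n.+2%:R^-1) by ring.
  apply: (le_trans (ler_normB _ _)); rewrite normrM.
  have d0 : 0 <= n.+1%:R^-1 - n.+2%:R^-1 :> R.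
    by rewrite subr_ge0 lef_pV2 ?posrE// ler_nat.
  rewrite (ger0_norm d0).
  have H : `|C n.+2| * (n.+1%:R^-1 - n.+2%:R^-1) <= 1 * (n.+1%:R^-1 - n.+2%:R^-1).
    by apply: ler_wpM2r => //; exact: cos_max.
  by apply: (le_trans (lerD IH H)); rewrite mul1r addrA subrK.
have H2 : `|\sum_(1 <= k < n.+2) (C k - C k.+1) / k%:R| <= 2.
  rewrite -[X in `|X|](addrK (C n.+2 / n.+1%:R)).
  apply: (le_trans (ler_normB _ _)).
  have H1 : `|C n.+2 / n.+1%:R| <= n.+1%:R^-1.
    rewrite normrM normfV (ger0_norm (ler0n _ _)) ler_piMl//; exact: cos_max.
  by apply: (le_trans (lerD H H1)); rewrite subrK.
have E2 : \sum_(1 <= k < n.+2) (C k - C k.+1) / k%:R =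
    2 * sin (x / 2) * \sum_(1 <= k < n.+2) sin (k%:R * x) / k%:R.
  by rewrite mulr_sumr; apply: eq_bigr => k _; rewrite -E mulrA.
rewrite E2 normrM in H2.
have s2 : x / 2 <= `|2 * sin (x / 2)| by rewrite ger0_norm; lra.
set A := `|\sum_(_ <= _ < _) _| in H2 *.
have A0 : 0 <= A by exact: normr_ge0.
have : x / 2 * A <= 2 by apply: le_trans H2; exact: ler_wpM2r.
rewrite ler_pdivlMr//; lra.
Qed.

(* Near the mean [sum_sin_div_le] applies; elsewhere the trivial bound [N] is paid for by the variance. *)
Lemma gexp_sum_sin_le (t : R) (N n : nat) :
  (forall t : R, 0 < t -> (\int[lebesgue_measure]_(x in setT) (gamma_density t x)%:E = 1)%E) ->
  100 <= t -> 4 * t <= N%:R -> N%:R <= 5 * t -> (n <= N)%N ->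
  `|\sum_(1 <= k < n) gsin (t - 1) (k%:R / N%:R) / k%:R| <= 120.
Proof.
move=> mass t100 N4 N5 nN.
have N0 : 0 < N%:R :> R by lra.
set p := t - 1; have p0 : 0 < p by rewrite /p; lra.
pose g x : R := \sum_(1 <= k < n) (k%:R^-1 * sin (k%:R / N%:R * x)).
have gint_g k : gint p (fun x => k%:R^-1 * sin (k%:R / N%:R * x)).
  by apply: gintZ; exact: gint_sin.
have gg : gint p g by apply: gint_sum.
have -> : \sum_(1 <= k < n) gsin p (k%:R / N%:R) / k%:R = gexp p g.
  rewrite /g gexp_sum//; apply: eq_bigr => k _.
  by rewrite gexpZ 1?mulrC//; exact: gint_sin.
(* [40] is [4N/x] at [N = 5t], [x = t/2]. Off the window [|x - p| >= t/4], whence the factor 16. The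
   variance [p] makes the expectation of the second term at most 80. *)
pose h x : R := 40 + 16 * N%:R / t ^+ 2 * (x - p) ^+ 2.
have cN : 0 <= 16 * N%:R / t ^+ 2.
  exact: divr_ge0 (mulr_ge0 (ler0n _ 16) (ltW N0)) (sqr_ge0 _).
have gh : forall x, 0 < x -> `|g x| <= h x.
  move=> x x0.
  have h0 : 0 <= 16 * N%:R / t ^+ 2 * (x - p) ^+ 2 by rewrite mulr_ge0 ?sqr_ge0.
  have gE : g x = \sum_(1 <= k < n) sin (k%:R * (x / N%:R)) / k%:R.
    by apply: eq_bigr => k _; rewrite mulrC mulrA [_ / N%:R * x]mulrAC.
  have [/andP[x1 x2]|xbad] := boolP (t / 2 <= x <= 2 * t).
    have xN : 0 < x / N%:R <= 1.
      by rewrite divr_gt0//= ler_pdivrMr//; lra.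
    rewrite gE; apply: (le_trans (sum_sin_div_le n xN)).
    rewrite (_ : 4 / (x / N%:R) = 4 * N%:R / x); last by rewrite invf_div mulrA.
    rewrite ler_pdivrMr// /h; apply: (@le_trans _ _ (40 * x)); first by lra.
    by rewrite ler_pM2r//; lra.
  have xt : t ^+ 2 <= 16 * (x - p) ^+ 2.
    have xa : t <= 4 * `|x - p|.
      move: xbad; rewrite negb_and -!ltNge => /orP[xs|xl].
        have : p - x <= `|x - p| by rewrite distrC ler_norm.
        by rewrite /p; lra.
      have := ler_norm (x - p); rewrite /p; lra.
    have -> : 16 * (x - p) ^+ 2 = (4 * `|x - p|) ^+ 2.
      by rewrite exprMn real_normK ?num_real//; congr (_ * _); ring.
    by rewrite lerXn2r ?nnegrE ?mulr_ge0//; lra.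
  have gN : `|g x| <= N%:R.
    rewrite gE; apply: (le_trans (ler_norm_sum _ _ _)).
    apply: (@le_trans _ _ (\sum_(1 <= k < n) (1 : R))).
      apply: ler_sum_nat => k /andP[k1 _]; rewrite normrM normfV (ger0_norm (ler0n _ _)).
      rewrite ler_pdivrMr ?ltr0n// mul1r; apply: (le_trans (sin_max _)).
      by rewrite ler1n.
    by rewrite sumr_const_nat ler_nat (leq_trans (leq_subr _ _)).
  apply: (le_trans gN); rewrite /h.
  have : N%:R <= 16 * N%:R / t ^+ 2 * (x - p) ^+ 2.
    rewrite mulrAC ler_pdivlMr ?exprn_gt0//; last by lra.
    rewrite (_ : 16 * N%:R * (x - p) ^+ 2 = N%:R * (16 * (x - p) ^+ 2)); last by ring.
    by rewrite ler_pM2l.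
  lra.
have gv := gint_variance mass p0.
have hint : gint p h.
  by apply: gintD; [exact: gint_cst|exact: gintZ].
have hE : gexp p h <= 120.
  rewrite /h gexpD//; [|exact: gint_cst|exact: gintZ].
  rewrite gexp_cst// gexpZ// gexp_variance//.
  have : 16 * N%:R / t ^+ 2 * p <= 80.
    rewrite mulrAC ler_pdivrMr ?exprn_gt0//; last by lra.
    have : N%:R * p <= 5 * t * t by apply: ler_pM => //; rewrite /p; lra.
    lra.
  lra.
rewrite ler_norml; apply/andP; split.
  have : gexp p (fun x => (-1) * g x) <= gexp p h.
    apply: le_gexp => //; first exact: gintZ.
    by move=> x x0; rewrite mulN1r (le_trans _ (gh x x0))// -normrN ler_norm.
  rewrite gexpZ// mulN1r; lra.
apply: le_trans hE; apply: le_gexp => // x x0.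
exact: le_trans (ler_norm _) (gh x x0).
Qed.

End Trig.

(** * Approximating zeta by a Dirichlet polynomial *)

Section ComplexNorm.
Local Open Scope complex_scope.
Context {R : realType}.
Implicit Types (z w : R[i]).

(** The modulus as an element of [R]; the built-in norm on [R[i]] takes its values in [R[i]]. *)
Definition cnorm z : R := Num.sqrt (complex.Re z ^+ 2 + complex.Im z ^+ 2).

Lemma cnormE z : cnorm z = Normc.normc z. Proof. by case: z. Qed.

Lemma cnorm_ge0 z : 0 <= cnorm z. Proof. exact: sqrtr_ge0. Qed.

Lemma sqr_cnorm z : cnorm z ^+ 2 = complex.Re z ^+ 2 + complex.Im z ^+ 2.
Proof. by rewrite sqr_sqrtr// addr_ge0 ?sqr_ge0. Qed.

Lemma cnormM z w : cnorm (z * w) = cnorm z * cnorm w.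
Proof. by rewrite !cnormE Normc.normcM. Qed.

Lemma cnormV z : cnorm z^-1 = (cnorm z)^-1.
Proof. by rewrite !cnormE Normc.normcV. Qed.

Lemma cnormD z w : cnorm (z + w) <= cnorm z + cnorm w.
Proof. by rewrite !cnormE; exact: le_normcD. Qed.

Lemma cnormN z : cnorm (- z) = cnorm z.
Proof. by case: z => a b; rewrite /cnorm /= !sqrrN. Qed.

Lemma cnormB z w : cnorm (z - w) <= cnorm z + cnorm w.
Proof. by rewrite -(cnormN w); exact: cnormD. Qed.

Lemma cnorm0 : cnorm 0 = 0.
Proof. by rewrite /cnorm /= expr0n/= addr0 sqrtr0. Qed.

Lemma cnorm_sum (f : nat -> R[i]) (a b : nat) :
  cnorm (\sum_(a <= n < b) f n) <= \sum_(a <= n < b) cnorm (f n).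
Proof.
elim/big_ind2 : _ => //; first by rewrite cnorm0.
by move=> x1 x2 y1 y2 h1 h2; apply: (le_trans (cnormD _ _)); exact: lerD.
Qed.

Lemma Re_le_cnorm z : `|complex.Re z| <= cnorm z.
Proof. by rewrite -sqrtr_sqr ler_wsqrtr// lerDl sqr_ge0. Qed.

Lemma Im_le_cnorm z : `|complex.Im z| <= cnorm z.
Proof. by rewrite -sqrtr_sqr ler_wsqrtr// lerDr sqr_ge0. Qed.

Lemma cnorm_le z : cnorm z <= `|complex.Re z| + `|complex.Im z|.
Proof.
rewrite -[leRHS]ger0_norm ?addr_ge0// -sqrtr_sqr ler_wsqrtr//.
rewrite -[in leLHS](real_normK (num_real (complex.Re z))).
rewrite -[in leLHS](real_normK (num_real (complex.Im z))).
by rewrite sqrrD lerD2r lerDl mulrn_wge0// mulr_ge0.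
Qed.

(* Kusmin-Landau: write [z n = (z n - z n.+1) / (1 - q n)] and sum by parts. *)
Lemma cnorm_sum_by_parts (z q : nat -> R[i]) (e : nat -> R) (Z d : R) (A B : nat) :
  0 < d -> 0 <= Z ->
  (forall n, (A <= n)%N -> z n.+1 = q n * z n) ->
  (forall n, (A <= n < B)%N -> d <= cnorm (1 - q n)) ->
  (forall n, (A <= n)%N -> cnorm (q n.+1 - q n) <= e n) ->
  (forall n, (A <= n)%N -> cnorm (z n) <= Z) ->
  cnorm (\sum_(A <= n < B) z n) <= Z * (2 / d + (\sum_(A <= n < B) e n) / d ^+ 2).
Proof.
move=> d0 Z0 zq dq qe zZ.
have e0 n : (A <= n)%N -> 0 <= e n by move=> An; exact: le_trans (cnorm_ge0 _) (qe n An).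
have se0 n : 0 <= \sum_(A <= n < n) e n.
  by rewrite big_nat_cond sumr_ge0// => i /andP[/andP[Ai _] _]; exact: e0.
have dV : 0 <= d^-1 by rewrite invr_ge0 ltW.
have [BA|AB] := leqP B A.
  rewrite !big_geq// cnorm0 mul0r addr0 mulr_ge0// divr_ge0// ltW//.
case: B AB dq => // B; rewrite ltnS => AB dq.
pose c n := (1 - q n)^-1.
have cn n : (A <= n <= B)%N -> cnorm (c n) <= d^-1.
  move=> nAB; have dn := dq n nAB.
  by rewrite cnormV lef_pV2 ?posrE// (lt_le_trans d0).
have qn0 n : (A <= n <= B)%N -> 1 - q n != 0.
  move=> nAB; apply/eqP => E; have := dq n nAB; rewrite E cnorm0.
  by rewrite leNgt d0.
(* Abel summation in the form needed: [z n = c n (z n - z n.+1)], with the boundary term at the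
   upper end kept on the left so that the induction closes. *)
have E n : (A <= n <= B)%N -> \sum_(A <= i < n.+1) z i + c n * z n.+1 =
    c A * z A + \sum_(A <= i < n) (c i.+1 - c i) * z i.+1.
  elim: n => [|n IH] /andP[An nB].
    move: An; rewrite leqn0 => /eqP A0; subst A.
    rewrite big_nat1 [X in _ = _ + X]big_geq// addr0 zq// /c.
    have Q := qn0 0%N nB; move: (q 0%N) (z 0%N) Q => a b Q.
    by field; exact: Q.
  have [nA|nA] := ltnP n A.
    have An' : n.+1 = A by apply/eqP; rewrite eqn_leq nA An.
    rewrite An' big_nat1 [X in _ = _ + X]big_geq// addr0 zq// /c.
    have Q := qn0 A _; move: Q; rewrite leqnn AB => /(_ isT).
    move: (q A) (z A) => a b Q.
    by field; exact: Q.
  rewrite [in RHS]big_nat_recr//= big_nat_recr ?leqW//= addrA -IH; last first.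
    by rewrite nA ltnW.
  rewrite (zq n.+1)// /c.
  have Q1 : 1 - q n.+1 != 0 by apply: qn0; rewrite An nB.
  have Q2 : 1 - q n != 0 by apply: qn0; rewrite nA ltnW.
  move: (\sum_(_ <= _ < _) _) (q n.+1) (q n) (z n.+1) Q1 Q2 => S a b w Q1 Q2.
  by field; rewrite Q1 Q2.
have BB : (A <= B <= B)%N by rewrite AB leqnn.
have AA : (A <= A <= B)%N by rewrite AB leqnn.
have -> : \sum_(A <= n < B.+1) z n =
    c A * z A + \sum_(A <= i < B) (c i.+1 - c i) * z i.+1 - c B * z B.+1.
  by rewrite -E// addrK.
apply: (le_trans (cnormB _ _)); rewrite cnormM.
have h1 : cnorm (c B) * cnorm (z B.+1) <= d^-1 * Z.
  by apply: ler_pM; rewrite ?cnorm_ge0 ?cn ?zZ// leqW.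
have h2 : cnorm (c A * z A) <= d^-1 * Z.
  by rewrite cnormM; apply: ler_pM; rewrite ?cnorm_ge0 ?cn ?zZ.
have h3 : cnorm (\sum_(A <= i < B) (c i.+1 - c i) * z i.+1) <=
    (\sum_(A <= n < B) e n) / d ^+ 2 * Z.
  apply: (le_trans (cnorm_sum _ _ _)); rewrite !mulr_suml.
  apply: ler_sum_nat => i /andP[Ai iB].
  have i1 : (A <= i <= B)%N by rewrite Ai ltnW.
  have i2 : (A <= i.+1 <= B)%N by rewrite leqW.
  rewrite cnormM; apply: ler_pM; rewrite ?cnorm_ge0 ?zZ 1?leqW//.
  have -> : c i.+1 - c i = (q i.+1 - q i) * (c i * c i.+1).
    rewrite /c; have := qn0 _ i1; have := qn0 _ i2; move: (q i) (q i.+1) => a b Q1 Q2.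
    by field; rewrite Q1 Q2.
  rewrite cnormM; apply: ler_pM; rewrite ?cnorm_ge0 ?qe//.
  rewrite cnormM -exprVn expr2; apply: ler_pM; rewrite ?cnorm_ge0 ?cn//.
have h4 : (\sum_(A <= n < B) e n) / d ^+ 2 * Z <= (\sum_(A <= n < B.+1) e n) / d ^+ 2 * Z.
  apply: ler_wpM2r => //; apply: ler_wpM2r; first by rewrite invr_ge0 sqr_ge0.
  by rewrite [leRHS]big_nat_recr//= lerDl e0.
apply: (le_trans (lerD (le_trans (cnormD _ _) (lerD h2 (le_trans h3 h4))) h1)).
by rewrite le_eqVlt; apply/orP; left; apply/eqP; ring.
Qed.

End ComplexNorm.

(** * Ratios of consecutive terms and the Kusmin-Landau bounds *)

Section CriticalLine.
Local Open Scope complex_scope.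
Context {R : realType}.
Implicit Types (x : R) (n : nat).

Definition lratio n : R := ln n.+1%:R - ln n%:R.

Definition rho n : R := Num.sqrt (n%:R / n.+1%:R).

(** This is [(n / (n+1))^(1/2 + ix)], with modulus [rho n] and phase [- x lratio n]. *)
Definition npow_ratio x n : R[i] :=
  (rho n * cos (x * lratio n)) -i* (rho n * sin (x * lratio n)).

Let npowE n : (0 < n)%N -> n%:R `^ (- 2^-1) = (Num.sqrt (n%:R : R))^-1.
Proof. by move=> n0; rewrite powRN powR12_sqrt. Qed.

Lemma npow_critS x n : (0 < n)%N -> npow_crit x n.+1 = npow_ratio x n * npow_crit x n.
Proof.
move=> n0; rewrite /npow_crit !npowE// /npow_ratio.
have s0 : Num.sqrt (n%:R : R) != 0 by rewrite gt_eqF// sqrtr_gt0 ltr0n.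
have -> : rho n = Num.sqrt n%:R / Num.sqrt n.+1%:R.
  by rewrite /rho sqrtrM// sqrtrV.
have -> : x * ln n.+1%:R = x * lratio n + x * ln n%:R.
  by rewrite /lratio -mulrDr subrK.
rewrite cosD sinD; move: (cos (x * lratio n)) (sin (x * lratio n)) => c s.
move: (cos (x * _)) (sin (x * _)) => c' s'.
move: (Num.sqrt n%:R) (Num.sqrt n.+1%:R) s0 => a b a0.
have E (p q : R[i]) : complex.Re p = complex.Re q -> complex.Im p = complex.Im q -> p = q.
  by case: p q => [? ?] [? ?] /= -> ->.
apply: E => /=.
  transitivity (b^-1 * (a / a) * (c * c' - s * s')); last by ring.
  by rewrite divff// mulr1.
transitivity (- (b^-1 * (a / a)) * (s * c' + c * s')); last by ring.
by rewrite divff// mulr1; ring.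
Qed.

Lemma cnorm_npow x n : (0 < n)%N -> cnorm (npow_crit x n) = (Num.sqrt n%:R)^-1.
Proof.
move=> n0; rewrite /cnorm /npow_crit npowE//=.
set a := _^-1; have a0 : 0 <= a by rewrite invr_ge0.
rewrite sqrrN !exprMn -mulrDr cos2Dsin2 mulr1.
by rewrite sqrtr_sqr ger0_norm.
Qed.

Lemma lratio_ge n : (0 < n)%N -> n.+1%:R^-1 <= lratio n.
Proof.
move=> n0; have n0' : 0 < n%:R :> R by rewrite ltr0n.
rewrite /lratio -lerN2 opprB -ln_div ?posrE//.
have -> : n%:R / n.+1%:R = 1 + - (n.+1%:R)^-1 :> R.
  by rewrite -natr1; field; rewrite gt_eqF// addr_gt0.
by apply: le_ln1Dx; rewrite ltrN2 invf_lt1 ?ltr1n.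
Qed.

Lemma lratio_le n : (0 < n)%N -> lratio n <= n%:R^-1.
Proof.
move=> n0; have n0' : 0 < n%:R :> R by rewrite ltr0n.
rewrite /lratio -ln_div ?posrE//.
have -> : n.+1%:R / n%:R = 1 + n%:R^-1 :> R.
  by rewrite -natr1 mulrDl mul1r divff// gt_eqF.
by apply: le_ln1Dx; apply: lt_trans (_ : 0 < _); rewrite ?ltrN10 ?invr_gt0.
Qed.

(** The difference is the logarithm of [(n+1)^2 / (n (n+2)) = 1 + 1 / (n (n+2))]. *)
Lemma lratio_diff n : (0 < n)%N -> 0 <= lratio n - lratio n.+1 <= (n%:R ^+ 2)^-1.
Proof.
move=> n0; have n0' : 0 < n%:R :> R by rewrite ltr0n.
have E : lratio n - lratio n.+1 = ln (1 + (n%:R * n.+2%:R)^-1).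
  rewrite /lratio opprB addrACA -opprD -!lnM ?posrE// -ln_div ?posrE ?mulr_gt0//.
  congr ln; rewrite -[n.+2]addn2 natrD -natr1; field.
  by rewrite !gt_eqF// addr_gt0.
have q0 : 0 < (n%:R * n.+2%:R : R)^-1 by rewrite invr_gt0 mulr_gt0.
rewrite E; apply/andP; split; first by rewrite ln_ge0// lerDl ltW.
apply: (le_trans (le_ln1Dx _)); first by apply: lt_trans q0; rewrite ltrN10.
by rewrite lef_pV2 ?posrE ?exprn_gt0 ?mulr_gt0// expr2 ler_pM2l// ler_nat leqW.
Qed.

Lemma rho_sqr n : rho n ^+ 2 = n%:R / n.+1%:R.
Proof. by rewrite sqr_sqrtr// divr_ge0. Qed.

Lemma rho_ge n : (0 < n)%N -> 1 / 2 <= rho n.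
Proof.
move=> n0; rewrite -(@ler_pXn2r _ 2)// ?nnegrE ?sqrtr_ge0//.
rewrite rho_sqr ler_pdivlMr// -[n.+1%:R]natr1.
have : 1 <= n%:R :> R by rewrite ler1n.
by rewrite (_ : (1 / 2) ^+ 2 = 1 / 4); [lra|field].
Qed.

Lemma rho_le1 n : rho n <= 1.
Proof.
rewrite -[leRHS]sqrtr1 ler_wsqrtr// ler_pdivrMr// mul1r ler_nat//.
Qed.

(** The difference of the squares is [1 / ((n+1)(n+2))], and the sum of the two values is at least
    1. *)
Lemma rho_diff n : (0 < n)%N -> `|rho n.+1 - rho n| <= (n%:R ^+ 2)^-1.
Proof.
move=> n0; have n0' : 0 < n%:R :> R by rewrite ltr0n.
have n1 : 0 < n%:R + 1 :> R by rewrite addr_gt0.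
have n2 : 0 < n%:R + 2 :> R by rewrite addr_gt0.
have r1 := rho_ge n0; have r2 : 1 / 2 <= rho n.+1 by exact: rho_ge.
have E : (rho n.+1 - rho n) * (rho n.+1 + rho n) = ((n%:R + 1) * (n%:R + 2))^-1.
  rewrite -subr_sqr !rho_sqr -[n.+2]addn2 natrD -natr1.
  by field; rewrite !gt_eqF.
have q0 : 0 < ((n%:R + 1) * (n%:R + 2) : R)^-1 by rewrite invr_gt0 mulr_gt0.
have s1 : 1 <= rho n.+1 + rho n by lra.
have : `|rho n.+1 - rho n| * (rho n.+1 + rho n) = ((n%:R + 1) * (n%:R + 2))^-1.
  by rewrite -[RHS]gtr0_norm// -E normrM (@ger0_norm _ (rho n.+1 + rho n))//; lra.
have : `|rho n.+1 - rho n| * 1 <= `|rho n.+1 - rho n| * (rho n.+1 + rho n).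
  by apply: ler_wpM2l.
rewrite mulr1 => /le_trans H H2; apply: H; rewrite H2.
rewrite lef_pV2 ?posrE ?exprn_gt0 ?mulr_gt0//; nra.
Qed.

Lemma npow_ratio_diff x n : (0 < n)%N ->
  cnorm (npow_ratio x n.+1 - npow_ratio x n) <= 2 * (1 + `|x|) * (n%:R ^+ 2)^-1.
Proof.
move=> n0; apply: (le_trans (cnorm_le _)); rewrite /npow_ratio /=.
have rd := rho_diff n0; have /andP[l0 l1] := lratio_diff n0.
set w := (n%:R ^+ 2)^-1 in rd l1 *.
have w0 : 0 <= w by rewrite invr_ge0 sqr_ge0.
have xd : `|x * lratio n.+1 - x * lratio n| <= `|x| * w.
  by rewrite -mulrBr normrM ler_wpM2l// distrC ger0_norm.
have lip (f f' : R -> R) (a b : R) : (forall z : R, is_derive z 1 f (f' z)) ->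
    (forall z, `|f' z| <= 1) -> `|f b - f a| <= `|b - a|.
  move=> df f1; have [ab|ba] := leP a b.
    have := @le_mean_value R f f' a b 1 ab (fun z _ => df z) (fun z _ => f1 z).
    by rewrite mul1r [`|b - a|]ger0_norm// subr_ge0.
  have := @le_mean_value R f f' b a 1 (ltW ba) (fun z _ => df z) (fun z _ => f1 z).
  by rewrite mul1r distrC [`|b - a|]distrC [`|a - b|]gtr0_norm// subr_gt0.
have key (f f' : R -> R) : (forall z : R, is_derive z 1 f (f' z)) ->
    (forall z, `|f' z| <= 1) -> (forall z, `|f z| <= 1) ->
    `|rho n.+1 * f (x * lratio n.+1) - rho n * f (x * lratio n)| <= (1 + `|x|) * w.
  move=> df f'1 f1.
  have -> : rho n.+1 * f (x * lratio n.+1) - rho n * f (x * lratio n) =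
    (rho n.+1 - rho n) * f (x * lratio n.+1) +
    rho n * (f (x * lratio n.+1) - f (x * lratio n)) by ring.
  rewrite [(1 + `|x|) * w]mulrDl mul1r; apply: (le_trans (ler_normD _ _)); rewrite !normrM.
  apply: lerD.
    by rewrite -[leRHS]mulr1; apply: ler_pM.
  rewrite -[leRHS]mul1r; apply: ler_pM => //.
    by rewrite ger0_norm ?sqrtr_ge0 ?rho_le1.
  exact: le_trans (lip _ _ _ _ df f'1) xd.
have k1 := key cos (fun z => - sin z) (fun z => is_derive_cos z) _ (@cos_max R).
have k2 := key sin cos (fun z => is_derive_sin z) (@cos_max R) (@sin_max R).
rewrite -mulrA mulr_natl mulr2n; apply: lerD.
  by apply: k1 => z; rewrite normrN; exact: sin_max.
by apply: le_trans k2; rewrite -normrN le_eqVlt; apply/orP; left; apply/eqP; congr (`|_|); ring.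
Qed.

Lemma angle_le x n : (0 < n)%N -> `|x| <= n%:R -> `|x * lratio n| <= 1.
Proof.
move=> n0 xn; have n0' : 0 < n%:R :> R by rewrite ltr0n.
have l0 : 0 <= lratio n by apply: le_trans (lratio_ge n0); rewrite invr_ge0.
rewrite normrM (ger0_norm l0); apply: (@le_trans _ _ (n%:R * n%:R^-1)).
  by apply: ler_pM => //; exact: lratio_le.
by rewrite divff// gt_eqF.
Qed.

Let sum_ratio_diff x (A B : nat) : (1 < A)%N -> `|x| <= A%:R ->
  \sum_(A <= n < B) 2 * (1 + `|x|) * ((n%:R : R) ^+ 2)^-1 <= 8.
Proof.
move=> A1 xA; rewrite -mulr_sumr.
have A2 : 2 <= A%:R :> R by rewrite ler_nat.
have A1r : 0 < A.-1%:R :> R by rewrite ltr0n -ltnS prednK// ltnW.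
have AE : A%:R = A.-1%:R + 1 :> R by rewrite natr1 prednK// ltnW.
have S := @sum_invr_sqr_from_le R A B A1.
apply: (@le_trans _ _ (2 * (1 + `|x|) * (A.-1%:R)^-1)).
  by apply: ler_wpM2l => //; rewrite mulr_ge0// addr_ge0.
rewrite ler_pdivrMr//; lra.
Qed.

Definition eta_term x n : R[i] := (-1) ^+ n.+1 * npow_crit x n.

(** The alternating sign makes the ratio [- npow_ratio]. Beyond [|x|] the phase is at most 1, so its
    cosine is positive and [|1 - q| >= 1]; the variation of the ratios is at most 8, and
    [2 + 8 = 10]. *)
Lemma eta_term_tail x (A B : nat) : (1 < A)%N -> `|x| <= A%:R ->
  cnorm (\sum_(A <= n < B) eta_term x n) <= 10 / Num.sqrt A%:R.
Proof.
move=> A1 xA; have A0 := ltnW A1.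
have sA : 0 < Num.sqrt (A%:R : R) by rewrite sqrtr_gt0 ltr0n.
have Z0 : 0 <= (Num.sqrt (A%:R : R))^-1 by rewrite invr_ge0 ltW.
have H := @cnorm_sum_by_parts R (eta_term x) (fun n => - npow_ratio x n)
  (fun n => 2 * (1 + `|x|) * (n%:R ^+ 2)^-1) (Num.sqrt (A%:R : R))^-1 1 A B ltr01 Z0.
apply: (le_trans (H _ _ _ _)).
- move=> n An; have n0 : (0 < n)%N by exact: leq_trans An.
  by rewrite /eta_term npow_critS// exprS; ring.
- move=> n /andP[An _]; have n0 : (0 < n)%N by exact: leq_trans An.
  apply: le_trans (Re_le_cnorm _); rewrite /npow_ratio opprK /=.
  apply: le_trans (ler_norm _); rewrite lerDl mulr_ge0 ?sqrtr_ge0//.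
  have xn : `|x| <= n%:R by apply: (le_trans xA); rewrite ler_nat.
  have := angle_le n0 xn; have := cos_ge (x * lratio n).
  move: (x * lratio n) => y cy y1; apply: le_trans cy.
  have : y ^+ 2 <= 1 by rewrite -[leLHS]real_normK ?num_real// expr_le1.
  lra.
- move=> n An; have n0 : (0 < n)%N by exact: leq_trans An.
  by rewrite -cnormN opprD !opprK; exact: npow_ratio_diff.
- move=> n An; have n0 : (0 < n)%N by exact: leq_trans An.
  rewrite /eta_term cnormM (_ : cnorm ((-1) ^+ n.+1) = 1) ?mul1r; last first.
    elim: n.+1 => [|m IH]; first by rewrite expr0 /cnorm /= expr1n expr0n/= addr0 sqrtr1.
    by rewrite exprS cnormM IH mulr1 cnormN /cnorm /= expr1n expr0n/= addr0 sqrtr1.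
  by rewrite cnorm_npow// lef_pV2 ?posrE ?sqrtr_gt0 ?ltr0n// ler_wsqrtr// ler_nat.
rewrite expr1n !divr1 [10 / _]mulrC; apply: ler_wpM2l => //.
have := sum_ratio_diff B A1 xA; lra.
Qed.

(** In this block the phase [x lratio n] lies in [[1/22, 1]]: [x >= t/2] while [n + 1 <= 11 t].
    Hence its sine is at least [1/44], and with [rho >= 1/2] the imaginary part of [1 - q] is at
    least [1/88]. *)
Lemma npow_block x (N : nat) (t : R) : 100 <= t -> 4 * t <= N%:R -> N%:R <= 5 * t ->
  t / 2 <= x <= 2 * t ->
  cnorm (\sum_(N.+1 <= n < (2 * N).+1) npow_crit x n) <= 176 + 8 * 88 ^+ 2.
Proof.
move=> t100 N4 N5 /andP[x1 x2].
have N1 : (1 < N.+1)%N by rewrite ltnS -(ltr0n R); lra.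
have x0 : 0 < x by lra.
have xN : `|x| <= N.+1%:R by rewrite gtr0_norm// -[N.+1%:R]natr1; lra.
have d0 : 0 < 88^-1 :> R by rewrite invr_gt0.
have H := @cnorm_sum_by_parts R (npow_crit x) (npow_ratio x)
  (fun n => 2 * (1 + `|x|) * (n%:R ^+ 2)^-1) 1 88^-1 N.+1 (2 * N).+1 d0 ler01.
apply: (le_trans (H _ _ _ _)).
- by move=> n An; rewrite npow_critS//; exact: leq_trans An.
- move=> n /andP[An]; rewrite ltnS => nN.
  have n0 : (0 < n)%N by exact: leq_trans An.
  have n0' : 0 < n%:R :> R by rewrite ltr0n.
  have nR : N%:R + 1 <= n%:R :> R by rewrite natr1 ler_nat.
  have nR2 : n%:R <= 2 * N%:R :> R by rewrite -natrM ler_nat.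
  apply: le_trans (Im_le_cnorm _).
  have -> : complex.Im (1 - npow_ratio x n) = rho n * sin (x * lratio n).
    by rewrite /npow_ratio /=; ring.
  have l1 := lratio_ge n0; have l2 := lratio_le n0.
  have th1 : x * lratio n <= 1.
    by have := angle_le n0 (le_trans xN _); rewrite ler_nat => /(_ An) /(le_trans (ler_norm _)).
  have th2 : 22^-1 <= x * lratio n.
    apply: (@le_trans _ _ (x * n.+1%:R^-1)); last by rewrite ler_pM2l.
    rewrite -[22^-1]mul1r ler_pdivrMr// mulrAC ler_pdivlMr// -[n.+1%:R]natr1; lra.
  have s1 : 44^-1 <= sin (x * lratio n).
    apply: le_trans (sin_ge_half _); first lra.
    by rewrite th1 andbT; apply: le_trans th2; rewrite invr_ge0.
  have r1 := rho_ge n0.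
  apply: le_trans (ler_norm _).
  have : 1 / 2 * 44^-1 <= rho n * sin (x * lratio n) by apply: ler_pM.
  lra.
- by move=> n An; apply: npow_ratio_diff; exact: leq_trans An.
- move=> n An; have n0 : (0 < n)%N by exact: leq_trans An.
  rewrite cnorm_npow// invf_le1 ?sqrtr_gt0 ?ltr0n//.
  by rewrite -[leLHS]sqrtr1 ler_wsqrtr// ler1n.
have S := sum_ratio_diff (2 * N).+1 N1 xN.
rewrite mul1r invrK exprVn invrK.
apply: lerD; first lra.
by apply: ler_wpM2r; rewrite ?sqr_ge0.
Qed.

End CriticalLine.

Lemma cauchy_lim_dist (R : realType) (u b : nat -> R) (n0 : nat) :
  (forall n m, (n0 <= n)%N -> (n <= m)%N -> `|u m - u n| <= b n) ->
  (forall e, 0 < e -> exists2 n, (n0 <= n)%N & b n <= e) ->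
  u n @[n --> \oo] --> limn u /\ forall n, (n0 <= n)%N -> `|limn u - u n| <= b n.
Proof.
move=> ub be.
have cu : cvgn u.
  apply: cauchy_cvg; apply: cauchy_exP => e e0.
  have [n nn0 bn] := be (e / 2) (divr_gt0 e0 (ltr0n _ 2)).
  exists (u n); exists n => // m /= nm; rewrite /ball /=.
  rewrite distrC; apply: le_lt_trans (ub n m nn0 nm) _; apply: (le_lt_trans bn).
  by rewrite ltr_pdivrMr// ltr_pMr// ltr1n.
split=> // n nn0; apply/ler_addgt0Pr => e e0.
have /cvgrPdist_le/(_ e e0)[m _ H] := cu.
have h1 : `|limn u - u (maxn m n)| <= e by apply: H; rewrite /= leq_maxl.
have h2 := ub n (maxn m n) nn0 (leq_maxr _ _).
have -> : limn u - u n = (limn u - u (maxn m n)) + (u (maxn m n) - u n) by ring.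
by apply: (le_trans (ler_normD _ _)); rewrite addrC; exact: lerD.
Qed.

(** * From the alternating series to zeta *)

Section Zeta.
Local Open Scope complex_scope.
Context {R : realType}.
Implicit Types (x t : R) (n N : nat).

Lemma eta_partial_dist x (n m : nat) : (0 < n)%N -> `|x| <= n.+1%:R -> (n <= m)%N ->
  cnorm (eta_partial x m - eta_partial x n) <= 10 / Num.sqrt n.+1%:R.
Proof.
move=> n0 xn nm; rewrite /eta_partial (@big_cat_nat _ _ _ n.+1 1 m.+1)//= addrAC subrr add0r.
exact: eta_term_tail.
Qed.

Let small e : 0 < e -> forall n0 : nat, exists2 n, (n0 <= n)%N & 10 / Num.sqrt (n.+1%:R : R) <= e.
Proof.
move=> e0 n0; pose k := maxn n0 (Num.trunc ((10 / e) ^+ 2)).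
exists k; first by rewrite leq_maxl.
have q0 : 0 <= 10 / e by rewrite divr_ge0// ltW.
have kq : (10 / e) ^+ 2 <= k.+1%:R.
  apply: (le_trans (ltW (truncnS_gt _))); rewrite ler_nat ltnS.
  by rewrite /k leq_maxr.
have : 10 / e <= Num.sqrt k.+1%:R.
  by rewrite -[leLHS]ger0_norm// -sqrtr_sqr ler_wsqrtr.
rewrite ler_pdivrMr// => H; rewrite ler_pdivrMr ?sqrtr_gt0//.
by rewrite mulrC.
Qed.

Let etaRe x := fun N => complex.Re (eta_partial x N).
Let etaIm x := fun N => complex.Im (eta_partial x N).

Let start x := (Num.trunc `|x|).+1.

Let startP x n : (start x <= n)%N -> (0 < n)%N /\ `|x| <= n.+1%:R.
Proof.
move=> xn; split; first exact: leq_trans xn.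
by apply: (le_trans (ltW (truncnS_gt _))); rewrite ler_nat; exact: leqW.
Qed.

(** [eta_crit] takes limits of real and imaginary parts separately, and these mean something only
    once convergence is known. Both parts are Cauchy at the rate of [eta_partial_dist]; adding the
    two rates gives 20. *)
Lemma eta_crit_dist x :
  [/\ etaRe x n @[n --> \oo] --> complex.Re (eta_crit x),
      etaIm x n @[n --> \oo] --> complex.Im (eta_crit x) &
      forall n, (0 < n)%N -> `|x| <= n.+1%:R ->
        cnorm (eta_crit x - eta_partial x n) <= 20 / Num.sqrt n.+1%:R].
Proof.
have hr n m : (0 < n)%N -> `|x| <= n.+1%:R -> (n <= m)%N ->
    `|etaRe x m - etaRe x n| <= 10 / Num.sqrt n.+1%:R.
  move=> n0 xn nm; apply: le_trans (eta_partial_dist n0 xn nm).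
  apply: le_trans (Re_le_cnorm _); rewrite /etaRe.
  by case: (eta_partial x m) => a b; case: (eta_partial x n).
have hi n m : (0 < n)%N -> `|x| <= n.+1%:R -> (n <= m)%N ->
    `|etaIm x m - etaIm x n| <= 10 / Num.sqrt n.+1%:R.
  move=> n0 xn nm; apply: le_trans (eta_partial_dist n0 xn nm).
  apply: le_trans (Im_le_cnorm _); rewrite /etaIm.
  by case: (eta_partial x m) => a b; case: (eta_partial x n).
have xm n k : `|x| <= n.+1%:R -> (n <= k)%N -> `|x| <= k.+1%:R.
  by move=> /le_trans + nk; apply; rewrite ler_nat ltnS.
have L n : (0 < n)%N -> `|x| <= n.+1%:R ->
    (etaRe x k @[k --> \oo] --> limn (etaRe x) /\
     forall k, (n <= k)%N -> `|limn (etaRe x) - etaRe x k| <= 10 / Num.sqrt k.+1%:R) /\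
    (etaIm x k @[k --> \oo] --> limn (etaIm x) /\
     forall k, (n <= k)%N -> `|limn (etaIm x) - etaIm x k| <= 10 / Num.sqrt k.+1%:R).
  move=> n0 xn; split; apply: cauchy_lim_dist.
  - by move=> k m nk km; apply: hr => //; [exact: leq_trans nk|exact: xm nk].
  - by move=> e e0; have [k] := small e0 n; exists k.
  - by move=> k m nk km; apply: hi => //; [exact: leq_trans nk|exact: xm nk].
  - by move=> e e0; have [k] := small e0 n; exists k.
have [s0 sx] := startP (leqnn (start x)).
have [[c1 _] [c2 _]] := L _ s0 sx.
split => // n n0 xn.
have [[_ d1] [_ d2]] := L _ n0 xn.
apply: (le_trans (cnorm_le _)).
have -> : 20 / Num.sqrt n.+1%:R = 10 / Num.sqrt n.+1%:R + 10 / Num.sqrt n.+1%:R :> R by ring.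
have := d1 n (leqnn _); have := d2 n (leqnn _).
rewrite /etaRe /etaIm /eta_crit; case: (eta_partial x n) => a b /= h2 h1.
exact: lerD.
Qed.

Definition zeta_sum x N : R[i] := \sum_(1 <= n < N.+1) npow_crit x n.

Let two_powE x n : (0 < n)%N ->
  2%:R * npow_crit x (2 * n) = two_pow_one_minus_s x * npow_crit x n.
Proof.
move=> n0; have n0' : 0 < n%:R :> R by rewrite ltr0n.
have s2 : (2%:R : R[i]) = (2 : R)%:C by rewrite rmorph_nat.
rewrite s2 /two_pow_one_minus_s /npow_crit !powRN !powR12_sqrt//.
have -> : x * ln (2 * n)%:R = x * ln 2 + x * ln n%:R.
  by rewrite natrM lnM ?posrE// mulrDr.
have E : 2 * (Num.sqrt (2 * n)%:R)^-1 = Num.sqrt 2 * (Num.sqrt n%:R)^-1 :> R.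
  rewrite natrM sqrtrM// invfM mulrA; congr (_ * _).
  rewrite -[X in X / _](@sqr_sqrtr _ 2)// expr2 mulfK// gt_eqF// sqrtr_gt0//.
rewrite cosD sinD.
move: (cos (x * ln n%:R)) (sin (x * ln n%:R)) (cos (x * ln 2)) (sin (x * ln 2)) => c' s' c s.
move: E.
move: (Num.sqrt (2 * n)%:R)^-1 (Num.sqrt 2) (Num.sqrt n%:R)^-1 => a q b E.
have EQ (p r : R[i]) : complex.Re p = complex.Re r -> complex.Im p = complex.Im r -> p = r.
  by case: p r => [? ?] [? ?] /= -> ->.
apply: EQ => /=.
  transitivity ((2 * a) * (c * c' - s * s')); first by ring.
  by rewrite E; ring.
transitivity (- (2 * a) * (s * c' + c * s')); first by ring.
by rewrite E; ring.
Qed.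

(** The alternating sum is the full sum minus twice its even terms, and
    [2 (2n)^(-s) = 2^(1-s) n^(-s)]. *)
Lemma eta_partial_double x N :
  eta_partial x (2 * N) = zeta_sum x (2 * N) - two_pow_one_minus_s x * zeta_sum x N.
Proof.
rewrite /eta_partial /zeta_sum; elim: N => [|N IH].
  by rewrite muln0 !big_geq// mulr0 subr0.
rewrite mulnS !add2n.
rewrite big_nat_recr//= big_nat_recr//= IH.
rewrite [X in _ = X - _]big_nat_recr//= [X in _ = X + _ - _]big_nat_recr//=.
rewrite [X in _ = _ - _ * X]big_nat_recr//=.
rewrite mulrDr -two_powE// mulnS add2n.
have s1 : (-1) ^+ (2 * N).+2 = 1 :> R[i].
  by rewrite -addn2 exprD exprM sqrrN !expr1n mulr1.
rewrite s1 mul1r exprS s1.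
by ring.
Qed.

(** On the critical line [|2^(1-s)| = sqrt 2 >= 7/5]; the zeros of [1 - 2^(1-s)] lie on the line of
    real part 1. *)
Lemma one_minus_two_pow_ge x : 2 / 5 <= cnorm (1 - two_pow_one_minus_s x).
Proof.
have w2 : cnorm (two_pow_one_minus_s x) = Num.sqrt 2.
  rewrite /cnorm /two_pow_one_minus_s /= sqrrN !exprMn -mulrDr cos2Dsin2 mulr1.
  by rewrite sqr_sqrtr.
have c1 : cnorm (1 : R[i]) = 1 by rewrite /cnorm /= expr1n expr0n/= addr0 sqrtr1.
have := cnormB 1 (1 - two_pow_one_minus_s x).
rewrite opprB addrC subrK w2 c1.
have : 7 / 5 <= Num.sqrt 2 :> R.
  have q0 : 0 <= 7 / 5 :> R by rewrite divr_ge0.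
  rewrite -[leLHS]ger0_norm// -sqrtr_sqr ler_wsqrtr//.
  by rewrite (_ : (7 / 5) ^+ 2 = 49 / 25 :> R); [lra|field].
lra.
Qed.

Let div_le (z : R[i]) x : cnorm (z / (1 - two_pow_one_minus_s x)) <= 5 / 2 * cnorm z.
Proof.
have w := one_minus_two_pow_ge x; have w0 : 0 < cnorm (1 - two_pow_one_minus_s x) by lra.
rewrite cnormM cnormV mulrC; apply: ler_wpM2r; first exact: cnorm_ge0.
by rewrite -[_^-1]mul1r ler_pdivrMr//; lra.
Qed.

Let w_neq0 x : 1 - two_pow_one_minus_s x != 0.
Proof.
apply/eqP => E; have := one_minus_two_pow_ge x; rewrite E cnorm0; lra.
Qed.

(* [zeta - S_N = (eta - eta_2N + S_2N - S_N) / (1 - 2^(1-s))]. *)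
Lemma zeta_sum_approx x t N : 100 <= t -> 4 * t <= N%:R -> N%:R <= 5 * t ->
  t / 2 <= x <= 2 * t -> cnorm (zeta_crit x - zeta_sum x N) <= 5 / 2 * (196 + 8 * 88 ^+ 2).
Proof.
move=> t100 N4 N5 xt; have /andP[x1 x2] := xt.
have N0 : (0 < N)%N by rewrite -(ltr0n R); lra.
have N20 : (0 < 2 * N)%N by rewrite muln_gt0.
have xN : `|x| <= (2 * N).+1%:R.
  by rewrite gtr0_norm; [rewrite -[(2 * N).+1%:R]natr1 natrM; lra|lra].
have [_ _ /(_ _ N20 xN) H1] := eta_crit_dist x.
have H2 := npow_block t100 N4 N5 xt.
have -> : zeta_crit x - zeta_sum x N = ((eta_crit x - eta_partial x (2 * N)) +
    \sum_(N.+1 <= n < (2 * N).+1) npow_crit x n) / (1 - two_pow_one_minus_s x).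
  have -> : \sum_(N.+1 <= n < (2 * N).+1) npow_crit x n = zeta_sum x (2 * N) - zeta_sum x N.
    have NN : (N.+1 <= (2 * N).+1)%N by rewrite ltnS leq_pmull.
    by rewrite /zeta_sum (@big_cat_nat _ _ _ N.+1 1 (2 * N).+1)//= addrAC subrr add0r.
  rewrite eta_partial_double /zeta_crit; have := w_neq0 x.
  move: (two_pow_one_minus_s x) (eta_crit x) (zeta_sum x _) (zeta_sum x _) => w e a b w0.
  by field.
apply: (le_trans (div_le _ _)); rewrite ler_pM2l; last by lra.
apply: (le_trans (cnormD _ _)).
have : 20 / Num.sqrt (2 * N).+1%:R <= 20 :> R.
  rewrite ler_pdivrMr ?sqrtr_gt0// ler_pMr//.
  by rewrite -[leLHS]sqrtr1 ler_wsqrtr// ler1n.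
lra.
Qed.

Lemma zeta_sum_le x N : cnorm (zeta_sum x N) ^+ 2 <= 4 * N%:R.
Proof.
have h : cnorm (zeta_sum x N) <= 2 * Num.sqrt N%:R.
  apply: (le_trans (cnorm_sum _ _ _)); apply: le_trans (sum_invr_sqrt_le N).
  by apply: ler_sum_nat => n /andP[n0 _]; rewrite cnorm_npow.
have -> : 4 * N%:R = (2 * Num.sqrt N%:R) ^+ 2 :> R.
  by rewrite exprMn sqr_sqrtr//; congr (_ * _); ring.
by rewrite lerXn2r ?nnegrE ?cnorm_ge0// mulr_ge0 ?sqrtr_ge0.
Qed.

(** The elementary bound [zeta = O(sqrt |x|)]: cut the eta series at [n] about [|x| + 1], where the
    partial sum is at most [2 sqrt n] and the tail is bounded. *)
Lemma zeta_crit_le x : cnorm (zeta_crit x) ^+ 2 <= 50 * `|x| + 50 * 101.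
Proof.
have [n0 xn] := startP (leqnn (start x)).
set n := start x in n0 xn *.
have [_ _ /(_ _ n0 xn) H] := eta_crit_dist x.
have nx : n%:R <= `|x| + 1.
  by rewrite /n /start -natr1 lerD2r; have /andP[] := truncn_itv (normr_ge0 x).
have e1 : cnorm (eta_partial x n) <= 2 * Num.sqrt n%:R.
  apply: (le_trans (cnorm_sum _ _ _)); apply: le_trans (sum_invr_sqrt_le n).
  apply: ler_sum_nat => k /andP[k0 _]; rewrite cnormM cnorm_npow// ler_piMl ?invr_ge0//.
  elim: k.+1 => [|m IH]; first by rewrite expr0 /cnorm /= expr1n expr0n/= addr0 sqrtr1.
  rewrite exprS cnormM cnormN {1}/cnorm /= expr1n expr0n/= addr0 sqrtr1 mul1r; exact: IH.
have e2 : 20 / Num.sqrt n.+1%:R <= 20 :> R.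
  rewrite ler_pdivrMr ?sqrtr_gt0// ler_pMr//.
  by rewrite -[leLHS]sqrtr1 ler_wsqrtr// ler1n.
have e3 : cnorm (eta_crit x) <= 2 * Num.sqrt n%:R + 20.
  rewrite -[eta_crit x](subrK (eta_partial x n)); apply: (le_trans (cnormD _ _)); lra.
have e4 : cnorm (zeta_crit x) <= 5 / 2 * (2 * Num.sqrt n%:R + 20).
  by apply: (le_trans (div_le _ _)); rewrite ler_pM2l//; lra.
have s0 : 0 <= Num.sqrt (n%:R : R) by exact: sqrtr_ge0.
have e5 : cnorm (zeta_crit x) ^+ 2 <= (5 / 2 * (2 * Num.sqrt n%:R + 20)) ^+ 2.
  by rewrite lerXn2r ?nnegrE ?cnorm_ge0//; apply: le_trans e4; exact: cnorm_ge0.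
apply: (le_trans e5).
have s2 : Num.sqrt (n%:R : R) ^+ 2 = n%:R by rewrite sqr_sqrtr.
(* This square yields [25 (y + 10)^2 <= 50 y^2 + 5000] for [y = sqrt n]. *)
have := sqr_ge0 (Num.sqrt (n%:R : R) - 10).
have : Num.sqrt (n%:R : R) ^+ 2 <= `|x| + 1 by rewrite s2.
move: (Num.sqrt n%:R) => y; nra.
Qed.

(** Inside the window the approximation is uniform. Outside it [t^2 <= 4 (x - t)^2], and the growth
    bounds on zeta and [S_N] give at most [142 (x + t + 1)]; the constant is [568 = 4 x 142]. *)
Lemma zeta_approx_error x t N : 100 <= t -> 4 * t <= N%:R -> N%:R <= 5 * t -> 0 < x ->
  cnorm (zeta_crit x - zeta_sum x N) ^+ 2 <=
  (5 / 2 * (196 + 8 * 88 ^+ 2)) ^+ 2 + 568 / t ^+ 2 * ((x + t + 1) * (x - t) ^+ 2).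
Proof.
move=> t100 N4 N5 x0; set K := 5 / 2 * _.
have q0 : 0 <= (x + t + 1) * (x - t) ^+ 2 by rewrite mulr_ge0 ?sqr_ge0//; lra.
have t0 : 0 < t by lra. have t20 : 0 < t ^+ 2 by rewrite exprn_gt0.
have c0 : 0 <= 568 / t ^+ 2 * ((x + t + 1) * (x - t) ^+ 2).
  by apply: mulr_ge0; [apply: divr_ge0; [lra|exact: ltW]|exact: q0].
have [xt|xbad] := boolP (t / 2 <= x <= 2 * t).
  have H := zeta_sum_approx t100 N4 N5 xt.
  have : cnorm (zeta_crit x - zeta_sum x N) ^+ 2 <= K ^+ 2.
    by rewrite lerXn2r ?nnegrE ?cnorm_ge0//; apply: le_trans H; exact: cnorm_ge0.
  by move=> /le_trans; apply; rewrite lerDl.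
have K0 := sqr_ge0 K.
have xt : t ^+ 2 <= 4 * (x - t) ^+ 2.
  have xa : t <= 2 * `|x - t|.
    move: xbad; rewrite negb_and -!ltNge => /orP[xs|xl].
      have : t - x <= `|x - t| by rewrite distrC ler_norm.
      lra.
    have := ler_norm (x - t); lra.
  have -> : 4 * (x - t) ^+ 2 = (2 * `|x - t|) ^+ 2.
    by rewrite exprMn real_normK ?num_real//; congr (_ * _); ring.
  by rewrite lerXn2r ?nnegrE ?mulr_ge0// ltW.
have h1 := zeta_crit_le x; have h2 := zeta_sum_le x N.
rewrite (gtr0_norm x0) in h1.
have h3 : cnorm (zeta_crit x - zeta_sum x N) ^+ 2 <= 142 * (x + t + 1).
  have a0 := cnorm_ge0 (zeta_crit x); have b0 := cnorm_ge0 (zeta_sum x N).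
  have : cnorm (zeta_crit x - zeta_sum x N) ^+ 2 <=
      (cnorm (zeta_crit x) + cnorm (zeta_sum x N)) ^+ 2.
    by rewrite lerXn2r ?nnegrE ?cnorm_ge0 ?addr_ge0 ?cnorm_ge0//; exact: cnormB.
  move=> /le_trans; apply.
  move: (cnorm (zeta_crit x)) (cnorm (zeta_sum x N)) h1 h2 a0 b0 => a b h1 h2 a0 b0.
  have := sqr_ge0 (a - b); nra.
apply: (le_trans h3); apply: le_trans (_ : 568 / t ^+ 2 * ((x + t + 1) * (x - t) ^+ 2) <= _).
  rewrite mulrAC ler_pdivlMr//.
  have : 142 * (x + t + 1) * t ^+ 2 <= 142 * (x + t + 1) * (4 * (x - t) ^+ 2).
    by apply: ler_wpM2l => //; lra.
  lra.
by rewrite lerDr.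
Qed.

End Zeta.

(** * The mean square *)

Section MeanSquare.
Local Open Scope complex_scope.
Context {R : realType}.
Implicit Types (x t : R) (n N : nat).

Let mulr_measurable (f : R -> R) (a : R) : measurable_fun setT f -> measurable_fun setT (fun x => a * f x).
Proof. by move=> mf; apply: measurable_funM. Qed.

Let measurable_cosM (a : R) : measurable_fun setT (fun x : R => cos (x * a)).
Proof.
have -> : (fun x : R => cos (x * a)) = (fun x => cos (a * x)) by apply/funext => x; rewrite mulrC.
by apply: continuous_measurable_fun; exact: continuous_cosM.
Qed.

Let measurable_sinM (a : R) : measurable_fun setT (fun x : R => sin (x * a)).
Proof.
have -> : (fun x : R => sin (x * a)) = (fun x => sin (a * x)) by apply/funext => x; rewrite mulrC.
by apply: continuous_measurable_fun; exact: continuous_sinM.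
Qed.

Let sgn_re n (z : R[i]) : complex.Re ((-1) ^+ n * z) = (-1) ^+ n * complex.Re z /\
  complex.Im ((-1) ^+ n * z) = (-1) ^+ n * complex.Im z.
Proof.
elim: n => [|n [IH1 IH2]]; first by rewrite !expr0 !mul1r.
by rewrite !exprS -!mulrA !mulN1r -IH1 -IH2; case: (_ * z).
Qed.

Lemma measurable_eta_partial N :
  measurable_fun setT (fun x : R => complex.Re (eta_partial x N)) /\
  measurable_fun setT (fun x : R => complex.Im (eta_partial x N)).
Proof.
elim: N => [|N [IH1 IH2]].
  have E0 x : eta_partial x 0 = 0 by rewrite /eta_partial big_geq.
  have -> : (fun x => complex.Re (eta_partial x 0)) = (fun=> 0) by apply/funext => x; rewrite E0.
  have -> : (fun x => complex.Im (eta_partial x 0)) = (fun=> 0) by apply/funext => x; rewrite E0.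
  by split; exact: measurable_cst.
have E x : eta_partial x N.+1 = eta_partial x N + (-1) ^+ N.+2 * npow_crit x N.+1.
  by rewrite /eta_partial big_nat_recr.
split.
  have -> : (fun x => complex.Re (eta_partial x N.+1)) = (fun x => complex.Re (eta_partial x N) +
     (-1) ^+ N.+2 * (N.+1%:R `^ (- 2^-1) * cos (x * ln N.+1%:R))).
    apply/funext => x; rewrite E; have [<- _] := sgn_re N.+2 (npow_crit x N.+1).
    by case: (eta_partial x N) => a b; case: (_ * _).
  by apply: measurable_funD => //; do 2 apply: mulr_measurable.
have -> : (fun x => complex.Im (eta_partial x N.+1)) = (fun x => complex.Im (eta_partial x N) +
     (-1) ^+ N.+2 * (- 1 * (N.+1%:R `^ (- 2^-1) * sin (x * ln N.+1%:R)))).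
  apply/funext => x; rewrite E mulN1r; have [_ <-] := sgn_re N.+2 (npow_crit x N.+1).
  by case: (eta_partial x N) => a b; case: (_ * _).
by apply: measurable_funD => //; do 3 apply: mulr_measurable.
Qed.

Lemma zeta_crit_sqE x : zeta_crit_sq x = cnorm (zeta_crit x) ^+ 2.
Proof. by rewrite sqr_cnorm. Qed.

(** The squared modulus of [eta_crit] is built from pointwise limits of measurable partial sums, and
    the denominator [q] is continuous without zeros. *)
Lemma measurable_zeta_crit_sq : measurable_fun setT (@zeta_crit_sq R).
Proof.
pose q x : R := (1 - Num.sqrt 2 * cos (x * ln 2)) ^+ 2 + (Num.sqrt 2 * sin (x * ln 2)) ^+ 2.
have qE x : q x = cnorm (1 - two_pow_one_minus_s x) ^+ 2.
  by rewrite sqr_cnorm /two_pow_one_minus_s /q /=; congr (_ + _); rewrite ?oppr0 ?add0r ?opprK.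
have q0 x : q x != 0.
  rewrite qE sqrf_eq0 gt_eqF//; apply: lt_le_trans (one_minus_two_pow_ge x).
  by rewrite divr_gt0.
have -> : @zeta_crit_sq R = (fun x =>
    (complex.Re (eta_crit x) ^+ 2 + complex.Im (eta_crit x) ^+ 2) * (q x)^-1).
  by apply/funext => x; rewrite zeta_crit_sqE cnormM cnormV exprMn exprVn -qE sqr_cnorm.
apply: measurable_funM.
  apply: measurable_funD; apply: measurable_funX.
    apply: (measurable_fun_cvg (h := fun n x => complex.Re (eta_partial x n))).
      by move=> n; have [] := measurable_eta_partial n.
    by move=> x _; have [] := eta_crit_dist x.
  apply: (measurable_fun_cvg (h := fun n x => complex.Im (eta_partial x n))).
    by move=> n; have [] := measurable_eta_partial n.
  by move=> x _; have [] := eta_crit_dist x.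
apply: continuous_measurable_fun => x.
have c1 : {for x, continuous (fun y : R => cos (ln 2 * y))} by exact: continuous_cosM.
have c2 : {for x, continuous (fun y : R => sin (ln 2 * y))} by exact: continuous_sinM.
have cq : {for x, continuous q}.
  have -> : q = (fun x => (1 - Num.sqrt 2 * cos (ln 2 * x)) * (1 - Num.sqrt 2 * cos (ln 2 * x)) +
     (Num.sqrt 2 * sin (ln 2 * x)) * (Num.sqrt 2 * sin (ln 2 * x))).
    by apply/funext => y; rewrite /q !expr2 [y * _]mulrC.
  have d1 : {for x, continuous (fun y : R => 1 - Num.sqrt 2 * cos (ln 2 * y))}.
    by apply: cvgB; [exact: cvg_cst|apply: cvgM; [exact: cvg_cst|exact: c1]].
  have d2 : {for x, continuous (fun y : R => Num.sqrt 2 * sin (ln 2 * y))}.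
    by apply: cvgM; [exact: cvg_cst|exact: c2].
  by apply: cvgD; apply: cvgM; [exact: d1|exact: d1|exact: d2|exact: d2].
by apply: cvgV; [exact: q0|exact: cq].
Qed.

(** By induction on [N]: the new term [n = N + 1] pairs with each earlier [m], which adds the
    antidiagonal [m + k = N + 1] of the double sum. *)
Lemma sqr_zeta_sum x N : cnorm (zeta_sum x N) ^+ 2 =
  \sum_(1 <= n < N.+1) (n%:R : R)^-1 + 2 * \sum_(1 <= k < N) \sum_(1 <= m < (N - k).+1)
    cos ((ln (m%:R + k%:R) - ln m%:R) * x) / Num.sqrt (m%:R * (m%:R + k%:R)).
Proof.
pose T m k : R := cos ((ln (m%:R + k%:R) - ln m%:R) * x) / Num.sqrt (m%:R * (m%:R + k%:R)).
rewrite -/(T _ _); elim: N => [|N IH].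
  by rewrite /zeta_sum !big_geq// cnorm0 expr0n/= mulr0 addr0.
have SE : zeta_sum x N.+1 = zeta_sum x N + npow_crit x N.+1 by rewrite /zeta_sum big_nat_recr.
pose inner (z w : R[i]) : R := complex.Re z * complex.Re w + complex.Im z * complex.Im w.
have sqD z w : cnorm (z + w) ^+ 2 = cnorm z ^+ 2 + cnorm w ^+ 2 + 2 * inner z w.
  by rewrite !sqr_cnorm /inner; case: z w => a b [c d] /=; ring.
have innerE : inner (zeta_sum x N) (npow_crit x N.+1) =
    \sum_(1 <= m < N.+1) T m (N.+1 - m)%N.
  have H (z w v : R[i]) : inner (z + w) v = inner z v + inner w v.
    by rewrite /inner; case: z w v => ? ? [? ?] [? ?] /=; ring.
  have H0 (v : R[i]) : inner 0 v = 0 by rewrite /inner /= !mul0r addr0.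
  rewrite /zeta_sum (big_morph (fun z => inner z (npow_crit x N.+1)) (fun z w => H z w _) (H0 _)).
  apply: eq_big_nat => m /andP[m0 mN]; rewrite /T -natrD subnKC; last exact: leqW.
  rewrite /inner /npow_crit /= !powRN !powR12_sqrt// sqrtrM// invfM mulrBl cosB.
  rewrite ![ln _ * x]mulrC; ring.
have sqa : cnorm (npow_crit x N.+1) ^+ 2 = N.+1%:R^-1.
  by rewrite cnorm_npow// exprVn sqr_sqrtr.
rewrite SE sqD sqa innerE IH [in RHS]big_nat_recr//=.
have -> : \sum_(1 <= k < N.+1) \sum_(1 <= m < (N.+1 - k).+1) T m k =
    \sum_(1 <= k < N) \sum_(1 <= m < (N - k).+1) T m k + \sum_(1 <= m < N.+1) T m (N.+1 - m)%N.
  have -> : \sum_(1 <= k < N.+1) \sum_(1 <= m < (N.+1 - k).+1) T m k =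
      \sum_(1 <= k < N.+1) (\sum_(1 <= m < (N - k).+1) T m k + T (N.+1 - k)%N k).
    apply: eq_big_nat => k /andP[k0]; rewrite ltnS => kN.
    by rewrite subSn// big_nat_recr.
  rewrite big_split/=; congr (_ + _).
    case: N {IH SE innerE sqa} => [|N]; first by rewrite !big_geq.
    by rewrite big_nat_recr//= subnn [X in _ + X]big_geq// addr0.
  rewrite big_nat_rev/=; apply: eq_big_nat => m /andP[m0 mN].
  rewrite add1n subSS; congr (T _ _).
  by rewrite subKn// ltnW.
by ring.
Qed.

Lemma harmonic_bounds N : (0 < N)%N ->
  ln N%:R <= \sum_(1 <= n < N.+1) (n%:R : R)^-1 <= 1 + ln N%:R.
Proof.
move=> N0; apply/andP; split; case: N N0 => // N _.
  apply: (@le_trans _ _ (ln N.+2%:R)); first by rewrite ler_ln ?posrE// ler_nat.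
  elim: N => [|N IH].
    by rewrite big_nat1 invr1; have := @lratio_le R 1 isT; rewrite /lratio ln1 subr0 invr1.
  rewrite big_nat_recr//=; have := @lratio_le R N.+2 isT; rewrite /lratio => H.
  by rewrite -lerBlDr; apply: (le_trans _ IH); rewrite lerBlDr addrC -lerBlDr.
elim: N => [|N IH]; first by rewrite big_nat1 invr1 ln1 addr0.
rewrite big_nat_recr//=; have := @lratio_ge R N.+1 isT; rewrite /lratio => H.
by rewrite -lerBrDr; apply: (le_trans IH); rewrite -addrA lerD2l lerBrDr addrC -lerBrDr.
Qed.

End MeanSquare.

(** * Comparison of mean squares *)

Section Comparison.
Context {R : realType}.
Implicit Types (z w : R[i]) (t l : R).

(** With [h = |z - w|] and [b = |w|], the difference is at most [h (2b + h)], and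
    [2hb <= l b^2 + h^2 / l]. The free parameter [l], fixed after integration, replaces
    Cauchy-Schwarz for expectations. *)
Lemma sqr_cnorm_diff_le z w l : 0 < l ->
  `|cnorm z ^+ 2 - cnorm w ^+ 2| <= l * cnorm w ^+ 2 + (1 + l^-1) * cnorm (z - w) ^+ 2.
Proof.
move=> l0.
have H1 : cnorm z <= cnorm (z - w) + cnorm w by rewrite -{1}(subrK w z); exact: cnormD.
have H2 : cnorm w <= cnorm (z - w) + cnorm z.
  by rewrite -(cnormN (z - w)) opprB -{1}(subrK z w); exact: cnormD.
have := cnorm_ge0 z; have := cnorm_ge0 w; have := cnorm_ge0 (z - w).
move: (cnorm z) (cnorm w) (cnorm (z - w)) H1 H2 => a b h H1 H2 h0 b0 a0.
have am_gm : 2 * h * b <= l * b ^+ 2 + l^-1 * h ^+ 2.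
  have := mulr_ge0 (ltW l0) (sqr_ge0 (b - l^-1 * h)).
  have -> : l * (b - l^-1 * h) ^+ 2 = l * b ^+ 2 + l^-1 * h ^+ 2 - 2 * h * b.
    by field; rewrite gt_eqF.
  by rewrite subr_ge0.
apply: (@le_trans _ _ (2 * h * b + h ^+ 2)); last by rewrite mulrDl mul1r; lra.
by rewrite ler_norml; apply/andP; split; nra.
Qed.

(** The hypothesis squeezes [f] between [(1 - l) g - c e] and [(1 + l) g + c e]. The upper side also
    gives the integrability of [f], which is not assumed. *)
Lemma gexp_perturb (t l c : R) (f g e : R -> R) : 0 <= l ->
  measurable_fun (`]0, +oo[ : set R) f -> gint t g -> gint t e ->
  (forall x, 0 < x -> 0 <= f x) ->
  (forall x, 0 < x -> `|f x - g x| <= l * g x + c * e x) ->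
  gint t f /\ `|gexp t f - gexp t g| <= l * gexp t g + c * gexp t e.
Proof.
move=> l0 mf ig ie f0 H.
have iup : gint t (fun x => (1 + l) * g x + c * e x) by apply: gintD; exact: gintZ.
have ilo : gint t (fun x => (1 - l) * g x + - c * e x) by apply: gintD; exact: gintZ.
have fi : gint t f.
  apply: (le_gint mf iup) => x x0; rewrite ger0_norm ?f0//.
  by have := H x x0; rewrite ler_norml => /andP[_]; lra.
split=> //.
have up : gexp t f <= (1 + l) * gexp t g + c * gexp t e.
  rewrite -(gexpZ (1 + l) ig) -(gexpZ c ie) -(gexpD (gintZ (1 + l) ig) (gintZ c ie)).
  apply: (le_gexp fi iup) => x x0.
  by have := H x x0; rewrite ler_norml => /andP[_]; lra.
have lo : (1 - l) * gexp t g + - c * gexp t e <= gexp t f.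
  rewrite -(gexpZ (1 - l) ig) -(gexpZ (- c) ie) -(gexpD (gintZ (1 - l) ig) (gintZ (- c) ie)).
  apply: (le_gexp ilo fi) => x x0.
  by have := H x x0; rewrite ler_norml => /andP[+ _]; lra.
move: (gexp t f) (gexp t g) (gexp t e) up lo => F G E up lo.
by rewrite ler_norml; apply/andP; split; lra.
Qed.

Lemma integral_gamma_comp_gexp d (T : measurableType d) (P : probability T R) t (Y : T -> R) (f : R -> R) :
  measurable_fun setT Y ->
  (forall A : set R, measurable A ->
    P (Y @^-1` A) = (\int[lebesgue_measure]_(x in A) (gamma_density t x)%:E)%E) ->
  measurable_fun setT f -> (forall x, 0 <= f x) -> gint t f ->
  (\int[P]_w (f (Y w))%:E = (gexp t f)%:E)%E.
Proof.
move=> mY lY mf f0 fi; rewrite (integral_gamma_comp mY lY mf f0) fineK//.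
by apply: integrable_fin_num => //; exact: measurable_itv.
Qed.

End Comparison.

Section MeanSquareBound.
Context {R : realType}.
Hypothesis mass : forall t : R, 0 < t ->
  (\int[lebesgue_measure]_(x in setT) (gamma_density t x)%:E = 1)%E.
Variables (t : R) (N : nat).
Hypotheses (t100 : 100 <= t) (Nge : 4 * t <= N%:R) (Nle : N%:R <= 5 * t).

Let t0 : 0 < t. Proof. by have := t100; lra. Qed.

Lemma gint_sqr_zeta_sum : gint t (fun x => cnorm (zeta_sum x N) ^+ 2).
Proof.
under eq_fun do rewrite sqr_zeta_sum.
apply: gintD; first exact: gint_cst.
apply: gintZ; apply: gint_sum => k _; apply: gint_sum => m _.
under eq_fun do rewrite mulrC.
by apply: gintZ; exact: gint_cos.
Qed.

Lemma gexp_sqr_zeta_sum : gexp t (fun x => cnorm (zeta_sum x N) ^+ 2) =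
  \sum_(1 <= n < N.+1) (n%:R : R)^-1 + 2 * \sum_(1 <= k < N) \sum_(1 <= m < (N - k).+1)
    gcos t (ln (m%:R + k%:R) - ln m%:R) / Num.sqrt (m%:R * (m%:R + k%:R)).
Proof.
pose F k m (x : R) : R := (Num.sqrt (m%:R * (m%:R + k%:R)))^-1 * cos ((ln (m%:R + k%:R) - ln m%:R) * x).
have iF k m : gint t (F k m) by apply: gintZ; exact: gint_cos.
have iS k : gint t (fun x => \sum_(1 <= m < (N - k).+1) F k m x).
  by apply: gint_sum => m _; exact: iF.
have iSS : gint t (fun x => \sum_(1 <= k < N) \sum_(1 <= m < (N - k).+1) F k m x).
  by apply: gint_sum => k _; exact: iS.
have -> : (fun x => cnorm (zeta_sum x N) ^+ 2) = (fun x => \sum_(1 <= n < N.+1) (n%:R : R)^-1 +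
    2 * \sum_(1 <= k < N) \sum_(1 <= m < (N - k).+1) F k m x).
  apply/funext => x; rewrite sqr_zeta_sum; congr (_ + 2 * _).
  by apply: eq_bigr => k _; apply: eq_bigr => m _; rewrite /F mulrC.
rewrite (gexpD (gint_cst mass _ t0) (gintZ 2 iSS)) (gexp_cst mass _ t0) (gexpZ 2 iSS).
congr (_ + 2 * _); rewrite (gexp_sum _ (fun k _ => iS k)); apply: eq_bigr => k _.
rewrite (gexp_sum _ (fun m _ => iF k m)); apply: eq_bigr => m _.
by rewrite /F (gexpZ _ (gint_cos mass _ t0)) mulrC.
Qed.

Lemma gexp_sqr_zeta_sum_approx :
  `|gexp t (fun x => cnorm (zeta_sum x N) ^+ 2) - ln t| <= 6 + 2 * (100 * 1000 + 10 * 120).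
Proof.
rewrite gexp_sqr_zeta_sum.
have N0 : (0 < N)%N by rewrite -(ltr0n R); have := Nge; have := t0; lra.
(* Since [t <= N <= 5t] and [ln 5 < 5], the harmonic sum lies between [ln t] and [ln t + 1 + 5]. *)
have H : 0 <= \sum_(1 <= n < N.+1) (n%:R : R)^-1 - ln t <= 6.
  have /andP[lo up] := @harmonic_bounds R N N0.
  have lo' : ln t <= ln N%:R by rewrite ler_ln ?posrE ?ltr0n//; have := Nge; have := t0; lra.
  have up' : ln N%:R <= 5 + ln t.
    have : ln N%:R <= ln (5 * t).
      by rewrite ler_ln ?posrE ?ltr0n//; have := t0; lra.
    by rewrite lnM ?posrE//; have := @ln_sublinear R 5 ltac:(lra); lra.
  by apply/andP; split; [rewrite subr_ge0; exact: le_trans lo|rewrite lerBlDr; lra].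
pose r := Num.sqrt t; pose M := (Num.truncn r).+1.
have rt : r ^+ 2 = t by rewrite sqr_sqrtr// ltW.
have r0 : 0 <= r by exact: sqrtr_ge0.
have r10 : 10 <= r by have := t100; rewrite -rt; nra.
have Mge : r <= M%:R by apply/ltW; exact: truncnS_gt.
have Mle : M%:R <= 2 * r.
  by rewrite /M -natr1; have := r0; rewrite -truncn_le; lra.
have := @off_diagonal_bound R gcos gsin _ _ _ r N M r10 _ _ Mge Mle 120.
rewrite rt => /(_ _ _ _ Nge Nle).
have dc p q u : 0 < p -> q = p + 1 -> is_derive (u : R) 1 (gcos p) (- p * gsin q u).
  by move=> p0 ->; exact: gcos_is_derive.
have ds p q u : 0 < p -> q = p + 1 -> is_derive (u : R) 1 (gsin p) (p * gcos q u).
  by move=> p0 ->; exact: gsin_is_derive.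
move=> /(_ dc ds (fun p u n => gcos2Dgsin2_le mass u n)).
move=> /(_ (fun n => gexp_sum_sin_le mass t100 Nge Nle)).
move: H; set S := \sum_(1 <= n < N.+1) _; set D := \sum_(1 <= k < N) _.
move: S D => S D /andP[S0 S6]; set K := 100 * 1000 + 10 * 120.
rewrite ler_norml => /andP[D1 D2].
have K0 : 0 <= K by move: D1 D2; move: (K) => k; lra.
by move: K K0 D1 D2 => k k0 D1 D2; rewrite ler_norml; apply/andP; split; lra.
Qed.

Lemma gexp_zeta_crit_sq_approx l : 0 < l ->
  gint t (@zeta_crit_sq R) /\
  `|gexp t (@zeta_crit_sq R) - gexp t (fun x => cnorm (zeta_sum x N) ^+ 2)|
    <= l * gexp t (fun x => cnorm (zeta_sum x N) ^+ 2)
       + (1 + l^-1) * ((5 / 2 * (196 + 8 * 88 ^+ 2)) ^+ 2 + 568 * 3).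
Proof.
move=> l0; set K := (5 / 2 * _) ^+ 2.
pose e (x : R) := K + 568 / t ^+ 2 * ((x + t + 1) * (x - t) ^+ 2).
have iv := gint_variance_cubic mass t0.
have ie : gint t e by apply: gintD; [exact: gint_cst|exact: gintZ].
(* The cubic moment is [2 t^2 + 3 t], at most [3 t^2]. *)
have He : gexp t e <= K + 568 * 3.
  rewrite (gexpD (gint_cst mass K t0) (gintZ _ iv)) (gexp_cst mass K t0).
  rewrite (gexpZ _ iv) (gexp_variance_cubic mass t0) lerD2l -mulrA.
  apply: ler_wpM2l; first by lra.
  rewrite mulrC ler_pdivrMr ?exprn_gt0//.
  by have := t100; nra.
have c0 : 0 <= 1 + l^-1 by rewrite addr_ge0// invr_ge0 ltW.
have [|||fi H] := @gexp_perturb R t l (1 + l^-1) (@zeta_crit_sq R)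
    (fun x => cnorm (zeta_sum x N) ^+ 2) e (ltW l0) _ gint_sqr_zeta_sum ie.
- apply: measurable_funS (@measurable_zeta_crit_sq R) => //.
- by move=> x _; rewrite zeta_crit_sqE sqr_ge0.
- move=> x x0; rewrite zeta_crit_sqE.
  apply: (le_trans (sqr_cnorm_diff_le _ _ l0)); rewrite lerD2l.
  by apply: ler_wpM2l => //; exact: zeta_approx_error.
split=> //; apply: (le_trans H); rewrite lerD2l.
exact: ler_wpM2l.
Qed.

End MeanSquareBound.

Theorem theorem1p1 (R : realType) (d : measure_display) (T : measurableType d)
  (P : probability T R) (X : R -> T -> R)
  (mX : forall t : R, 0 < t -> measurable_fun setT (X t))
  (lawX : forall t : R, 0 < t -> forall A : set R, measurable A ->
     P (X t @^-1` A) = (\int[lebesgue_measure]_(x in A) (gamma_density t x)%:E)%E) :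
  exists C : R, 0 < C /\
    \forall t \near +oo,
      (`| \int[P]_w (zeta_crit_sq (X t w))%:E - (ln t)%:E |
         <= (C * Num.sqrt (ln t) * ln (ln t))%:E)%E.
Proof.
(* The law evaluated on the whole line: the density has total mass one. *)
have mass (t : R) : 0 < t ->
    (\int[lebesgue_measure]_(x in setT) (gamma_density t x)%:E = 1)%E.
  by move=> t0; rewrite -lawX// preimage_setT probability_setT.
pose K1 : R := 6 + 2 * (100 * 1000 + 10 * 120).
pose K2 : R := (5 / 2 * (196 + 8 * 88 ^+ 2)) ^+ 2 + 568 * 3.
have K10 : 0 <= K1 by rewrite /K1; lra.
have K20 : 0 <= K2 by apply: addr_ge0; [exact: sqr_ge0|lra].
exists (2 * K1 + 1 + 2 * K2); split; first by move: K1 K2 K10 K20 => a b; lra.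
near=> t.
have t100 : 100 <= t by near: t; apply: nbhs_pinfty_ge; rewrite num_real.
(* Beyond this threshold [ln (ln t) >= 1]. *)
have tE : expR (expR 1) <= t by near: t; apply: nbhs_pinfty_ge; rewrite num_real.
have t0 : 0 < t by lra.
pose N := (Num.truncn (4 * t)).+1.
have Nge : 4 * t <= N%:R by apply/ltW; exact: truncnS_gt.
have Nle : N%:R <= 5 * t.
  have : (Num.truncn (4 * t))%:R <= 4 * t by rewrite truncn_le; lra.
  by rewrite /N -[(Num.truncn _).+1%:R]natr1; lra.
have Le : expR 1 <= ln t by rewrite -(expRK (expR 1)) ler_ln ?posrE ?expR_gt0.
have L1 : 1 <= ln t by apply: le_trans Le; have := @expR_ge1Dx R 1; lra.
have LL1 : 1 <= ln (ln t).
  by rewrite -(expRK 1) ler_ln ?posrE ?expR_gt0//; apply: lt_le_trans L1.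
pose q := Num.sqrt (ln t).
have q2 : q ^+ 2 = ln t by rewrite sqr_sqrtr//; exact: le_trans L1.
have q1 : 1 <= q by rewrite -sqrtr1 ler_sqrt//; exact: le_trans L1.
have q0 : 0 < q by exact: lt_le_trans q1.
(* The choice [l = 1 / sqrt (ln t)] balances [l E |S_N|^2], of order [l ln t], against the term of
   order [1 / l]. *)
have [fi H] := gexp_zeta_crit_sq_approx mass t100 Nge Nle (l := q^-1) ltac:(by rewrite invr_gt0).
rewrite (integral_gamma_comp_gexp (mX t t0) (lawX t t0) (@measurable_zeta_crit_sq R) _ fi); last first.
  by move=> x; rewrite zeta_crit_sqE sqr_ge0.
rewrite -EFinB abse_EFin lee_fin -/q.
have := gexp_sqr_zeta_sum_approx mass t100 Nge Nle; move: H; rewrite invrK.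
rewrite -/K1 -/K2 -q2; move: (gexp t _) (gexp t _) => G F.
rewrite -q2 in LL1; move: (ln (q ^+ 2)) LL1 => l l1 H1 H2.
clearbody K1 K2 q.
have G2 : G <= q ^+ 2 + K1 by move: H2; rewrite ler_norml => /andP[_]; lra.
have qG : q^-1 * G <= q + K1.
  rewrite mulrC ler_pdivrMr//; nra.
have HF : `|F - q ^+ 2| <= q + 2 * K1 + (1 + q) * K2.
  have -> : F - q ^+ 2 = (F - G) + (G - q ^+ 2) by ring.
  by apply: (le_trans (ler_normD _ _)); lra.
apply: (le_trans HF).
(* As [q >= 1], all terms are absorbed into a multiple of [q = sqrt (ln t)]; the factor
   [ln (ln t) >= 1] then only enlarges the bound. *)
apply: (@le_trans _ _ ((2 * K1 + 1 + 2 * K2) * q)).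
  by move: (K1) (K2) K10 K20 => a b a0 b0; nra.
rewrite ler_peMr// mulr_ge0//; last exact: ltW.
by have := K20; lra.
Unshelve. all: by end_near.
Qed.
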